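(* Let $G$ be a connected planar graph, directed or undirected, of minimum degree at least $3$, such that $\chi(v_1,w_1)=\chi(v_2,w_2)$ for all $(v_1,w_1),(v_2,w_2)\in E(G)$, where $\chi$ is the stable coloring of $V(G)^2$ computed by $2$-WL on $G$. Then one of the following holds: (A) $G$ is isomorphic to the graph of a tetrahedron ($K_4$), a cube, a dodecahedron, or an icosahedron; (B) the undirected version of $G$ is isomorphic to the graph of an octahedron, a cuboctahedron, or an icosidodecahedron; (C) the undirected version of $G$ is isomorphic to the graph of a cube, a rhombic dodecahedron, or a rhombic triacontahedron.
   Context: An undirected graph is identified with the directed graph containing both orientations $(v,w),(w,v)$ of each edge $vw$; so $E(G)$ is a set of ordered pairs. For a directed graph, $N(v)=\{w:(v,w)\in E\text{ or }(w,v)\in E\}$ and $\deg(v)=|N(v)|$. The undirected version of a directed graph $G$ has the same vertices and an edge $vw$ whenever $(v,w)\in E(G)$ or $(w,v)\in E(G)$. The 2-dimensional Weisfeiler–Leman algorithm (2-WL) on $G$ computes a coloring of $V(G)^2$: initially $\chi^0(v_1,v_2)=\chi^0(w_1,w_2)$ iff ($v_1=v_2\Leftrightarrow w_1=w_2$) and, for all $i,j\in\{1,2\}$, ($(v_i,v_j)\in E(G)\Leftrightarrow(w_i,w_j)\in E(G)$); then $\chi^{r+1}(v_1,v_2)=\big(\chi^r(v_1,v_2),\{\!\{(\chi^r(u,v_2),\chi^r(v_1,u)) : u\in V(G)\}\!\}\big)$; $\chi$ is the coloring obtained once the induced partition stops being refined. ''The graph of'' a polyhedron means its 1-skeleton.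 *)

(* Defs.v *)
From HB Require Import structures.
From mathcomp Require Import all_boot all_order all_algebra.
From mathcomp Require Import finmap multiset.
From mathcomp Require Import all_classical all_reals all_analysis.

Set Implicit Arguments.
Unset Strict Implicit.
Unset Printing Implicit Defensive.

Import Order.TTheory GRing.Theory Num.Theory.
Import numFieldNormedType.Exports.

Local Open Scope classical_set_scope.
Local Open Scope ring_scope.

(* A directed graph on V is a relation E : rel V; it is undirected when E is
   symmetric. *)
Section Graphs.
Variables (V : finType) (E : rel V).

Definition undirected : rel V := [rel v w | E v w || E w v].

Definition deg (v : V) : nat := #|[pred w | undirected v w]|.

Definition connected_graph : Prop :=
  (0 < #|V|)%N /\ forall v w : V, connect undirected v w.

End Graphs.

Definition graph_iso (V W : finType) (E : rel V) (F : rel W) : Prop :=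
  exists2 f : V -> W, bijective f & forall v w, F (f v) (f w) = E v w.

Section Planarity.
Variable R : realType.

Definition is_arc (x y : R * R) (S : set (R * R)) : Prop :=
  exists g : R -> R * R,
    [/\ {within `[0, 1], continuous g},
        {in `[0, 1] &, injective g},
        g 0 = x, g 1 = y & S = g @` `[0, 1]].

(* p places the vertices and A v w is the arc drawn for the edge vw. *)
Definition plane_drawing (V : finType) (E : rel V)
    (p : V -> R * R) (A : V -> V -> set (R * R)) : Prop :=
  [/\ injective p,
      forall v w, undirected E v w ->
        is_arc (p v) (p w) (A v w) /\ A v w = A w v,
      forall v w x, undirected E v w -> A v w (p x) -> x = v \/ x = w
    & forall v w v' w' z, undirected E v w -> undirected E v' w' ->
        A v w z -> A v' w' z ->
        [\/ (v, w) = (v', w'), (v, w) = (w', v')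
          | exists t, [/\ t = v \/ t = w, t = v' \/ t = w' & z = p t]]].

Definition planar (V : finType) (E : rel V) : Prop :=
  exists p : V -> R * R, exists A : V -> V -> set (R * R),
    plane_drawing E p A.

End Planarity.

(* The colors after r rounds form a type of their own, so that colors are
   literally pairs consisting of the old color and a multiset. *)
Fixpoint wl_color (r : nat) : choiceType :=
  match r with
  | 0 => (bool * (bool * bool * bool * bool))%type
  | r.+1 => (wl_color r * {mset (wl_color r * wl_color r)%type}%mset)%type
  end.

Section WeisfeilerLeman.
Variables (V : finType) (E : rel V).

Fixpoint wl (r : nat) : V * V -> wl_color r :=
  match r return V * V -> wl_color r with
  | 0 => fun p => (p.1 == p.2, (E p.1 p.1, E p.1 p.2, E p.2 p.1, E p.2 p.2))
  | r.+1 => fun p =>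
      (wl r p, seq_mset [seq (wl r (u, p.2), wl r (p.1, u)) | u <- enum V])
  end.

Definition wl_stable (r : nat) : bool :=
  [forall p, forall q, (wl r p == wl r q) ==> (wl r.+1 p == wl r.+1 q)].

Lemma ex_wl_stable : exists r, wl_stable r.
Proof.
pose m r := #|[pred x : (V * V) * (V * V) | wl r x.1 == wl r x.2]|.
suff H n r : (m r <= n)%N -> exists r, wl_stable r by exact: (H (m 0) 0).
elim: n r => [|n IHn] r mr.
  exists r; apply/forallP => p; apply/forallP => q; apply/implyP => pq.
  move: mr; rewrite leqn0 => /eqP/card0_eq/(_ (p, q)).
  by rewrite inE /= pq.
have [st|] := boolP (wl_stable r); first by exists r.
rewrite negb_forall => /existsP[p]; rewrite negb_forall => /existsP[q].
rewrite negb_imply => /andP[pq npq].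
apply: (IHn r.+1); rewrite -ltnS; apply: leq_trans mr.
apply/proper_card/properP; split.
  by apply/fintype.subsetP => x; rewrite !inE /= xpair_eqE => /andP[].
by exists (p, q); rewrite !inE.
Qed.

Definition wl_round : nat := ex_minn ex_wl_stable.

Definition chi : V * V -> wl_color wl_round := wl wl_round.

End WeisfeilerLeman.

(* Polyhedra are given by their usual Cartesian coordinates, which lie in
   Z[phi] with phi the golden ratio; (a, b) stands for a + b phi. *)
Definition zphi : Type := (int * int)%type.

(* phi ^ 2 = phi + 1 *)
Definition zphi_mul (x y : zphi) : zphi :=
  (x.1 * y.1 + x.2 * y.2, x.1 * y.2 + x.2 * y.1 + x.2 * y.2).

Definition zint (a : int) : zphi := (a, 0).
Definition phi : zphi := (0, 1).
Definition phi_inv : zphi := (-1, 1).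

Definition point : Type := (zphi * zphi * zphi)%type.

Definition dist2 (p q : point) : zphi :=
  let sq x := zphi_mul x x in
  sq (p.1.1 - q.1.1) + sq (p.1.2 - q.1.2) + sq (p.2 - q.2).

(* In each polyhedron below all edges have the same length, and this length is
   the least distance between two vertices; hence the 1-skeleton joins the
   pairs of vertices at squared distance d. *)
Definition skeleton (s : seq point) (d : zphi) : rel 'I_(size s) :=
  fun i j => dist2 (tnth (in_tuple s) i) (tnth (in_tuple s) j) == d.

Arguments skeleton : clear implicits.

Definition pm (x : zphi) : seq zphi := [:: x; - x].

Definition box (xs ys zs : seq zphi) : seq point :=
  [seq (xy, z) | xy <- [seq (x, y) | x <- xs, y <- ys], z <- zs].

Definition cyc (s : seq point) : seq point :=
  s ++ [seq (p.2, p.1.1, p.1.2) | p <- s] ++ [seq (p.1.2, p.2, p.1.1) | p <- s].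

Definition cube_vertices : seq point :=
  box (pm (zint 1)) (pm (zint 1)) (pm (zint 1)).

Definition dodecahedron_vertices : seq point :=
  cube_vertices ++ cyc (box [:: 0] (pm phi_inv) (pm phi)).

Definition tetrahedron_vertices : seq point :=
  [:: (zint 1, zint 1, zint 1); (zint 1, - zint 1, - zint 1);
      (- zint 1, zint 1, - zint 1); (- zint 1, - zint 1, zint 1)].

Definition octahedron_vertices : seq point :=
  cyc (box (pm (zint 1)) [:: 0] [:: 0]).

Definition icosahedron_vertices : seq point :=
  cyc (box [:: 0] (pm (zint 1)) (pm phi)).

Definition cuboctahedron_vertices : seq point :=
  cyc (box (pm (zint 1)) (pm (zint 1)) [:: 0]).

Definition icosidodecahedron_vertices : seq point :=
  cyc (box (pm (0, 2)) [:: 0] [:: 0]) ++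
  cyc (box (pm (zint 1)) (pm phi) (pm (1, 1))).

Definition rhombic_dodecahedron_vertices : seq point :=
  cube_vertices ++ cyc (box (pm (zint 2)) [:: 0] [:: 0]).

Definition rhombic_triacontahedron_vertices : seq point :=
  dodecahedron_vertices ++ cyc (box [:: 0] (pm phi) (pm (zint 1))).

Definition tetrahedron := skeleton tetrahedron_vertices (zint 8).
Definition cube := skeleton cube_vertices (zint 4).
Definition octahedron := skeleton octahedron_vertices (zint 2).
Definition dodecahedron := skeleton dodecahedron_vertices (8, - 4).
Definition icosahedron := skeleton icosahedron_vertices (zint 4).
Definition cuboctahedron := skeleton cuboctahedron_vertices (zint 2).
Definition icosidodecahedron := skeleton icosidodecahedron_vertices (zint 4).
Definition rhombic_dodecahedron :=
  skeleton rhombic_dodecahedron_vertices (zint 3).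
Definition rhombic_triacontahedron :=
  skeleton rhombic_triacontahedron_vertices (3, - 1).

(* Main.v *)
Require Import Defs.
From HB Require Import structures.
From mathcomp Require Import all_boot all_order all_algebra.
From mathcomp Require Import zify ring lra.

Set Implicit Arguments.
Unset Strict Implicit.
Unset Printing Implicit Defensive.

Import Order.TTheory GRing.Theory Num.Theory.

(* Call U the undirected version of G.  A plane drawing is discretized on a fine
   square lattice: vertices become labelled sets of lattice squares and an edge
   becomes a lattice walk crossing once from one label to the other.  The
   complementary regions give circulations that span the cycle space, each edge
   lying in at most two of them; this is Euler's formula as an inequality, and
   it bounds the number of edges of U in terms of the lengths of its cycles.

   Numbers of short walks between the ends of a pair are functions of its 2-WL
   color, hence constant on the edges of G.  So either U is regular of degree
   3, 4 or 5, or every vertex is a source or a sink and U is bipartite with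
   degrees (3, 3), (3, 4) or (3, 5).  Counting triangles, 4-cycles and 5-cycles
   leaves in each case only the local structure of one polyhedron; the others
   close up on too few vertices for Euler, except that one needs a K33 minor.

   The local structure turns the flags of U into a set acted on by the Coxeter
   group [p, 3] with p = 4 or 5.  That group has 48 or 120 elements, which gives
   a map from the polyhedron onto U; Euler's lower bound on the number of
   vertices makes it injective. *)
(** * Lattice models of drawings and their faces *)

Local Open Scope ring_scope.

(** On a lattice a divergence-free flow has a stream function, found by summing along columns, and
    it is constant on every region that the drawing leaves free. This is why region boundaries span
    the circulations. Regions enter only through these circulations; nothing says that a region is
    bounded by a cycle. Kirchhoff's law takes over: the support of a nonzero circulation has no
    vertex of degree one, so it has at least as many edges as the girth.

    Euler's inequality serves as a lower bound on the number of vertices for given degrees and cycle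
    lengths, and the polyhedra reached through flags attain it. Hence a map from such a polyhedron
    onto U is enough. The faces used to build the map are not those of the drawing either: they are
    short cycles, or other local figures, that the color counts show to be unique at a given corner.
    The Coxeter group acts as an upper bound: its relations leave at most 48 or 120 flags. *)

Definition pt : Type := (nat * nat)%type.
Definition rgt (x : pt) : pt := (x.1.+1, x.2).
Definition lft (x : pt) : pt := (x.1.-1, x.2).
Definition up (x : pt) : pt := (x.1, x.2.+1).
Definition dwn (x : pt) : pt := (x.1, x.2.-1).
Definition adj4 (x y : pt) : bool :=
  [|| y == rgt x, x == rgt y, y == up x | x == up y].
Definition step (x y : pt) : bool := (x == y) || adj4 x y.

(* mu labels lattice squares by vertices; the edge e is drawn as a lattice walk
   whose squares are first all labelled src e and then all labelled tgt e. *)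
Definition gridmodel (V I : finType) (src tgt : I -> V) : Prop :=
  exists (N : nat) (base : V -> pt) (mu : pt -> option V)
         (W1 W2 : I -> seq pt),
    (forall x v, mu x = Some v -> (0 < x.1 < N)%N && (0 < x.2 < N)%N) /\
    forall e, [/\ path step (base (src e)) (W1 e ++ W2 e),
      last (base (src e)) (W1 e ++ W2 e) = base (tgt e),
      {in base (src e) :: W1 e, forall x, mu x = Some (src e)},
      {in W2 e, forall x, mu x = Some (tgt e)} & W2 e != [::]].

(** * Flows on the lattice and their stream functions *)

Section Flows.
Variable F : realFieldType.

Section Potential.
Variable chi : pt -> F.
(** [chi x] is read as the value of a stream function at the upper right corner of the square [x].
    The step from [x] to [rgt x] passes between the corners of [x] and [dwn x], the step from [x] to
    [up x] between those of [lft x] and [x]. [Om] is the discrete curl: the flow along each step. *)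
Definition Hpot (x y : pt) : F :=
  (y == rgt x)%:R * (chi x - chi (dwn x)) +
  (y == up x)%:R * (chi (lft x) - chi x).
Definition Om (x y : pt) : F := Hpot x y - Hpot y x.

Lemma OmC x y : Om x y = - Om y x.
Proof. by rewrite /Om opprB. Qed.

Lemma Om_rgt x : Om x (rgt x) = chi x - chi (dwn x).
Proof.
have e1 : (rgt x == rgt x) = true by rewrite eqxx.
have e2 : (rgt x == up x) = false by apply/eqP => -[]; lia.
have e3 : (x == rgt (rgt x)) = false.
  by rewrite /eq_op /= /eq_op /=; lia.
have e4 : (x == up (rgt x)) = false.
  by rewrite /eq_op /= /eq_op /=; lia.
by rewrite /Om /Hpot e1 e2 e3 e4 !mul0r mul1r !addr0 ?subr0.
Qed.

Lemma Om_up x : Om x (up x) = chi (lft x) - chi x.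
Proof.
have e1 : (up x == up x) = true by rewrite eqxx.
have e2 : (up x == rgt x) = false by apply/eqP => -[]; lia.
have e3 : (x == rgt (up x)) = false.
  by rewrite /eq_op /= /eq_op /=; lia.
have e4 : (x == up (up x)) = false.
  by rewrite /eq_op /= /eq_op /=; lia.
by rewrite /Om /Hpot e1 e2 e3 e4 !mul0r mul1r !add0r ?subr0.
Qed.

Lemma Om_nadj x y : ~~ adj4 x y -> Om x y = 0.
Proof.
rewrite /adj4 !negb_or => /and4P[/negPf a /negPf b /negPf c /negPf d].
by rewrite /Om /Hpot a b c d !mul0r !addr0 ?subrr.
Qed.
End Potential.

Lemma Om_two x y : adj4 x y ->
  exists s t, [/\ forall chi : pt -> F, Om chi x y = chi s - chi t,
    (s.1 <= maxn x.1 y.1)%N && (s.2 <= maxn x.2 y.2)%N &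
    (t.1 <= maxn x.1 y.1)%N && (t.2 <= maxn x.2 y.2)%N].
Proof.
case/or4P => /eqP->.
- exists x, (dwn x); split=> /=; [by move=> chi; rewrite Om_rgt| |]; lia.
- exists (dwn y), y; split=> /=; [by move=> chi; rewrite OmC Om_rgt opprB| |]; lia.
- exists (lft x), x; split=> /=; [by move=> chi; rewrite Om_up| |]; lia.
- exists y, (lft y); split=> /=; [by move=> chi; rewrite OmC Om_up opprB| |]; lia.
Qed.

(** The unit flow along the step from [a] to [b], evaluated at the pair [(x, y)]. A stationary step
    carries no flow, so walks may pause. *)
Definition sf (a b x y : pt) : F :=
  ((a == x) && (b == y))%:R - ((a == y) && (b == x))%:R.

Fixpoint wf (x : pt) (W : seq pt) (u v : pt) : F :=
  if W is y :: W' then sf x y u v + wf y W' u v else 0.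

Lemma wf_cat x W W' u v : wf x (W ++ W') u v = wf x W u v + wf (last x W) W' u v.
Proof. by elim: W x => [|y W IH] x /=; rewrite ?add0r // IH addrA. Qed.

Lemma sfC a b x y : sf a b x y = - sf a b y x.
Proof. by rewrite /sf opprB. Qed.

Lemma wfC x W u v : wf x W u v = - wf x W v u.
Proof. by elim: W x => [|y W IH] x /=; rewrite ?oppr0 // opprD -sfC -IH. Qed.

Lemma sf_eq0 a b x y : sf a b x y != 0 -> (a == x) && (b == y) || (a == y) && (b == x).
Proof.
by rewrite /sf; case: (_ && _) => //=; case: (_ && _) => //=; rewrite subrr eqxx.
Qed.

Lemma wf_label (T : eqType) (mu : pt -> T) (l : T) x W u v :
  {in x :: W, forall z, mu z = l} -> wf x W u v != 0 -> mu u = l /\ mu v = l.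
Proof.
elim: W x => [|y W IH] x /= h; first by move/eqP.
have hx : mu x = l by apply: h; rewrite inE eqxx.
have hy : mu y = l by apply: h; rewrite !inE eqxx orbT.
have [->|ne] := eqVneq (sf x y u v) 0.
  by rewrite add0r; apply: IH => z zin; apply: h; rewrite inE zin orbT.
by move=> _; case/orP: (sf_eq0 ne) => /andP[/eqP <- /eqP <-].
Qed.

Definition ppos (z : pt) := (0 < z.1)%N && (0 < z.2)%N.

(** Positivity matters because [lft] and [dwn] truncate at 0, where a square would become its own
    neighbour. *)
Lemma nbsum (z y : pt) : ppos z -> ppos y ->
  ((y == rgt z) + (y == lft z) + (y == up z) + (y == dwn z))%N = adj4 z y.
Proof.
move=> /andP[z1 z2] /andP[y1 y2].
have E1 : (z == rgt y) = (y == lft z).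
  by case: z y z1 z2 y1 y2 => [z1 z2] [y1 y2] /= *; rewrite /eq_op /= /eq_op /=; lia.
have E2 : (z == up y) = (y == dwn z).
  by case: z y z1 z2 y1 y2 {E1} => [z1 z2] [y1 y2] /= *; rewrite /eq_op /= /eq_op /=; lia.
rewrite /adj4 E1 E2 {E1 E2}.
case: eqVneq => [->|_].
  have -> : (rgt z == lft z) = false by apply/eqP => -[]; lia.
  have -> : (rgt z == up z) = false by apply/eqP => -[]; lia.
  by have -> : (rgt z == dwn z) = false by apply/eqP => -[]; lia.
case: eqVneq => [->|_].
  have -> : (lft z == up z) = false by apply/eqP => -[]; lia.
  by have -> : (lft z == dwn z) = false by apply/eqP => -[]; lia.
case: eqVneq => [->|_] //.
by have -> : (up z == dwn z) = false by apply/eqP => -[]; lia.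
Qed.

Lemma sf_div x y z : step x y -> ppos x -> ppos y -> ppos z ->
  sf x y z (rgt z) + sf x y z (lft z) + sf x y z (up z) + sf x y z (dwn z)
  = (x == z)%:R - (y == z)%:R.
Proof.
move=> st px py pz.
have := nbsum pz px; have := nbsum pz py.
move=> /(congr1 (fun n => n%:R : F)); rewrite !natrD => hy.
move=> /(congr1 (fun n => n%:R : F)); rewrite !natrD => hx.
have -> : sf x y z (rgt z) + sf x y z (lft z) + sf x y z (up z) + sf x y z (dwn z)
  = (x == z)%:R * (adj4 z y)%:R - (y == z)%:R * (adj4 z x)%:R.
  rewrite -hx -hy /sf !(andbC _ (y == z)) -!mulnb !natrM; ring.
have adC a b : adj4 a b = adj4 b a.
  by rewrite /adj4; do !case: (_ == _).
have adI a : adj4 a a = false.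
  by case: a => a1 a2; rewrite /adj4 /eq_op /= /eq_op /=; lia.
case/orP: st => [/eqP <-|ad].
  by rewrite !subrr.
have [xz|xz] := eqVneq x z; have [yz|yz] := eqVneq y z.
- by move: ad; rewrite xz yz adI.
- by rewrite -xz ad mulr1 mul0r.
- by rewrite -yz adC ad mulr1 mul0r.
- by rewrite !mul0r.
Qed.

Lemma wf_div x W z : path step x W -> all ppos (x :: W) -> ppos z ->
  wf x W z (rgt z) + wf x W z (lft z) + wf x W z (up z) + wf x W z (dwn z)
  = (x == z)%:R - (last x W == z)%:R.
Proof.
move=> + + pz; elim: W x => [|y W IH] x /=; first by move=> *; rewrite subrr !addr0.
move=> /andP[st pW] /and3P[px py aW].
have /= := IH _ pW; rewrite py aW => /(_ isT).
have := sf_div st px py pz.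
set a1 := sf x y z (rgt z); set a2 := sf _ _ _ _; set a3 := sf _ _ _ _; set a4 := sf _ _ _ _.
set b1 := wf y W z (rgt z); set b2 := wf _ _ _ _; set b3 := wf _ _ _ _; set b4 := wf _ _ _ _.
move=> h1 h2.
have -> : a1 + b1 + (a2 + b2) + (a3 + b3) + (a4 + b4) =
  (a1 + a2 + a3 + a4) + (b1 + b2 + b3 + b4) by ring.
by rewrite h1 h2; ring.
Qed.

(** * Regions of a lattice model and their boundary circulations *)

Section Faces.
Variables (V I : finType) (src tgt : I -> V).
Hypothesis src_neq_tgt : forall e, src e != tgt e.
Hypothesis simple_edges : forall e e',
  (src e = src e' /\ tgt e = tgt e') \/ (src e = tgt e' /\ tgt e = src e') ->
  e = e'.

Definition circulation (z : I -> F) : Prop :=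
  forall v, \sum_(e | src e == v) z e = \sum_(e | tgt e == v) z e.

Variables (N : nat) (base : V -> pt) (mu : pt -> option V).
Variables (W1 W2 : I -> seq pt).
Hypothesis mu_box : forall x v, mu x = Some v ->
  (0 < x.1 < N)%N && (0 < x.2 < N)%N.
Hypothesis W_path : forall e, path step (base (src e)) (W1 e ++ W2 e).
Hypothesis W_last : forall e, last (base (src e)) (W1 e ++ W2 e) = base (tgt e).
Hypothesis W1_mu : forall e, {in base (src e) :: W1 e, forall x, mu x = Some (src e)}.
Hypothesis W2_mu : forall e, {in W2 e, forall x, mu x = Some (tgt e)}.
Hypothesis W2_neq0 : forall e, W2 e != [::].

Definition xe e := last (base (src e)) (W1 e).
Definition ye e := head (0, 0)%N (W2 e).

Lemma mu_xe e : mu (xe e) = Some (src e).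
Proof. by apply: W1_mu; rewrite /xe mem_last. Qed.

Lemma mu_ye e : mu (ye e) = Some (tgt e).
Proof.
apply: W2_mu; rewrite /ye; case: (W2 e) (W2_neq0 e) => //= a s _.
by rewrite inE eqxx.
Qed.

Lemma ye_cat e : W2 e = ye e :: behead (W2 e).
Proof. by rewrite /ye; case: (W2 e) (W2_neq0 e). Qed.

Lemma xe_ye e : adj4 (xe e) (ye e).
Proof.
have := W_path e; rewrite cat_path ye_cat /= => /and3P[_ + _].
case/orP => // /eqP h; move: (mu_xe e); rewrite /xe h mu_ye => -[] /esym/eqP.
by rewrite (negPf (src_neq_tgt e)).
Qed.

Definition wflow e := wf (base (src e)) (W1 e ++ W2 e).

(** A walk stays inside one label before its crossing and inside another after it, so between
    squares with different labels only the crossing contributes. *)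
Lemma wflowE e u v : mu u != mu v -> wflow e u v = sf (xe e) (ye e) u v.
Proof.
move=> ne; rewrite /wflow wf_cat -/(xe e) ye_cat /=.
have -> : wf (base (src e)) (W1 e) u v = 0.
  apply/eqP/negPn/negP => /(wf_label (@W1_mu e))[h1 h2].
  by rewrite h1 h2 eqxx in ne.
suff -> : wf (ye e) (behead (W2 e)) u v = 0 by rewrite add0r addr0.
apply/eqP/negPn/negP => h.
have hl : {in ye e :: behead (W2 e), forall x, mu x = Some (tgt e)}.
  by rewrite -ye_cat; exact: W2_mu.
have [h1 h2] := wf_label hl h.
by rewrite h1 h2 eqxx in ne.
Qed.

Lemma mu_xeye e : mu (xe e) != mu (ye e).
Proof.
by rewrite mu_xe mu_ye; apply: contra (src_neq_tgt e) => /eqP[->].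
Qed.

(** The labels at a crossing name both ends of its edge, so simplicity of the graph keeps the
    crossings of distinct edges apart. *)
Lemma sf_xeye e e' : sf (xe e) (ye e) (xe e') (ye e') = (e == e')%:R.
Proof.
rewrite /sf; have [->|ne] := eqVneq e e'.
  rewrite !eqxx /=; case: eqP => [h|]; last by rewrite subr0.
  by have := mu_xeye e'; rewrite h eqxx.
have -> : (xe e == xe e') && (ye e == ye e') = false.
  apply/negP => /andP[/eqP h1 /eqP h2]; case/eqP: ne; apply: simple_edges; left.
  move: (mu_xe e) (mu_ye e); rewrite h1 h2 mu_xe mu_ye.
  by move=> [->] [->].
have -> : (xe e == ye e') && (ye e == xe e') = false.
  apply/negP => /andP[/eqP h1 /eqP h2]; case/eqP: ne; apply: simple_edges; right.
  move: (mu_xe e) (mu_ye e); rewrite h1 h2 mu_xe mu_ye.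
  by move=> [->] [->].
by rewrite subr0.
Qed.

Definition cross (u v : pt) :=
  [exists e, ((xe e == u) && (ye e == v)) || ((xe e == v) && (ye e == u))].
(** The pairs of squares that flow may use. All pairs inside one label count, so that the squares of
    a vertex form a solid block in which the walks of different edges may overlap. *)
Definition wall (u v : pt) := (mu u == mu v) && (mu u != None) || cross u v.

Lemma crossC u v : cross u v = cross v u.
Proof. by apply: eq_existsb => e; rewrite orbC. Qed.

Lemma wallC u v : wall u v = wall v u.
Proof.
rewrite /wall crossC; congr (_ || _); rewrite eq_sym.
by case: eqP => //= ->.
Qed.

Lemma sf_ncross e u v : ~~ cross u v -> sf (xe e) (ye e) u v = 0.
Proof.
move=> nc; apply/eqP/negPn/negP => /sf_eq0 h; case/negP: nc.
by apply/existsP; exists e.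
Qed.

Lemma wflow_nwall e u v : ~~ wall u v -> wflow e u v = 0.
Proof.
rewrite negb_or negb_and negbK => /andP[h nc].
have [mm|mm] := boolP (mu u == mu v); last by rewrite wflowE // sf_ncross.
move: h; rewrite mm /= => /eqP mu0.
rewrite /wflow wf_cat ye_cat /= sf_ncross // add0r.
rewrite [X in X + _](_ : _ = 0) ?add0r; last first.
  by apply/eqP/negPn/negP => /(wf_label (@W1_mu e))[]; rewrite mu0.
apply/eqP/negPn/negP => h.
have hl : {in ye e :: behead (W2 e), forall x, mu x = Some (tgt e)}.
  by rewrite -ye_cat; exact: W2_mu.
by have [] := wf_label hl h; rewrite mu0.
Qed.

Lemma W_pos e : all ppos (base (src e) :: W1 e ++ W2 e).
Proof.
apply/allP => x; rewrite -cat_cons mem_cat => /orP[/W1_mu|/W2_mu];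
by move/mu_box; rewrite /ppos => /andP[/andP[-> _] /andP[-> _]].
Qed.

Lemma wflow_box e u v : wflow e u v != 0 -> ppos u && ppos v.
Proof.
rewrite /wflow; have := W_pos e; move: (base _) (_ ++ _) => x W.
elim: W x => [|y W IH] x /=; first by rewrite eqxx.
move=> /and3P[px py aW].
have [->|ne _] := eqVneq (sf x y u v) 0.
  by rewrite add0r; apply: IH; rewrite /= py.
by case/orP: (sf_eq0 ne) => /andP[/eqP <- /eqP <-]; rewrite px py.
Qed.

Section Span.
Variable z : I -> F.
Hypothesis zC : circulation z.

Definition om u v := \sum_e z e * wflow e u v.

Lemma omC u v : om u v = - om v u.
Proof. by rewrite -sumrN; apply: eq_bigr => e _; rewrite /wflow wfC mulrN. Qed.

Lemma om_box u v : ~~ (ppos u && ppos v) -> om u v = 0.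
Proof.
move=> nb; apply: big1 => e _; have [->|/wflow_box] := eqVneq (wflow e u v) 0.
  by rewrite mulr0.
by rewrite (negPf nb).
Qed.

Lemma om_nwall u v : ~~ wall u v -> om u v = 0.
Proof. by move=> nw; apply: big1 => e _; rewrite wflow_nwall ?mulr0. Qed.

Lemma om_xeye e : om (xe e) (ye e) = z e.
Proof.
rewrite /om (bigD1 e) //= wflowE ?mu_xeye // sf_xeye eqxx mulr1.
rewrite big1 ?addr0 // => e' ne.
by rewrite wflowE ?mu_xeye // sf_xeye (negPf ne) mulr0.
Qed.

(** Each walk runs from base to base, so the divergence at a square collects Kirchhoff's law over
    all vertices based there. *)
Lemma om_div x : ppos x ->
  om x (rgt x) + om x (lft x) + om x (up x) + om x (dwn x) = 0.
Proof.
move=> px; rewrite /om -!big_split /=.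
rewrite (eq_bigr (fun e => \sum_v (base v == x)%:R *
   ((src e == v)%:R * z e - (tgt e == v)%:R * z e))); last first.
  move=> e _; rewrite -!mulrDr.
  rewrite -[X in z e * X = _]/(_ + wf _ _ _ _).
  rewrite (wf_div (W_path e) (W_pos e) px) W_last.
  under eq_bigr do rewrite mulrBr.
  rewrite sumrB mulrBr; congr (_ - _).
    rewrite (bigD1 (src e)) //= eqxx mul1r big1 ?addr0 1?mulrC //.
    by move=> v; rewrite eq_sym => /negPf ->; rewrite mul0r mulr0.
  rewrite (bigD1 (tgt e)) //= eqxx mul1r big1 ?addr0 1?mulrC //.
  by move=> v; rewrite eq_sym => /negPf ->; rewrite mul0r mulr0.
rewrite exchange_big big1 //= => v _.
rewrite -mulr_sumr sumrB.
have E (f : I -> V) : \sum_i (f i == v)%:R * z i = \sum_(i | f i == v) z i.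
  rewrite [RHS]big_mkcond; apply: eq_bigr => i _.
  by case: ifP => _; rewrite ?mul1r ?mul0r.
by rewrite !E zC subrr mulr0.
Qed.

(** The stream function of [om]: the total flow to the right that passes below the corner of [x].
    Squares with a coordinate 0 carry no flow, which fixes the constant of integration. *)
Definition cpot (x : pt) : F := \sum_(j < x.2.+1) om (x.1, val j) (x.1.+1, val j).

Lemma cpot_rgt x : (0 < x.2)%N -> om x (rgt x) = cpot x - cpot (dwn x).
Proof.
case: x => i [|j] // _; rewrite /cpot /= [in X in _ = X - _]big_ord_recr /=.
by rewrite addrAC subrr add0r.
Qed.

(** Induction on the height: vanishing divergence at one square carries the identity from one row to
    the next, starting from the empty row 0. *)
Lemma cpot_up x : (0 < x.1)%N -> om x (up x) = cpot (lft x) - cpot x.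
Proof.
case: x => -[//|i] j _; elim: j => [|j IH].
  rewrite /cpot /= !big_ord_recl !big_ord0 /= !addr0.
  by rewrite !om_box ?subr0 // /ppos /= ?andbF.
have := @om_div (i.+1, j.+1) isT.
rewrite [om _ (dwn _)]omC [om (i.+1, j.+1) (lft _)]omC IH /lft /= /dwn /=.
have := @cpot_rgt (i.+1, j.+1) isT; have := @cpot_rgt (i, j.+1) isT.
rewrite /dwn /rgt /= => -> ->.
move=> h; apply/eqP; rewrite -subr_eq0; apply/eqP; rewrite -[RHS]h; ring.
Qed.

Lemma om_Om x y : ppos x -> ppos y -> adj4 x y -> om x y = Om cpot x y.
Proof.
move=> /andP[x1 x2] /andP[y1 y2]; case/or4P => /eqP E; rewrite E.
- by rewrite Om_rgt cpot_rgt.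
- by rewrite OmC Om_rgt omC cpot_rgt.
- by rewrite Om_up cpot_up.
- by rewrite OmC Om_up omC cpot_up.
Qed.
End Span.

Definition square : finType := ('I_N.+1 * 'I_N.+1)%type.
Definition qp (s : square) : pt := (val s.1, val s.2).
Definition sq (x : pt) : square := (inord x.1, inord x.2).

Lemma qpK : cancel qp sq.
Proof. by case=> i j; rewrite /sq /= !inord_val. Qed.

Lemma sqK x : (x.1 <= N)%N -> (x.2 <= N)%N -> qp (sq x) = x.
Proof. by case: x => i j /= hi hj; rewrite /qp /= !inordK. Qed.

(** Here [s] and [t] stand for corners, as in [Om]. Neighbouring corners are joined unless the step
    passing between them is a wall; the components are the regions left free by the drawing. *)
Definition fr (s t : square) :=
  (qp t == up (qp s)) && ~~ wall (qp t) (rgt (qp t)) ||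
  (qp t == rgt (qp s)) && ~~ wall (qp t) (up (qp t)).
Definition free_adj : rel square := [rel s t | fr s t || fr t s].
Definition cls (x : pt) : square := fingraph.root free_adj (sq x).

Lemma fr_csym : connect_sym free_adj.
Proof. by apply: sym_connect_sym => s t; rewrite /free_adj /= orbC. Qed.

Lemma cls_rgt x : (x.1 <= N)%N -> (0 < x.2 <= N)%N -> ~~ wall x (rgt x) ->
  cls x = cls (dwn x).
Proof.
move=> h1 /andP[h2 h2'] nw; apply/eqP; rewrite /cls (root_connect fr_csym); apply: connect1.
have h3 : ((dwn x).2 <= N)%N by rewrite /=; lia.
rewrite /free_adj /fr /= (sqK h1 h2') (sqK (x := dwn x) h1 h3).
have -> : x == up (dwn x) by case: (x) h2 => a [].
by rewrite nw orbT.
Qed.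

Lemma cls_up x : (0 < x.1 <= N)%N -> (x.2 <= N)%N -> ~~ wall x (up x) ->
  cls x = cls (lft x).
Proof.
move=> /andP[h1 h1'] h2 nw; apply/eqP; rewrite /cls (root_connect fr_csym); apply: connect1.
have h3 : ((lft x).1 <= N)%N by rewrite /=; lia.
rewrite /free_adj /fr /= (sqK h1' h2) (sqK (x := lft x) h3 h2).
have -> : x == rgt (lft x) by case: (x) h1 => -[].
by rewrite nw !orbT.
Qed.

Definition fpot (C : square) (x : pt) : F := (cls x == C)%:R.
(** The curl of the indicator of a region, read off at the crossings, is the oriented boundary of
    the region. An index that is not the root of a component gives 0. *)
Definition face (C : square) : I -> F := fun e => Om (fpot C) (xe e) (ye e).

Definition inner (x : pt) := (0 < x.1 < N)%N && (0 < x.2 < N)%N.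

Lemma Om_nwall C x y : inner x -> ~~ wall x y -> Om (fpot C) x y = 0.
Proof.
move=> /andP[/andP[x1 x1'] /andP[x2 x2']] nw.
have [|na] := boolP (adj4 x y); last by rewrite Om_nadj.
case/or4P => /eqP E.
- by rewrite E Om_rgt /fpot cls_rgt ?subrr // -?E //; first lia; apply/andP; split; lia.
- rewrite E in x1 x1' x2 x2' nw *; rewrite wallC in nw.
  by rewrite OmC Om_rgt /fpot cls_rgt ?subrr ?oppr0 //; move: x1 x1' x2 x2' => /=; lia.
- by rewrite E Om_up /fpot (cls_up (x := x)) ?subrr // -?E //; [apply/andP; split; lia|lia].
- rewrite E in x1 x1' x2 x2' nw *; rewrite wallC in nw.
  by rewrite OmC Om_up /fpot (cls_up (x := y)) ?subrr ?oppr0 //; move: x1 x1' x2 x2' => /=; lia.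
Qed.

Lemma Om_cross C x y : inner x -> mu x != mu y ->
  Om (fpot C) x y = \sum_e face C e * sf (xe e) (ye e) x y.
Proof.
move=> bx ne.
have D e0 : \sum_e face C e * sf (xe e) (ye e) (xe e0) (ye e0) = face C e0.
  rewrite (bigD1 e0) //= sf_xeye eqxx mulr1 big1 ?addr0 // => e ne0.
  by rewrite sf_xeye (negPf ne0) mulr0.
have [|nc] := boolP (cross x y).
  case/existsP => e0 /orP[] /andP[/eqP <- /eqP <-]; first by rewrite D.
  rewrite OmC -[in LHS]/(face C e0) -D -sumrN.
  by apply: eq_bigr => e _; rewrite -mulrN -sfC.
rewrite Om_nwall //; last by rewrite /wall (negPf ne).
by rewrite big1 // => e _; rewrite sf_ncross ?mulr0.
Qed.

Lemma sum_delta (f : square -> F) (x : pt) : (x.1 <= N)%N -> (x.2 <= N)%N ->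
  \sum_(s : square) (qp s == x)%:R * f s = f (sq x).
Proof.
move=> h1 h2; rewrite (bigD1 (sq x)) //= sqK // eqxx mul1r big1 ?addr0 //.
move=> s ne; case: eqP => [E|]; last by rewrite mul0r.
by rewrite -E qpK eqxx in ne.
Qed.

Lemma Om_div chi x : inner x -> \sum_(s : square) Om chi x (qp s) = 0.
Proof.
move=> /andP[/andP[x1 x1'] /andP[x2 x2']].
rewrite /Om sumrB /Hpot !big_split /=.
rewrite -[\sum_(s : square) (qp s == rgt x)%:R * _]mulr_suml.
rewrite -[\sum_(s : square) (qp s == up x)%:R * _]mulr_suml.
have S1 y : (y.1 <= N)%N -> (y.2 <= N)%N ->
    \sum_(s : square) (qp s == y)%:R = 1 :> F.
  by move=> *; rewrite -[RHS](sum_delta (fun=> 1) (x := y)) //;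
     apply: eq_bigr => s _; rewrite mulr1.
rewrite !S1 ?mul1r //=; try lia.
rewrite (eq_bigr (fun s => (qp s == lft x)%:R * (chi (qp s) - chi (dwn (qp s))))).
  rewrite [X in _ - (_ + X) = _](eq_bigr (fun s : square =>
    (qp s == dwn x)%:R * (chi (lft (qp s)) - chi (qp s)))).
    rewrite !sum_delta ?sqK //=; try lia.
    rewrite /lft /dwn /=; ring.
  move=> s _; congr (_%:R * _); congr (nat_of_bool _).
  by apply/eqP/eqP => [->|->] //; move: x2; case: (x) => a [].
move=> s _; congr (_%:R * _); congr (nat_of_bool _).
by apply/eqP/eqP => [->|->] //; move: x1; case: (x) => -[].
Qed.

Lemma sum_sf v e :
  \sum_(s : square | mu (qp s) == Some v) \sum_(t : square | mu (qp t) != Some v)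
     sf (xe e) (ye e) (qp s) (qp t) = (src e == v)%:R - (tgt e == v)%:R.
Proof.
have bx : ((xe e).1 <= N)%N && ((xe e).2 <= N)%N.
  by have := mu_box (mu_xe e); lia.
have by' : ((ye e).1 <= N)%N && ((ye e).2 <= N)%N.
  by have := mu_box (mu_ye e); lia.
have key (a b : pt) (P R : pred pt) : (a.1 <= N)%N && (a.2 <= N)%N ->
   (b.1 <= N)%N && (b.2 <= N)%N ->
   \sum_(s : square | P (qp s)) \sum_(t : square | R (qp t))
     ((a == qp s) && (b == qp t))%:R = (P a && R b)%:R :> F.
  move=> /andP[a1 a2] /andP[b1 b2].
  rewrite big_mkcond /=.
  rewrite (eq_bigr (fun s : square => (qp s == a)%:R * (P a && R b)%:R)).
    by rewrite sum_delta.
  move=> s _; rewrite eq_sym; case: eqP => [->|_]; last first.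
    by rewrite mul0r; case: ifP => // _; rewrite big1.
  rewrite mul1r; case: (P a) => //=.
  rewrite big_mkcond /= -[RHS](@sum_delta (fun=> (R b)%:R) b) //.
  apply: eq_bigr => t _; rewrite eq_sym; case: eqP => [->|_].
    by rewrite mul1r; case: (R b).
  by rewrite mul0r; case: ifP.
under eq_bigr do rewrite sumrB.
rewrite sumrB (key _ _ (fun x => mu x == Some v) (fun x => mu x != Some v)) //.
under [X in _ - X]eq_bigr do under eq_bigr do rewrite andbC.
rewrite (key _ _ (fun x => mu x == Some v) (fun x => mu x != Some v)) //.
rewrite mu_xe mu_ye.
have E (a b : V) : (Some a == Some b) = (a == b) by [].
rewrite !E; have := src_neq_tgt e.
by case: (src e =P v) => [->|_]; case: (tgt e =P v) => [->|_]; rewrite ?eqxx.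
Qed.

(** Sum the divergence over all squares labelled [v]. Pairs inside the label cancel by antisymmetry,
    and pairs leaving it contribute exactly the crossings at [v]. *)
Lemma face_circulation C : circulation (face C).
Proof.
move=> v; apply/eqP; rewrite -subr_eq0; apply/eqP.
have h0 : \sum_(s : square | mu (qp s) == Some v) \sum_(t : square)
     Om (fpot C) (qp s) (qp t) = 0.
  by apply: big1 => s /eqP m; rewrite Om_div // /inner (mu_box m).
have h1 : \sum_(s : square | mu (qp s) == Some v)
      \sum_(t : square | mu (qp t) == Some v) Om (fpot C) (qp s) (qp t) = 0.
  set T := (X in X = 0); have : T = - T.
    rewrite {1}/T exchange_big /= -sumrN; apply: eq_bigr => s _.
    by rewrite -sumrN; apply: eq_bigr => t _; rewrite OmC.
  by move=> h; lra.
have h2 : \sum_(s : square | mu (qp s) == Some v)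
      \sum_(t : square | mu (qp t) != Some v) Om (fpot C) (qp s) (qp t) = 0.
  rewrite -[RHS]h0 -[LHS]add0r -{1}h1 -big_split /=; apply: eq_bigr => s _.
  by rewrite [RHS](bigID (fun t : square => mu (qp t) == Some v)).
rewrite -[RHS]h2.
under [RHS]eq_bigr => s /eqP m.
  under eq_bigr => t m' do
    rewrite Om_cross ?m 1?eq_sym // ?/inner ?(mu_box m) //.
  rewrite exchange_big /=.
  over.
rewrite exchange_big /=.
under [RHS]eq_bigr do under eq_bigr do rewrite -mulr_sumr.
under [RHS]eq_bigr do rewrite -mulr_sumr sum_sf mulrBr.
rewrite [RHS]sumrB; congr (_ - _); rewrite big_mkcond; apply: eq_bigr => e _.
  by case: eqP; rewrite ?mulr1 ?mulr0.
by case: eqP; rewrite ?mulr1 ?mulr0.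
Qed.

Lemma face_two e : exists s t, forall C, face C e = (s == C)%:R - (t == C)%:R.
Proof.
have [s [t [h _ _]]] := Om_two (xe_ye e).
by exists (cls s), (cls t) => C; rewrite /face h.
Qed.

(** The stream function of a circulation cannot jump where no flow passes, so it is constant on each
    region, and its value there is the coefficient of that region. *)
Lemma face_span z : circulation z ->
  exists k : square -> F, forall e, z e = \sum_C k C * face C e.
Proof.
move=> zC; exists (fun C => cpot z (qp C)) => e.
have [px py] : ppos (xe e) /\ ppos (ye e).
  by have := mu_box (mu_xe e); have := mu_box (mu_ye e); rewrite /ppos; lia.
rewrite -om_xeye om_Om ?xe_ye //.
have [s [t [h bs bt]]] := Om_two (xe_ye e).
have bxy : (maxn (xe e).1 (ye e).1 <= N)%N && (maxn (xe e).2 (ye e).2 <= N)%N.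
  by have := mu_box (mu_xe e); have := mu_box (mu_ye e); lia.
rewrite h; under eq_bigr do rewrite /face h mulrBr.
have key x : (x.1 <= N)%N -> (x.2 <= N)%N ->
    \sum_C cpot z (qp C) * fpot C x = cpot z x.
  move=> x1 x2; rewrite (bigD1 (cls x)) //= /fpot eqxx mulr1 big1 ?addr0.
    rewrite -[in RHS](sqK x1 x2).
    have : connect free_adj (sq x) (cls x) by apply: connect_root.
    case/connectP => p + ->; elim: p (sq x) => [|q p IH] s0 //=.
    case/andP => sq0 pp; rewrite (IH _ pp) {p pp IH}.
    suff K s1 s2 : fr s1 s2 -> cpot z (qp s1) = cpot z (qp s2).
      by case/orP: sq0 => /K.
    case/orP => /andP[/eqP E nw].
      have := @cpot_rgt z (qp s2); rewrite om_nwall // E /= => /(_ isT).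
      by move=> /esym/subr0_eq ->.
    have := @cpot_up z zC (qp s2); rewrite om_nwall // E /= => /(_ isT).
    by move=> /esym/subr0_eq <-.
  by move=> C; rewrite eq_sym => /negPf ->; rewrite mulr0.
by rewrite sumrB !key //; lia.
Qed.
End Faces.
End Flows.

Theorem gridmodel_faces (F : realFieldType) (V I : finType) (src tgt : I -> V) :
  gridmodel src tgt -> (forall e, src e != tgt e) ->
  (forall e e', (src e = src e' /\ tgt e = tgt e') \/
                (src e = tgt e' /\ tgt e = src e') -> e = e') ->
  exists (Q : finType) (face : Q -> I -> F),
    [/\ forall C, circulation src tgt (face C),
       forall z, circulation src tgt z ->
         exists k : Q -> F, forall e, z e = \sum_C k C * face C e
     & forall e, exists s t, forall C, face C e = (s == C)%:R - (t == C)%:R].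
Proof.
case=> N [base [mu [W1 [W2 [box H]]]]] nst simple.
have h1 e : path step (base (src e)) (W1 e ++ W2 e) by case: (H e).
have h2 e : last (base (src e)) (W1 e ++ W2 e) = base (tgt e) by case: (H e).
have h3 e : {in base (src e) :: W1 e, forall x, mu x = Some (src e)} by case: (H e).
have h4 e : {in W2 e, forall x, mu x = Some (tgt e)} by case: (H e).
have h5 e : W2 e != [::] by case: (H e).
exists (square N), (@face F V I src N base mu W1 W2); split.
- exact: face_circulation.
- exact: face_span.
- by move=> e; apply: face_two.
Qed.

(** * The cycle space and Euler's inequality *)

Section FreeSubfamily.
Variables (K : fieldType) (vT : vectType K) (Q : eqType) (b : Q -> vT).

Lemma free_subfamily (s : seq Q) : exists t : seq Q,
  [/\ subseq t s, free (map b t) & <<map b t>>%VS = <<map b s>>%VS].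
Proof.
elim: s => [|C s [t [sub fr sp]]]; first by exists [::]; rewrite /= nil_free.
have [inC|ninC] := boolP (b C \in <<map b t>>%VS).
  exists t; split=> //; first exact: subseq_trans sub (subseq_cons _ _).
  rewrite /= span_cons -sp; apply/esym/addv_idPr.
  by rewrite -memvE.
exists (C :: t); split=> /=; first by rewrite eqxx.
  by rewrite free_cons ninC fr.
by rewrite !span_cons sp.
Qed.

Lemma free_coef (t : seq Q) (k : Q -> K) : free (map b t) -> uniq t ->
  \sum_(C <- t) k C *: b C = 0 -> {in t, forall C, k C = 0}.
Proof.
elim: t => [|C t IH] //=; rewrite free_cons => /andP[nin fr] /andP[_ un].
rewrite big_cons => h.
have sin : \sum_(C <- t) k C *: b C \in <<map b t>>%VS.
  rewrite big_seq; apply: memv_suml => D Dt; apply: memvZ; apply: memv_span.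
  exact: map_f.
have kC : k C = 0.
  apply/eqP; apply: contraR nin => kC0.
  have -> : b C = - (k C)^-1 *: \sum_(C <- t) k C *: b C.
    move/eqP: h; rewrite addr_eq0 => /eqP h.
    by rewrite scaleNr -scalerN -h scalerA mulVf // scale1r.
  exact: memvZ.
move: h; rewrite kC scale0r add0r => h D; rewrite inE => /orP[/eqP->//|].
exact: IH.
Qed.
End FreeSubfamily.

Section Incidence.
Variables (V I : finType) (src tgt : I -> V).
Let U1 : vectType rat := {ffun I -> rat^o}.
Let U0 : vectType rat := {ffun V -> rat^o}.

Definition bdry (z : U1) : U0 :=
  [ffun v => \sum_(e | src e == v) z e - \sum_(e | tgt e == v) z e].

Lemma bdry_linear : linear bdry.
Proof.
move=> a x y; apply/ffunP => v; rewrite !ffunE /=.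
under eq_bigr do rewrite !ffunE.
under [X in _ - X = _]eq_bigr do rewrite !ffunE.
rewrite !big_split /= -!scaler_sumr scalerBr.
by rewrite opprD addrACA.
Qed.
HB.instance Definition _ := GRing.isLinear.Build _ _ _ _ bdry bdry_linear.

Definition total (y : U0) : rat^o := \sum_v y v.
Lemma total_linear : linear total.
Proof.
move=> a x y; rewrite /total scaler_sumr -big_split /=.
by apply: eq_bigr => v _; rewrite !ffunE.
Qed.
HB.instance Definition _ := GRing.isLinear.Build _ _ _ _ total total_linear.

Lemma dim_ffun (T : finType) : \dim (fullv : {vspace {ffun T -> rat^o}}) = #|T|.
Proof. by rewrite dimvf /dim /= muln1. Qed.

Lemma total_bdry z : total (bdry z) = 0.
Proof.
rewrite /total; under eq_bigr do rewrite ffunE.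
have E (f : I -> V) : \sum_v \sum_(e | f e == v) z e = \sum_e z e.
  under eq_bigr do rewrite big_mkcond.
  rewrite exchange_big; apply: eq_bigr => e _.
  rewrite (bigD1 (f e)) //= eqxx big1 ?addr0 // => v; rewrite eq_sym.
  by move=> /negPf ->.
by rewrite sumrB !E subrr.
Qed.

(** Boundaries have total 0, so they span at most [#|V| - 1] dimensions; rank and nullity do the
    rest. *)
Lemma dim_cycles : (0 < #|V|)%N -> (#|I| + 1 <= \dim (lker (linfun bdry)) + #|V|)%N.
Proof.
move=> V0.
have := limg_ker_dim (linfun bdry) fullv; rewrite capfv dim_ffun => <-.
have := limg_ker_dim (linfun total) fullv; rewrite capfv dim_ffun => h.
have h1 : (0 < \dim (linfun total @: fullv))%N.
  rewrite lt0n dimv_eq0; apply/eqP => h0.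
  have /card_gt0P [v _] := V0.
  pose d : U0 := [ffun w => (w == v)%:R].
  have : linfun total d \in (linfun total @: fullv)%VS by rewrite memv_img ?memvf.
  rewrite h0 memv0 lfunE /= /total (bigD1 v) //= ffunE eqxx big1 ?addr0.
    by rewrite oner_eq0.
  by move=> w /negPf; rewrite ffunE => ->.
have h2 : (\dim (linfun bdry @: fullv) <= \dim (lker (linfun total)))%N.
  apply: dimvS; apply/subvP => y /memv_imgP[z _ ->].
  by rewrite memv_ker !lfunE /= total_bdry.
lia.
Qed.
End Incidence.

Definition supp (I : finType) (z : I -> rat) := #|[pred e | z e != 0]|.

(** [L] is a maximal independent family of faces together with minus their sum, which plays the
    outer face. Independence makes the members nonzero and pairwise non-proportional; for this
    [#|V| < #|I|] provides at least two independent faces. An edge lies between two regions, and the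
    added circulation meets it only if exactly one of them was selected, hence the bound by 2 per
    edge. *)
Theorem euler_faces (V I : finType) (src tgt : I -> V) :
  gridmodel src tgt -> (forall e, src e != tgt e) ->
  (forall e e', (src e = src e' /\ tgt e = tgt e') \/
                (src e = tgt e' /\ tgt e = src e') -> e = e') ->
  (0 < #|V| < #|I|)%N ->
  exists L : seq (I -> rat),
  [/\ (#|I| + 2 <= size L + #|V|)%N,
      forall i, (i < size L)%N -> circulation src tgt (nth (fun=> 0) L i),
      forall i, (i < size L)%N -> (0 < supp (nth (fun=> 0%R) L i))%N,
      (\sum_(z <- L) supp z <= 2 * #|I|)%N &
      forall i j a c, (i < j < size L)%N ->
        (forall e, a * nth (fun=> 0) L i e = c * nth (fun=> 0) L j e) -> a = 0].
Proof.
move=> gm nst simple /andP[V0 VI].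
have [Q [face [fcirc fspan ftwo]]] := gridmodel_faces rat gm nst simple.
pose b (C : Q) : {ffun I -> rat^o} := [ffun e => face C e].
have [t [sub fr sp]] := free_subfamily b (enum Q).
have un : uniq t by apply: subseq_uniq sub (enum_uniq Q).
have szt : (#|I| + 1 <= size t + #|V|)%N.
  apply: leq_trans (dim_cycles src tgt V0) _; rewrite leq_add2r.
  have -> : size t = \dim <<map b t>>%VS by rewrite (eqP fr) size_map.
  apply: dimvS; apply/subvP => z; rewrite memv_ker lfunE /= => /eqP z0.
  have [|k hk] := fspan z.
    by move=> v; move/ffunP/(_ v): z0; rewrite !ffunE => /subr0_eq.
  have -> : z = \sum_C k C *: b C.
    apply/ffunP => e; rewrite hk sum_ffunE; apply: eq_bigr => C _.
    by rewrite !ffunE.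
  rewrite sp -big_enum /=; rewrite big_seq; apply: memv_suml => C Cin.
  by apply/memvZ/memv_span/map_f.
have szt2 : (1 < size t)%N by lia.
have coef k : (forall e, \sum_(C <- t) k C * face C e = 0) -> {in t, forall C, k C = 0}.
  move=> h; apply: (free_coef fr un); apply/ffunP => e.
  rewrite sum_ffunE [RHS]ffunE -[RHS](h e); apply: eq_bigr => C _.
  by rewrite !ffunE.
pose f0 : I -> rat := fun e => - \sum_(C <- t) face C e.
pose L := f0 :: map face t.
have sum1 C0 e : C0 \in t -> \sum_(C <- t) (C == C0)%:R * face C e = face C0 e.
  move=> C0t; rewrite (bigD1_seq C0) //= eqxx mul1r big1 ?addr0 //.
  by move=> C /negPf->; rewrite mul0r.
have [C1 C1t] : exists C1, C1 \in t.
  by case: (t) szt2 => // C s _; exists C; rewrite inE eqxx.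
have indep i j a c : (i < j < size L)%N ->
    (forall e, a * nth (fun=> 0) L i e = c * nth (fun=> 0) L j e) -> a = 0.
  case: j => [|j]; first by rewrite ltn0.
  rewrite /= size_map => /andP[ij jt] h.
  pose D := nth C1 t j; have Dt : D \in t by apply: mem_nth.
  have hj e : nth (fun=> 0) (map face t) j e = face D e by rewrite (nth_map C1).
  case: i ij h => [_|i ij] h.
    (* In a relation between [f0] and the face [D], any other selected face [D'] has coefficient
       [a]. *)
    have [D' D't DD'] : exists2 D', D' \in t & D' != D.
      exists (nth C1 t (if j == 0 then 1 else 0)%N).
        by apply: mem_nth; case: ifP; lia.
      by rewrite nth_uniq //; move: jt szt2; case: (j) => [|j'] //= *; lia.
    have := coef (fun C => a + (C == D)%:R * c).
    move=> /(_ _ D' D't); rewrite (negPf DD') mul0r addr0; apply=> e.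
    under eq_bigr do rewrite mulrDl.
    rewrite big_split /= -mulr_sumr.
    under [X in _ + X = _]eq_bigr do rewrite mulrAC.
    rewrite -mulr_suml sum1 //.
    have := h e; rewrite /= hj /f0 => h'; lra.
  have it : (i < size t)%N by exact: (@ltn_trans j).
  pose D' := nth C1 t i; have D't : D' \in t by apply: mem_nth.
  have hi e : nth (fun=> 0) (map face t) i e = face D' e by rewrite (nth_map C1).
  have DD' : D' != D by rewrite nth_uniq // ltn_eqF.
  have := coef (fun C => (C == D')%:R * a - (C == D)%:R * c).
  move=> /(_ _ D' D't); rewrite eqxx (negPf DD') mul1r mul0r subr0; apply=> e.
  under eq_bigr do rewrite mulrBl mulrAC [X in _ - X]mulrAC.
  rewrite sumrB -!mulr_suml !sum1 //.
  have := h e; rewrite /= hi hj; lra.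
exists L; split=> //.
- by rewrite /= size_map addnS addSn ltnS.
- case=> [|i] /=; last first.
    by rewrite size_map => it; rewrite (nth_map C1).
  move=> _ v; rewrite /f0 !sumrN; congr (- _).
  rewrite exchange_big [RHS]exchange_big /=; apply: eq_bigr => C _.
  exact: fcirc.
- move=> i iL; rewrite lt0n; apply/eqP => s0.
  have z0 e : nth (fun=> 0) L i e = 0.
    by apply/eqP/negPn/negP => ne; move: (card0_eq s0 e); rewrite !inE ne.
  suff : (1 : rat) = 0 by move/eqP; rewrite oner_eq0.
  have sL : (size L = (size t).+1) by rewrite /= size_map.
  have [i0|i0] := eqVneq i 0%N.
    apply: (indep i 1%N 1 0); first by rewrite i0 sL; lia.
    by move=> e; rewrite z0 mulr0 mul0r.
  case: i i0 iL {s0} z0 => // i _ iL z0.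
  rewrite sL ltnS in iL.
  pose D' := nth C1 t i; have D't : D' \in t by apply: mem_nth.
  have := coef (fun C => (C == D')%:R) => /(_ _ D' D't); rewrite eqxx; apply=> e.
  by rewrite sum1 //; have := z0 e; rewrite /= (nth_map C1).
- rewrite big_cons big_map /supp.
  have E (z : I -> rat) : #|[pred e | z e != 0]| = (\sum_e (z e != 0)%R)%N.
    by rewrite -sum1_card big_mkcond /=; apply: eq_bigr => e _; rewrite inE; case: ifP.
  rewrite E (eq_bigr (fun C => (\sum_e (face C e != 0)%R)%N)); last by move=> C _; exact: E.
  rewrite exchange_big /= -big_split /= mulnC -sum_nat_const; apply: leq_sum => e _.
  have [s [r h]] := ftwo e.
  have mem C : \sum_(D <- t) (C == D)%:R = (C \in t)%:R :> rat.
    have [Ct|Ct] := boolP (C \in t).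
      rewrite (bigD1_seq C) //= eqxx big1 ?addr0 // => D.
      by rewrite eq_sym => /negPf ->.
    rewrite big_seq big1 // => D Dt; case: eqP => // E'.
    by rewrite E' Dt in Ct.
  have memn C : (\sum_(D <- t) (C == D))%N = (C \in t) :> nat.
    have [Ct|Ct] := boolP (C \in t).
      rewrite (bigD1_seq C) //= eqxx big1 ?addn0 // => D.
      by rewrite eq_sym => /negPf ->.
    rewrite big_seq big1 // => D Dt; case: eqP => // E'.
    by rewrite E' Dt in Ct.
  have -> : f0 e = - ((s \in t)%:R - (r \in t)%:R).
    by rewrite /f0; under eq_bigr do rewrite h; rewrite sumrB !mem.
  under eq_bigr do rewrite h.
  have [->|sr] := eqVneq s r.
    by rewrite !subrr oppr0 eqxx big1 // => D _; rewrite subrr eqxx.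
  apply: (@leq_trans ((((s \in t) != (r \in t)) + ((s \in t) + (r \in t))))%N).
    apply: leq_add.
      by case: (s \in t); case: (r \in t); rewrite ?subrr ?oppr0 ?eqxx.
    rewrite -!memn -big_split /=; apply: leq_sum => D _.
    by case: (s == D); case: (r == D); rewrite ?subrr ?eqxx.
  by case: (s \in t); case: (r \in t).
Qed.

Local Close Scope ring_scope.

(** * Lattice models from walks with tagged squares *)

Section Zones.
Variables (V I : finType) (src tgt : I -> V).
Hypothesis src_neq_tgt : forall e, src e != tgt e.

(** A tag is the zone of a vertex or the inner part of an edge. Compatible tags are those that may
    share a square. *)
Definition compat (t t' : V + I) : bool :=
  match t, t' with
  | inl a, inl b => a == b
  | inl a, inr e | inr e, inl a => (a == src e) || (a == tgt e)
  | inr e, inr e' => e == e'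
  end.

Variables (n N : nat) (a : I -> nat -> pt) (tg : I -> nat -> V + I).
Variable base : V -> pt.
Hypothesis a_step : forall e j, j < n -> step (a e j) (a e j.+1).
Hypothesis a_box : forall e j, j <= n ->
  (0 < (a e j).1 < N) && (0 < (a e j).2 < N).
Hypothesis tg_val : forall e j, [\/ tg e j = inl (src e), tg e j = inr e | tg e j = inl (tgt e)].
Hypothesis tg0 : forall e, tg e 0 = inl (src e).
Hypothesis tgn : forall e, tg e n = inl (tgt e).
Hypothesis tg_src : forall e i j, i <= j -> tg e j = inl (src e) -> tg e i = inl (src e).
Hypothesis tg_tgt : forall e i j, i <= j -> tg e i = inl (tgt e) -> tg e j = inl (tgt e).
Hypothesis a_compat : forall e j e' j', j <= n -> j' <= n ->
  a e j = a e' j' -> compat (tg e j) (tg e' j').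
Hypothesis base_src : forall e, a e 0 = base (src e).
Hypothesis base_tgt : forall e, a e n = base (tgt e).

Let visit (t : V + I) (x : pt) : bool :=
  [exists e, exists j : 'I_n.+1, (a e j == x) && (tg e j == t)].

Let visitP t x : reflect (exists e j, [/\ j <= n, a e j = x & tg e j = t]) (visit t x).
Proof.
apply: (iffP existsP) => [[e /existsP[j /andP[/eqP h1 /eqP h2]]]|[e [j [jn h1 h2]]]].
  by exists e, j; split => //; rewrite -ltnS.
exists e; apply/existsP; exists (Ordinal (jn : j < n.+1)).
by rewrite /= h1 h2 !eqxx.
Qed.

Let visit_compat t t' x : visit t x -> visit t' x -> compat t t'.
Proof.
move=> /visitP[e [j [jn h1 <-]]] /visitP[e' [j' [jn' h1' <-]]].
by apply: a_compat => //; rewrite h1.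
Qed.

(** Vertex zones have priority; squares seen only by the inner part of an edge go to its source. *)
Let label (x : pt) : option V :=
  if [pick w | visit (inl w) x] is Some w then Some w
  else if [pick e | visit (inr e) x] is Some e then Some (src e) else None.

Let label_end w x : visit (inl w) x -> label x = Some w.
Proof.
move=> vx; rewrite /label; case: pickP => [w' vx'|/(_ w)]; last by rewrite vx.
by have /eqP -> := visit_compat vx' vx.
Qed.

Let label_mid e x : visit (inr e) x -> ~~ visit (inl (tgt e)) x -> label x = Some (src e).
Proof.
move=> vx nv; rewrite /label; case: pickP => [w vx'|_].
  case/orP: (visit_compat vx' vx) => /eqP E; rewrite E // in vx' *.
  by rewrite vx' in nv.
case: pickP => [e' vx'|/(_ e)]; last by rewrite vx.
by have /eqP -> := visit_compat vx' vx.
Qed.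

Let iota_path (f : nat -> pt) i k : (forall j, i <= j < i + k -> step (f j) (f j.+1)) ->
  path step (f i) (map f (iota i.+1 k)).
Proof.
elim: k i => [|k IH] i h //=; rewrite h ?IH //; last by lia.
by move=> j hj; apply: h; lia.
Qed.

Let iota_last (f : nat -> pt) i k : last (f i) (map f (iota i.+1 k)) = f (i + k).
Proof. by elim: k i => [|k IH] i /=; rewrite ?addn0 // IH addnS addSn. Qed.

Let stepC x y : step x y = step y x.
Proof. by rewrite /step /adj4 eq_sym; congr (_ || _); do !case: (_ == _). Qed.

Let to_base w x : visit (inl w) x ->
  exists W, [/\ path step x W, last x W = base w & all (visit (inl w)) W].
Proof.
move=> /visitP[e [j [jn <- tgj]]].
have [wt|ws] := eqVneq w (tgt e).
  exists (map (a e) (iota j.+1 (n - j))); split.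
  - by apply: iota_path => i hi; apply: a_step; lia.
  - by rewrite iota_last subnKC // base_tgt wt.
  - apply/allP => y /mapP[i]; rewrite mem_iota => hi ->.
    apply/visitP; exists e, i; split => //; first by lia.
    by rewrite wt; apply: (@tg_tgt e j); [lia | rewrite tgj wt].
have wsr : w = src e.
  case: (tg_val e j); rewrite tgj => // -[] // E.
  by rewrite E eqxx in ws.
pose f i := a e (j - i).
have E : f 0 = a e j by rewrite /f subn0.
exists (map f (iota 1 j)); split.
- rewrite -E; apply: iota_path => i hi; rewrite /f stepC.
  have -> : j - i = (j - i.+1).+1 by lia.
  by apply: a_step; lia.
- by rewrite -E iota_last /f subnn base_src wsr.
- apply/allP => y /mapP[i]; rewrite mem_iota => hi ->.
  apply/visitP; exists e, (j - i); split => //; first by lia.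
  by rewrite wsr; apply: (@tg_src e _ j); [lia | rewrite tgj wsr].
Qed.

(** The walk of [e] is cut at its first square in the zone of [tgt e], which may owe its place there
    to another edge. All earlier squares carry the label of the source, and from the cut [to_base]
    leads on inside the zone. *)
Lemma zones_gridmodel : gridmodel src tgt.
Proof.
exists N, base, label.
suff : forall e, exists WW : seq pt * seq pt,
    [/\ path step (base (src e)) (WW.1 ++ WW.2),
      last (base (src e)) (WW.1 ++ WW.2) = base (tgt e),
      {in base (src e) :: WW.1, forall x, label x = Some (src e)},
      {in WW.2, forall x, label x = Some (tgt e)} & WW.2 != [::]].
  move=> /fin_all_exists[WW hWW].
  exists (fun e => (WW e).1), (fun e => (WW e).2); split=> // x v.
  have key t : visit t x -> (0 < x.1 < N) && (0 < x.2 < N).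
    by move=> /visitP[e [j [jn <- _]]]; apply: a_box.
  rewrite /label; case: pickP => [w /key //|_].
  by case: pickP => [e /key //|].
move=> e.
have ex : exists j, (j <= n) && visit (inl (tgt e)) (a e j).
  by exists n; rewrite leqnn; apply/visitP; exists e, n; rewrite tgn.
case: (ex_minnP ex) => j /andP[jn vj] jmin.
have [W [pW lW aW]] := to_base vj.
have before i : i < j -> label (a e i) = Some (src e).
  move=> ij; have nv : ~~ visit (inl (tgt e)) (a e i).
    apply/negP => v; have := jmin i; rewrite v andbT.
    by move=> /(_ (leq_trans (ltnW ij) jn)); rewrite leqNgt ij.
  have hv t : tg e i = t -> visit t (a e i).
    by move=> ht; apply/visitP; exists e, i; split=> //; lia.
  case: (tg_val e i) => ti; have := hv _ ti.
  - exact: label_end.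
  - by move/label_mid; apply.
  - by move=> v; rewrite v in nv.
case: j jn vj jmin lW pW before => [|j] jn vj jmin lW pW before.
  have v0 : visit (inl (src e)) (a e 0) by apply/visitP; exists e, 0; rewrite tg0.
  by have /eqP E := visit_compat v0 vj; have := src_neq_tgt e; rewrite E eqxx.
exists (map (a e) (iota 1 j), a e j.+1 :: W); split=> //=.
- rewrite cat_path -base_src iota_path /=; last by move=> i hi; apply: a_step; lia.
  by rewrite iota_last add0n a_step.
- by rewrite last_cat -base_src /= lW.
- move=> x; rewrite inE => /orP[/eqP ->|/mapP[i]]; first by rewrite -base_src before.
  by rewrite mem_iota => hi ->; apply: before; lia.
- move=> x; rewrite inE => /orP[/eqP ->|xW]; first exact: label_end.
  by apply: label_end; apply: (allP aW).
Qed.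
End Zones.

(** * Euler bounds for short cycles *)

Definition edge (V : finType) (U : rel V) : finType :=
  {e : V * V | U e.1 e.2 && (enum_rank e.1 < enum_rank e.2)%N}.
Definition esrc (V : finType) (U : rel V) (e : edge U) : V := (val e).1.
Definition etgt (V : finType) (U : rel V) (e : edge U) : V := (val e).2.

Ltac sd := match goal with
  | |- is_true (negb (eq_op _ _)) => first [done | rewrite eq_sym; done]
  | H : symmetric _ |- _ => first [done | rewrite H; done]
  | _ => done
  end.

Ltac neqs := rewrite /= ?inE ?negb_or; repeat (apply/andP; split => //); by [| rewrite eq_sym].

(** * Lower bounds on the number of edges when no vertex has degree one *)

Section Pairs.
Variable V : finType.
Implicit Type r : rel V.

Definition npairs r : nat := #|[pred p : V * V | r p.1 p.2]|.

Definition without r v : rel V := fun x y => [&& r x y, x != v & y != v].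

Lemma npairs_without r v s : symmetric r -> irreflexive r -> uniq s -> all (r v) s ->
  npairs (without r v) + 2 * size s <= npairs r.
Proof.
move=> rs ri us /allP as_.
pose A := [set p : V * V | without r v p.1 p.2].
pose B := [set (v, x) | x in s]; pose C := [set (x, v) | x in s].
have cB : #|B| = size s.
  by rewrite card_imset ?(card_uniqP us) // => x y [].
have cC : #|C| = size s.
  by rewrite card_imset ?(card_uniqP us) // => x y [].
have dAB : [disjoint A & B].
  rewrite -setI_eq0; apply/eqP/setP => p; rewrite !inE; apply/negP.
  by case/andP=> /and3P[_ h _] /imsetP[x _ E]; rewrite E eqxx in h.
have dABC : [disjoint A :|: B & C].
  rewrite -setI_eq0; apply/eqP/setP => p; rewrite !inE; apply/negP.
  case/andP=> /orP[/and3P[_ _ h]|/imsetP[y ys ->]] /imsetP[x xs E].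
    by rewrite E eqxx in h.
  by case: E => _ E; have := as_ _ ys; rewrite E ri.
have -> : npairs (without r v) = #|A| by apply: eq_card => p; rewrite !inE.
have e1 : #|A :|: B| = #|A| + #|B| by rewrite -cardsUI (disjoint_setI0 dAB) cards0 addn0.
have e2 : #|A :|: B :|: C| = #|A :|: B| + #|C| by rewrite -cardsUI (disjoint_setI0 dABC) cards0 addn0.
rewrite mul2n -addnn addnA -{1}cB -cC -e1 -e2; apply: subset_leq_card.
apply/subsetP => p; rewrite !inE => /orP[/orP[/and3P[]//|/imsetP[x xs ->]]|/imsetP[x xs ->]] /=.
  exact: as_.
by rewrite rs; exact: as_.
Qed.

Lemma without_sym r v : symmetric r -> symmetric (without r v).
Proof. by move=> rs x y; rewrite /without rs; case: (r y x) => //=; rewrite andbC. Qed.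

Lemma without_irr r v : irreflexive r -> irreflexive (without r v).
Proof. by move=> ri x; rewrite /without ri. Qed.

Lemma npairs_path r v s : symmetric r -> irreflexive r -> path r v s -> uniq (v :: s) ->
  2 * size s <= npairs r.
Proof.
elim: s r v => [|w s IH] r v rs ri //= /andP[vw ps] /and3P[]; rewrite inE negb_or.
move=> /andP[vw' vs] ws us.
have h : all (r v) [:: w] by rewrite /= vw.
apply: leq_trans (npairs_without rs ri (isT : uniq [:: w]) h).
have := IH (without r v) w (without_sym v rs) (without_irr v ri); rewrite /= ws us.
move=> h'; rewrite mulnS addnC leq_add2r; apply: h' => //.
have : all (predC1 v) (w :: s).
  by rewrite /= eq_sym vw'; apply/allP => x xs; apply: contra vs => /eqP <-.
elim: s {IH vs ws us vw' h vw} w ps => [|y s IHs] w //= /andP[wy ps] /and3P[wv yv av].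
by rewrite /without wy wv yv /=; apply: IHs => //=; rewrite yv.
Qed.

(** The extra neighbour [x] of [v] may lie further along the path, so a closing cycle and a branch
    are counted alike. *)
Lemma npairs_fork r x v w s : symmetric r -> irreflexive r -> r v x -> x != w ->
  path r v (w :: s) -> uniq [:: v, w & s] -> 2 * (size s).+2 <= npairs r.
Proof.
move=> rs ri vx xw /= /andP[vw ps] /and3P[]; rewrite inE negb_or => /andP[vw' vs] ws us.
have h : all (r v) [:: x; w] by rewrite /= vx vw.
have ux : uniq [:: x; w] by rewrite /= inE xw.
apply: leq_trans (npairs_without rs ri ux h).
have := @npairs_path (without r v) w s (without_sym v rs) (without_irr v ri).
rewrite /= ws us -[(size s).+2]addn2 mulnDr leq_add2r; apply=> //.
have : all (predC1 v) (w :: s).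
  by rewrite /= eq_sym vw'; apply/allP => y ys; apply: contra vs => /eqP <-.
elim: s {vs ws us vw' h vw xw ux vx} w ps => [|y s IHs] w //= /andP[wy ps] /and3P[wv yv av].
by rewrite /without wy wv yv /=; apply: IHs => //=; rewrite yv.
Qed.

Section Evenish.
Variable r : rel V.
Hypothesis rs : symmetric r.
Hypothesis ri : irreflexive r.
Hypothesis r2 : forall v w, r v w -> exists2 w', w' != w & r v w'.
Variables (a b : V).
Hypothesis rab : r a b.

Definition noC3 (U : rel V) := forall x y z, U x y -> U y z -> U z x -> False.
Definition noC4 (U : rel V) := forall x y z t, U x y -> U y z -> U z t -> U t x ->
  x != z -> y != t -> False.
Definition noC5 (U : rel V) := forall x y z t u, U x y -> U y z -> U z t -> U t u -> U u x ->
  uniq [:: x; y; z; t; u] -> False.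

Let neq x y : r x y -> x != y.
Proof. by apply: contraTN => /eqP ->; rewrite ri. Qed.

(** A path is prolonged without backtracking, and a second neighbour of its start supplies one more
    edge. In the next lemmas each excluded cycle length keeps the path simple for one step more. *)
Lemma npairs_ge6 : 6 <= npairs r.
Proof.
have [x xb ax] := r2 rab; have [c ca bc] := r2 (etrans (rs _ _) rab : r b a).
apply: (npairs_fork rs ri ax xb (s := [:: c])); first by rewrite /= rab bc.
by rewrite /= !inE !negb_or (neq rab) (neq bc) eq_sym ca.
Qed.

Lemma npairs_ge8 : noC3 r -> 8 <= npairs r.
Proof.
move=> n3.
have [x xb ax] := r2 rab; have [c ca bc] := r2 (etrans (rs _ _) rab : r b a).
have [d db cd] := r2 (etrans (rs _ _) bc : r c b).
have da : d != a.
  by apply/eqP => E; rewrite E in cd; exact: (n3 a b c).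
apply: (npairs_fork rs ri ax xb (s := [:: c; d])); first by rewrite /= rab bc cd.
have := neq rab; have := neq bc; have := neq cd => *; neqs.
Qed.

Lemma npairs_ge10 : noC3 r -> noC4 r -> 10 <= npairs r.
Proof.
move=> n3 n4.
have [x xb ax] := r2 rab; have [c ca bc] := r2 (etrans (rs _ _) rab : r b a).
have [d db cd] := r2 (etrans (rs _ _) bc : r c b).
have da : d != a by apply/eqP => E; rewrite E in cd; exact: (n3 a b c).
have [e ec de] := r2 (etrans (rs _ _) cd : r d c).
have eb : e != b by apply/eqP => E; rewrite E in de; exact: (n3 b c d).
have ea : e != a.
  apply/eqP => E; rewrite E in de; apply: (n4 a b c d) => //; rewrite eq_sym //.
apply: (npairs_fork rs ri ax xb (s := [:: c; d; e])); first by rewrite /= rab bc cd de.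
have := neq rab; have := neq bc; have := neq cd; have := neq de => *; neqs.
Qed.

Lemma npairs_ge12 : noC3 r -> noC4 r -> noC5 r -> 12 <= npairs r.
Proof.
move=> n3 n4 n5.
have [x xb ax] := r2 rab; have [c ca bc] := r2 (etrans (rs _ _) rab : r b a).
have [d db cd] := r2 (etrans (rs _ _) bc : r c b).
have da : d != a by apply/eqP => E; rewrite E in cd; exact: (n3 a b c).
have [e ec de] := r2 (etrans (rs _ _) cd : r d c).
have eb : e != b by apply/eqP => E; rewrite E in de; exact: (n3 b c d).
have ea : e != a.
  apply/eqP => E; rewrite E in de; apply: (n4 a b c d) => //; rewrite eq_sym //.
have [f fd ef] := r2 (etrans (rs _ _) de : r e d).
have fc : f != c by apply/eqP => E; rewrite E in ef; exact: (n3 c d e).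
have fb : f != b.
  apply/eqP => E; rewrite E in ef; apply: (n4 b c d e) => //; rewrite eq_sym //.
have u5 : uniq [:: a; b; c; d; e].
  have := neq rab; have := neq bc; have := neq cd; have := neq de => *; neqs.
have fa : f != a by apply/eqP => E; rewrite E in ef; exact: (n5 a b c d e).
apply: (npairs_fork rs ri ax xb (s := [:: c; d; e; f])); first by rewrite /= rab bc cd de ef.
have := neq rab; have := neq bc; have := neq cd; have := neq de; have := neq ef => *; neqs.
Qed.

(** Deleting [p] removes two edges and leaves the triangle intact: 2 + 3 edges, each counted
    twice. *)
Lemma npairs_triangle x y z p q : r x y -> r y z -> r z x -> r p q -> p \notin [:: x; y; z] ->
  10 <= npairs r.
Proof.
move=> xy yz zx pq pn; have [q' qq' pq'] := r2 pq.
have up : uniq [:: q; q'] by rewrite /= inE eq_sym qq'.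
have ap : all (r p) [:: q; q'] by rewrite /= pq pq'.
apply: leq_trans (npairs_without rs ri up ap); rewrite -[10]/(6 + 4) leq_add2r.
move: pn; rewrite !inE !negb_or => /and3P[px py pz].
have := neq xy; have := neq yz; have := neq zx => zx' yz' xy'.
apply: (@npairs_fork _ z x y [:: z]).
- exact: without_sym.
- exact: without_irr.
- by rewrite /without rs zx ![_ == p]eq_sym px pz.
- by rewrite eq_sym.
- by rewrite /= /without xy yz ![_ == p]eq_sym px py pz.
- by neqs.
Qed.

(** Without 4-cycles [p] has at most one neighbour on the triangle, hence a neighbour [t] off it.
    Deleting [p] and then [t] removes 2 + 1 edges besides the three of the triangle. *)
Lemma npairs_triangle12 x y z p q : noC4 r ->
  r x y -> r y z -> r z x -> r p q -> p \notin [:: x; y; z] -> 12 <= npairs r.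
Proof.
move=> n4 xy yz zx pq pn; have [q' qq' pq'] := r2 pq.
have up : uniq [:: q; q'] by rewrite /= inE eq_sym qq'.
have ap : all (r p) [:: q; q'] by rewrite /= pq pq'.
have [t [pt tn]] : exists t, r p t /\ t \notin [:: x; y; z].
  have [qn|qn] := boolP (q \in [:: x; y; z]); last by exists q.
  have [qn'|qn'] := boolP (q' \in [:: x; y; z]); last by exists q'.
  exfalso; have tri u v : u \in [:: x; y; z] -> v \in [:: x; y; z] -> u != v -> r p u -> r p v -> False.
    move: pn; rewrite !inE !negb_or => /and3P[px py pz].
    have xz : r x z by rewrite rs.
    have zy : r z y by rewrite rs.
    have yx : r y x by rewrite rs.
    move=> /or3P[] /eqP -> /or3P[] /eqP ->; rewrite ?eqxx // => _ pu pv;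
      rewrite (rs p) in pv.
    - by apply: (n4 p x z y) => //; rewrite ?(neq xy).
    - by apply: (n4 p x y z) => //; rewrite ?(neq xz).
    - by apply: (n4 p y z x) => //; rewrite ?(neq yx).
    - by apply: (n4 p y x z) => //; rewrite ?(neq yz).
    - by apply: (n4 p z y x) => //; rewrite ?(neq zx).
    - by apply: (n4 p z x y) => //; rewrite ?(neq zy).
  by apply: (tri q q') => //; rewrite eq_sym.
have [w wp tw] := r2 (etrans (rs _ _) pt : r t p).
apply: leq_trans (npairs_without rs ri up ap); rewrite -[12]/(8 + 4) leq_add2r.
have tp : t != p by rewrite eq_sym; exact: neq.
have tw' : all (without r p t) [:: w] by rewrite /= /without tw tp wp.
apply: leq_trans (npairs_without (without_sym p rs) (without_irr p ri) (isT : uniq [:: w]) tw').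
rewrite -[8]/(6 + 2) leq_add2r.
move: pn tn; rewrite !inE !negb_or => /and3P[px py pz] /and3P[tx ty tz].
apply: (@npairs_fork _ z x y [:: z]).
- by do 2!apply: without_sym.
- by do 2!apply: without_irr.
- by rewrite /without rs zx ![_ == p]eq_sym px pz ![_ == t]eq_sym tx tz.
- by rewrite eq_sym; exact: neq.
- by rewrite /= /without xy yz ![_ == p]eq_sym px py pz ![_ == t]eq_sym tx ty tz.
- by have := neq xy; have := neq yz; have := neq zx => *; neqs.
Qed.
End Evenish.
End Pairs.

(** * Supports of circulations and the resulting bounds *)

Section SimpleGraph.
Variables (V : finType) (U : rel V).
Hypothesis Us : symmetric U.
Hypothesis Ui : irreflexive U.

Local Open Scope ring_scope.

Lemma edge_neq (e : edge U) : esrc e != etgt e.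
Proof. by apply/eqP => h; case/andP: (valP e) => _; rewrite -/(esrc e) -/(etgt e) h ltnn. Qed.

Lemma edgeU (e : edge U) : U (esrc e) (etgt e).
Proof. by case/andP: (valP e). Qed.

Lemma edge_simple (e e' : edge U) :
  (esrc e = esrc e' /\ etgt e = etgt e') \/ (esrc e = etgt e' /\ etgt e = esrc e') -> e = e'.
Proof.
case=> -[h1 h2].
  by apply: val_inj; rewrite [val e]surjective_pairing [val e']surjective_pairing;
     congr pair.
case/andP: (valP e) => _; case/andP: (valP e') => _.
rewrite -!/(esrc _) -!/(etgt _) h1 h2 => l1 l2.
by have := ltn_trans l1 l2; rewrite ltnn.
Qed.

Lemma edge_exists v w : U v w -> exists e : edge U,
  (esrc e = v /\ etgt e = w) \/ (esrc e = w /\ etgt e = v).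
Proof.
move=> vw; have [lt|lt|E] := ltngtP (enum_rank v) (enum_rank w).
- by exists (exist _ (v, w) (introT andP (conj vw lt))); left.
- have wv : U w v by rewrite Us.
  by exists (exist _ (w, v) (introT andP (conj wv lt))); right.
- by move: vw; rewrite (enum_rank_inj (val_inj E)) Ui.
Qed.

Lemma npairs_edge : npairs U = (2 * #|edge U|)%N.
Proof.
rewrite mul2n -addnn card_sig.
pose lt (p : V * V) := (enum_rank p.1 < enum_rank p.2)%N.
rewrite /npairs -(cardID lt) /=; congr (_ + _)%N.
pose sw (p : V * V) := (p.2, p.1).
have swi : injective sw by move=> [a b] [c d] [-> ->].
rewrite -(card_image swi); apply: eq_card => -[v w].
have -> : (v, w) = sw (w, v) by [].
rewrite mem_image // !inE /= Us andbC.
have [vw|//] := boolP (U v w).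
rewrite !andTb -[_ \notin _]/(~~ lt (w, v)) /lt /= -leqNgt leq_eqVlt.
by case: eqP => // /val_inj/enum_rank_inj E; rewrite E Ui in vw.
Qed.

Lemma sum_deg : (\sum_v #|[pred w | U v w]| = 2 * #|edge U|)%N.
Proof.
rewrite -npairs_edge /npairs -sum1_card.
rewrite (eq_bigr (fun v => \sum_w (U v w : nat))%N); last first.
  by move=> v _; rewrite -sum1_card big_mkcond; apply: eq_bigr => w _; rewrite inE; case: (U v w).
rewrite pair_big [RHS]big_mkcond /=; apply: eq_bigr => p _.
by rewrite inE; case: (U p.1 p.2).
Qed.

Section Support.
Variable z : edge U -> rat.
Hypothesis zc : circulation (@esrc V U) (@etgt V U) z.

Definition joins (e : edge U) v w :=
  (esrc e == v) && (etgt e == w) || (esrc e == w) && (etgt e == v).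

Definition srel : rel V := fun v w => [exists e, (z e != 0) && joins e v w].

Lemma joinsC e v w : joins e v w = joins e w v.
Proof. by rewrite /joins orbC. Qed.

Lemma srel_sym : symmetric srel.
Proof. by move=> v w; apply: eq_existsb => e; rewrite joinsC. Qed.

Lemma srelU v w : srel v w -> U v w.
Proof.
case/existsP => e /andP[_ /orP[]] /andP[/eqP <- /eqP <-]; first exact: edgeU.
by rewrite Us edgeU.
Qed.

Lemma srel_irr : irreflexive srel.
Proof. by move=> v; apply/negbTE/negP => h; have := srelU h; rewrite Ui. Qed.

Lemma srel_edge e : z e != 0 -> srel (esrc e) (etgt e).
Proof. by move=> ze; apply/existsP; exists e; rewrite ze /joins !eqxx. Qed.

Lemma npairs_srel : (npairs srel <= 2 * supp z)%N.
Proof.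
rewrite /supp; set A := [pred e | z e != 0].
have -> : (2 * #|A| = #|[set (esrc e, etgt e) | e in A]| + #|[set (etgt e, esrc e) | e in A]|)%N.
  rewrite mul2n -addnn !card_imset // => e e' [h1 h2]; apply: edge_simple; left => //.
apply: leq_trans (leq_card_setU _ _); apply: subset_leq_card; apply/subsetP => p.
rewrite !inE => /existsP[e /andP[ze /orP[]] /andP[/eqP h1 /eqP h2]].
  by apply/orP; left; apply/imsetP; exists e; rewrite ?inE // h1 h2 -surjective_pairing.
by apply/orP; right; apply/imsetP; exists e; rewrite ?inE // h1 h2 -surjective_pairing.
Qed.

(* Kirchhoff: a single nonzero edge at a vertex cannot balance. *)
Lemma srel_two v w : srel v w -> exists2 w', w' != w & srel v w'.
Proof.
case/existsP => e /andP[ze je].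
have [/existsP[e' /and3P[ne ze' ve']]|] :=
    boolP [exists e', [&& e' != e, z e' != 0 & (esrc e' == v) || (etgt e' == v)]].
  have jw w' : joins e' v w' -> exists2 w', w' != w & srel v w'.
    move=> j'; exists w'; last by apply/existsP; exists e'; rewrite ze'.
    apply/eqP => E; rewrite E in j'; case/eqP: ne; apply: edge_simple.
    by case/orP: je => /andP[/eqP -> /eqP ->]; case/orP: j' => /andP[/eqP -> /eqP ->]; tauto.
  case/orP: ve' => /eqP E; [apply: (jw (etgt e'))|apply: (jw (esrc e'))];
    by rewrite /joins E !eqxx ?orbT.
rewrite negb_exists => /forallP none; exfalso.
have z0 e' : e' != e -> (esrc e' == v) || (etgt e' == v) -> z e' = 0.
  by move=> ne ve'; have := none e'; rewrite ne ve' andbT /= negbK => /eqP.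
have := zc v; case/orP: je => /andP[/eqP h1 /eqP h2].
  rewrite (bigD1 e) ?h1 //= big1; last first.
    by move=> e' /andP[h3 h4]; apply: z0; rewrite ?h3.
  rewrite big1 ?addr0; first by move/eqP; rewrite (negPf ze).
  move=> e' h3; apply: z0; rewrite ?h3 ?orbT //; apply/eqP => E.
  by move: h3; rewrite E h2 => /eqP E2; move: (edge_neq e); rewrite h1 h2 E2 eqxx.
rewrite [X in _ = X](bigD1 e) ?h2 //= [in RHS]big1; last first.
  by move=> e' /andP[h3 h4]; apply: z0; rewrite ?h3 ?orbT.
rewrite big1 ?addr0; first by move/esym/eqP; rewrite (negPf ze).
move=> e' h3; apply: z0; rewrite ?h3 //; apply/eqP => E.
by move: h3; rewrite E h1 => /eqP E2; move: (edge_neq e); rewrite h1 h2 E2 eqxx.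
Qed.

Lemma supp_edge : (0 < supp z)%N -> exists v w, srel v w.
Proof. by move=> /card_gt0P[e]; rewrite inE => /srel_edge h; do 2!eexists; exact: h. Qed.

Lemma supp_ge3 : (0 < supp z)%N -> (3 <= supp z)%N.
Proof.
move=> /supp_edge[v [w vw]]; have := npairs_ge6 srel_sym srel_irr srel_two vw.
by have := npairs_srel; lia.
Qed.
End Support.

Section Euler.
Hypothesis gm : gridmodel (@esrc V U) (@etgt V U).
Hypothesis V0 : (0 < #|V|)%N.

(** There are at least [#|edge U| + 2 - #|V|] faces of at least [g] edges each, and every edge is
    counted at most twice. *)
Lemma euler_girth g : (#|V| < #|edge U|)%N ->
  (forall z : edge U -> rat, circulation (@esrc V U) (@etgt V U) z ->
     (0 < supp z)%N -> (g <= supp z)%N) ->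
  (g * (#|edge U| + 2) <= 2 * #|edge U| + g * #|V|)%N.
Proof.
move=> VE hg.
have [L [h1 h2 h3 h4 _]] := euler_faces gm edge_neq edge_simple (introT andP (conj V0 VE)).
have : (g * size L <= \sum_(z <- L) supp z)%N.
  have -> : (g * size L = \sum_(i < size L) g)%N by rewrite sum_nat_const card_ord mulnC.
  rewrite (big_nth (fun=> 0%R)) big_mkord.
  by apply: leq_sum => i _; apply: hg; [exact: h2|exact: h3].
have : (g * (#|edge U| + 2) <= g * (size L + #|V|))%N by rewrite leq_mul2l h1 orbT.
by move=> l1 l2; apply: leq_trans l1 _; rewrite mulnDr leq_add2r (leq_trans l2).
Qed.

(* Two faces bounded by the same triangle would be proportional. *)
Lemma euler_triangles g : (3 <= g)%N -> (#|V| < #|edge U|)%N ->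
  (forall z : edge U -> rat, circulation (@esrc V U) (@etgt V U) z ->
     (0 < supp z < g)%N -> exists x y t, [/\ U x y, U y t, U t x &
       forall v w, srel z v w -> v \in [:: x; y; t]]) ->
  (forall x y t t', U x y -> U y t -> U t x -> U y t' -> U t' x -> t = t') ->
  (3 * g * (#|edge U| + 2) <= (g + 3) * #|edge U| + 3 * g * #|V|)%N.
Proof.
move=> g3 VE hg tri1.
have [L [h1 h2 h3 h4 h5]] := euler_faces gm edge_neq edge_simple (introT andP (conj V0 VE)).
pose n := size L.
pose zn (i : 'I_n) : edge U -> rat := nth (fun=> 0) L i.
have zc i : circulation (@esrc V U) (@etgt V U) (zn i) by apply: h2.
have zp i : (0 < supp (zn i))%N by apply: h3.
have sumE : (\sum_(z <- L) supp z = \sum_i supp (zn i))%N.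
  by rewrite (big_nth (fun=> 0%R)) big_mkord.
pose small (i : 'I_n) := (supp (zn i) < g)%N.
have tri i e : small i -> zn i e != 0 -> exists h, [/\ U (etgt e) h, U h (esrc e) &
    forall v w, srel (zn i) v w -> v \in [:: esrc e; etgt e; h]].
  move=> si ze; have [x [y [t [xy yt tx sub]]]] := hg _ (zc i) (introT andP (conj (zp i) si)).
  have se := srel_edge ze; have s1 := sub _ _ se.
  have s2 : etgt e \in [:: x; y; t] by apply: (sub _ (esrc e)); rewrite srel_sym.
  have ne := edge_neq e.
  have [h [h1' h2' h3']] : exists h, [/\ U (etgt e) h, U h (esrc e) &
      {subset [:: x; y; t] <= [:: esrc e; etgt e; h]}].
    move: s1 s2 ne; rewrite !inE => /or3P[] /eqP -> /or3P[] /eqP ->; rewrite ?eqxx // => _.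
    - by exists t; split=> // v; rewrite !inE.
    - exists y; split; rewrite 1?Us // => v; rewrite !inE => /or3P[] /eqP ->; rewrite eqxx ?orbT //.
    - exists t; split; rewrite 1?Us // => v; rewrite !inE => /or3P[] /eqP ->; rewrite eqxx ?orbT //.
    - exists x; split; rewrite // => v; rewrite !inE => /or3P[] /eqP ->; rewrite eqxx ?orbT //.
    - exists y; split; rewrite // => v; rewrite !inE => /or3P[] /eqP ->; rewrite eqxx ?orbT //.
    - exists x; split; rewrite 1?Us // => v; rewrite !inE => /or3P[] /eqP ->; rewrite eqxx ?orbT //.
  by exists h; split=> // v w vw; apply/h3'/(sub _ w).
have excl (i j : 'I_n) e : (i < j)%N -> small i -> small j -> zn i e != 0 -> zn j e != 0 -> False.
  move=> ij si sj zi zj.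
  have [h [hi1 hi2 hi3]] := tri i e si zi; have [h' [hj1 hj2 hj3]] := tri j e sj zj.
  have hh : h' = h by apply: (tri1 (esrc e) (etgt e)) => //; exact: edgeU.
  rewrite {}hh in hj1 hj2 hj3.
  (* The combination that vanishes on [e]. Its support lies in the triangle without the side [e],
     which is a path, so Kirchhoff's law makes it zero and the two faces are proportional. *)
  pose y : edge U -> rat := fun e' => zn j e * zn i e' - zn i e * zn j e'.
  have yc : circulation (@esrc V U) (@etgt V U) y.
    move=> v; rewrite /y !sumrB -!mulr_sumr.
    by have := zc i v; have := zc j v => -> ->.
  have ysub v w : srel y v w -> v \in [:: esrc e; etgt e; h].
    case/existsP => e' /andP[ye' jv].
    have [z0|z0] := eqVneq (zn i e') 0.
      apply: (hj3 _ w); apply/existsP; exists e'; rewrite jv andbT.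
      by apply: contra ye' => /eqP z1; rewrite /y z0 z1 !mulr0 subrr.
    by apply: (hi3 _ w); apply/existsP; exists e'; rewrite z0.
  have yst : ~~ srel y (esrc e) (etgt e).
    apply/existsP => -[e' /andP[ye' je]].
    have E : e' = e.
      by apply: edge_simple; case/orP: je => /andP[/eqP -> /eqP ->]; tauto.
    by move: ye'; rewrite E /y mulrC subrr eqxx.
  have y0 : supp y = 0%N.
    apply/eqP; rewrite -leqn0 leqNgt; apply/negP => /supp_edge[v [w vw]].
    have ysym := srel_sym y; have yirr := @srel_irr y.
    have end1 a b u : (a, b) = (esrc e, etgt e) \/ (a, b) = (etgt e, esrc e) -> ~~ srel y a u.
      move=> ab; apply/negP => au; have [u' uu' au'] := srel_two yc au.
      have nab : ~~ srel y a b by case: ab => -[-> ->] //; rewrite ysym.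
      have onlyh c : srel y a c -> c = h.
        move=> ac; have := ysub c a; rewrite ysym => /(_ ac); rewrite !inE.
        case: ab => -[ea eb] /or3P[] /eqP E //; rewrite E -?ea -?eb in ac *.
        - by rewrite yirr in ac.
        - by rewrite (negPf nab) in ac.
        - by rewrite (negPf nab) in ac.
        - by rewrite yirr in ac.
      by case/eqP: uu'; rewrite (onlyh _ au) (onlyh _ au').
    have e1 := end1 (esrc e) (etgt e) _ (or_introl erefl).
    have e2 := end1 (etgt e) (esrc e) _ (or_intror erefl).
    have vh a b : srel y a b -> a = h.
      move=> ab; have := ysub _ _ ab; rewrite !inE => /or3P[] /eqP E //; rewrite E in ab.
        by rewrite (negPf (e1 b)) in ab.
      by rewrite (negPf (e2 b)) in ab.
    have wv : srel y w v by rewrite ysym.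
    by have E1 := vh _ _ vw; have E2 := vh _ _ wv; rewrite E1 E2 yirr in vw.
  have ye e' : zn j e * zn i e' = zn i e * zn j e'.
    apply/eqP; rewrite -subr_eq0; apply/negPn/negP => ne.
    by move: (card0_eq y0 e'); rewrite !inE /y ne.
  have ijL : (i < j < size L)%N by rewrite ij ltn_ord.
  by have := h5 i j (zn j e) (zn i e) ijL ye => /eqP; rewrite (negPf zj).
have once e : (\sum_(i | small i) (zn i e != 0)%R <= 1)%N.
  rewrite -big_mkcondr /= sum1dep_card; apply/card_le1_eqP => i j.
  rewrite !inE => /andP[si zi] /andP[sj zj]; apply: val_inj.
  have [ij|ij|//] := ltngtP (val i) (val j).
    by case: (excl i j e).
  by case: (excl j i e).
have cardE (z : edge U -> rat) : supp z = (\sum_e (z e != 0)%R)%N.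
  by rewrite /supp -sum1_card big_mkcond /=; apply: eq_bigr => e _; rewrite inE; case: ifP.
(* Small faces are edge-disjoint and have at least 3 edges each. All others have at least [g], so
   the deficit is at most [g - 3] for each small face. *)
have N3 : (3 * #|small| <= #|edge U|)%N.
  apply: (@leq_trans (\sum_(i | small i) supp (zn i))%N).
    rewrite mulnC -sum_nat_const; apply: leq_sum => i _; exact: supp_ge3.
  under eq_bigr do rewrite cardE.
  have E1 : #|edge U| = (\sum_(e : edge U) 1)%N by rewrite sum1_card.
  rewrite exchange_big /= [leqRHS]E1; apply: leq_sum => e _; exact: once.
have gn : (g * n <= \sum_i supp (zn i) + (g - 3) * #|small|)%N.
  rewrite [X in (_ + X)%N]mulnC -sum_nat_const [X in (_ + X)%N]big_mkcond -big_split /=.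
  rewrite mulnC -{1}[n]card_ord -sum_nat_const; apply: leq_sum => i _.
  rewrite [i \in _]/(small i); have := supp_ge3 (zc i) (zp i).
  by rewrite /small; move: (supp (zn i)) => k k3; case: ltnP => hk; lia.
rewrite -sumE in gn.
have A1 : (3 * g * (#|edge U| + 2) <= 3 * g * (n + #|V|))%N by rewrite leq_mul2l h1 orbT.
apply: leq_trans A1 _; rewrite mulnDr leq_add2r -mulnA.
move: gn h4 N3; move: (\sum_(z <- L) _)%N (#|small|) => S N gn S2 N3.
have E : ((g + 3) * #|edge U| = 3 * (2 * #|edge U|) + (g - 3) * #|edge U|)%N.
  have -> : (g + 3 = 6 + (g - 3))%N by lia.
  by rewrite mulnDl mulnA.
rewrite E; apply: (@leq_trans (3 * (S + (g - 3) * N))%N); first by rewrite leq_mul2l gn.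
rewrite mulnDr leq_add ?leq_mul2l ?S2 ?orbT //.
by rewrite mulnCA leq_mul2l N3 orbT.
Qed.

Hypothesis VE : (#|V| < #|edge U|)%N.

Let sub_noC3 z : noC3 U -> noC3 (srel z).
Proof. by move=> n3 x y t xy yt tx; apply: (n3 x y t); apply: (@srelU z). Qed.
Let sub_noC4 z : noC4 U -> noC4 (srel z).
Proof.
by move=> n4 x y t u xy yt tu ux; apply: (n4 x y t u); apply: (@srelU z).
Qed.
Let sub_noC5 z : noC5 U -> noC5 (srel z).
Proof.
by move=> n5 x y t u w xy yt tu uw wx; apply: (n5 x y t u w); apply: (@srelU z).
Qed.

Lemma euler3 : (#|edge U| + 6 <= 3 * #|V|)%N.
Proof.
have : (3 * (#|edge U| + 2) <= 2 * #|edge U| + 3 * #|V|)%N.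
  by apply: euler_girth => // z zc; exact: supp_ge3.
lia.
Qed.

Lemma euler4 : noC3 U -> (#|edge U| + 4 <= 2 * #|V|)%N.
Proof.
move=> n3; have : (4 * (#|edge U| + 2) <= 2 * #|edge U| + 4 * #|V|)%N.
  apply: euler_girth => // z zc /supp_edge[v [w vw]].
  have := npairs_ge8 (srel_sym z) (@srel_irr z) (srel_two zc) vw (sub_noC3 n3).
  by have := npairs_srel z; lia.
lia.
Qed.

Lemma euler5 : noC3 U -> noC4 U -> (3 * #|edge U| + 10 <= 5 * #|V|)%N.
Proof.
move=> n3 n4; have : (5 * (#|edge U| + 2) <= 2 * #|edge U| + 5 * #|V|)%N.
  apply: euler_girth => // z zc /supp_edge[v [w vw]].
  have := npairs_ge10 (srel_sym z) (@srel_irr z) (srel_two zc) vw (sub_noC3 n3) (sub_noC4 n4).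
  by have := npairs_srel z; lia.
lia.
Qed.

Lemma euler6 : noC3 U -> noC4 U -> noC5 U -> (2 * #|edge U| + 6 <= 3 * #|V|)%N.
Proof.
move=> n3 n4 n5; have : (6 * (#|edge U| + 2) <= 2 * #|edge U| + 6 * #|V|)%N.
  apply: euler_girth => // z zc /supp_edge[v [w vw]].
  have := npairs_ge12 (srel_sym z) (@srel_irr z) (srel_two zc) vw (sub_noC3 n3) (sub_noC4 n4)
    (sub_noC5 n5).
  by have := npairs_srel z; lia.
lia.
Qed.

Section OneTriangle.
Hypothesis tri1 : forall x y t t', U x y -> U y t -> U t x -> U y t' -> U t' x -> t = t'.

Let find_triangle z g : circulation (@esrc V U) (@etgt V U) z -> (0 < supp z < g)%N ->
  (noC3 (srel z) -> (g <= supp z)%N) ->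
  (forall x y t p q, srel z x y -> srel z y t -> srel z t x -> srel z p q ->
     p \notin [:: x; y; t] -> (g <= supp z)%N) ->
  exists x y t, [/\ U x y, U y t, U t x & forall v w, srel z v w -> v \in [:: x; y; t]].
Proof.
move=> zc /andP[z0 zg] hno htri.
have [/existsP[x /existsP[y /existsP[t /and3P[xy yt tx]]]]|none] :=
    boolP [exists x, exists y, exists t, [&& srel z x y, srel z y t & srel z t x]].
  exists x, y, t; split; try exact: (@srelU z); move=> v w vw; apply/negPn/negP => vn.
  by have := htri _ _ _ _ _ xy yt tx vw vn; rewrite leqNgt zg.
have : noC3 (srel z).
  move=> x y t xy yt tx; case/negP: none; apply/existsP; exists x.
  by apply/existsP; exists y; apply/existsP; exists t; rewrite xy yt tx.
by move=> /hno; rewrite leqNgt zg.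
Qed.

(** For 4-regular graphs, where [#|edge U| = 2 * #|V|], this bound and the next two give at least 12
    vertices, at least 30 vertices, and a contradiction. *)
Lemma euler_tri4 : (12 * (#|edge U| + 2) <= 7 * #|edge U| + 12 * #|V|)%N.
Proof.
apply: (@euler_triangles 4) => // z zc zs; have z0 : (0 < supp z)%N by lia.
have [v [w vw]] := supp_edge z0; have np := npairs_srel z.
apply: (find_triangle zc zs) => [n3|x y t p q xy yt tx pq pn].
  by have := npairs_ge8 (srel_sym z) (@srel_irr z) (srel_two zc) vw n3; lia.
by have := npairs_triangle (srel_sym z) (@srel_irr z) (srel_two zc) xy yt tx pq pn; lia.
Qed.

Lemma euler_tri5 : noC4 U -> (15 * (#|edge U| + 2) <= 8 * #|edge U| + 15 * #|V|)%N.
Proof.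
move=> n4; apply: (@euler_triangles 5) => // z zc zs; have z0 : (0 < supp z)%N by lia.
have [v [w vw]] := supp_edge z0; have np := npairs_srel z.
apply: (find_triangle zc zs) => [n3|x y t p q xy yt tx pq pn].
  by have := npairs_ge10 (srel_sym z) (@srel_irr z) (srel_two zc) vw n3 (sub_noC4 n4); lia.
by have := npairs_triangle (srel_sym z) (@srel_irr z) (srel_two zc) xy yt tx pq pn; lia.
Qed.

Lemma euler_tri6 : noC4 U -> noC5 U -> (18 * (#|edge U| + 2) <= 9 * #|edge U| + 18 * #|V|)%N.
Proof.
move=> n4 n5; apply: (@euler_triangles 6) => // z zc zs; have z0 : (0 < supp z)%N by lia.
have [v [w vw]] := supp_edge z0; have np := npairs_srel z.
apply: (find_triangle zc zs) => [n3|x y t p q xy yt tx pq pn].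
  have := npairs_ge12 (srel_sym z) (@srel_irr z) (srel_two zc) vw n3 (sub_noC4 n4) (sub_noC5 n5).
  lia.
have := npairs_triangle12 (srel_sym z) (@srel_irr z) (srel_two zc) (sub_noC4 n4) xy yt tx pq pn.
lia.
Qed.
End OneTriangle.
End Euler.
End SimpleGraph.

Local Close Scope ring_scope.

(** * Developing maps for the groups of the cube and the dodecahedron *)

Definition table : Type := seq (seq nat).
Definition nxt (T : table) (s k : nat) : nat := nth 0 (nth [::] T s) k.
Definition walk (T : table) (k : nat) (w : seq nat) : nat :=
  foldl (fun k s => nxt T s k) k w.

Fixpoint alt (x y l : nat) : seq nat :=
  if l is l'.+1 then x :: alt y x l' else [::].

(* The relations (ab)^p = (bc)^3 = (ac)^2 = 1 of the Coxeter group [p,3], with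
   the generators numbered 0, 1, 2 and each relation solved for its first
   letter. *)
Definition coxeter (p : nat) : seq (nat * seq nat) :=
  [:: (0, alt 1 0 (p.*2.-1)); (1, alt 0 1 (p.*2.-1)); (1, alt 2 1 5);
      (2, alt 1 2 5); (0, alt 2 0 3); (2, alt 0 2 3)].

Definition tree_words (tree : seq (nat * nat)) : seq (seq nat) :=
  foldl (fun ws js => rcons ws (rcons (nth [::] ws js.1) js.2)) [:: [::]] tree.

Fixpoint known_walk (T : table) (known : seq bool) (k : nat) (w : seq nat) : option nat :=
  if w is s :: w' then
    if nth false known (3 * k + s) then known_walk T known (nxt T s k) w' else None
  else Some k.

Definition mark (known : seq bool) (k s : nat) := set_nth false known (3 * k + s) true.

(* Replays a coset enumeration: an equation is learnt when all other edges
   of a relator cycle are known. *)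
Fixpoint replay (p : nat) (T : table) (known : seq bool) (cert : seq (nat * nat)) : option (seq bool) :=
  if cert is (k, r) :: cert' then
    let: (s, w) := nth (3, [::]) (coxeter p) r in
    if [&& s < 3, known_walk T known k w == Some (nxt T s k) & nxt T s (nxt T s k) == k]
    then replay p T (mark (mark known k s) (nxt T s k) s) cert' else None
  else Some known.

Fixpoint mark_tree (T : table) (known : seq bool) (k : nat) (tree : seq (nat * nat)) : option (seq bool) :=
  if tree is (j, s) :: tree' then
    if [&& s < 3, nxt T s j == k & nxt T s k == j]
    then mark_tree T (mark (mark known j s) k s) k.+1 tree' else None
  else Some known.

Definition words_ok (tree : seq (nat * nat)) : bool :=
  let ws := tree_words tree in
  all (fun k => nth [::] ws k.+1 ==
     rcons (nth [::] ws (nth (0, 0) tree k).1) (nth (0, 0) tree k).2)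
   (iota 0 (size tree)).

(** [known] is a bit vector indexed by [3 * k + s]. Entries along the tree hold by the choice of the
    words, [replay] derives the others from the relators, and in the end every entry has to be known
    and in range. *)
Definition table_ok (p : nat) (T : table) (tree cert : seq (nat * nat)) : bool :=
  words_ok tree &&
  if mark_tree T [::] 1 tree is Some known then
    if replay p T known cert is Some known' then
      all (fun k => all (fun s => nth false known' (3 * k + s) && (nxt T s k < (size tree).+1))
         [:: 0; 1; 2]) (iota 0 (size tree).+1)
    else false
  else false.

Section Developing.
Variables (Om : Type) (good : Om -> Prop) (ga gb gc : Om -> Om).
Definition act (s : nat) : Om -> Om :=
  match s with 0 => ga | 1 => gb | _ => gc end.
Definition actw (w : seq nat) (x : Om) : Om := foldl (fun x s => act s x) x w.
Hypothesis act_good : forall s x, good x -> good (act s x).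
Hypothesis act_inv : forall s x, good x -> act s (act s x) = x.
Variable p : nat.
Hypothesis act_cox : forall s w x, (s, w) \in coxeter p -> good x -> act s x = actw w x.

Lemma actw_good w x : good x -> good (actw w x).
Proof. by elim: w x => [|s w IH] x gx //=; apply/IH/act_good. Qed.

Lemma actw_cat w w' x : actw (w ++ w') x = actw w' (actw w x).
Proof. by rewrite /actw foldl_cat. Qed.

Variables (T : table) (tree cert : seq (nat * nat)).
Hypothesis T_ok : table_ok p T tree cert.
Variable x0 : Om.
Hypothesis x0_good : good x0.

Definition dev (k : nat) : Om := actw (nth [::] (tree_words tree) k) x0.

Lemma dev_good k : good (dev k).
Proof. exact: actw_good. Qed.

Let sound (known : seq bool) := forall k s, s < 3 -> nth false known (3 * k + s) ->
  dev (nxt T s k) = act s (dev k).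

Let sound_mark known k s : s < 3 -> sound known -> dev (nxt T s k) = act s (dev k) ->
  sound (mark known k s).
Proof.
move=> s3 snd h k' s' s3'; rewrite nth_set_nth /=.
case: eqP => [E _|_]; last exact: snd.
have [-> ->] : k' = k /\ s' = s by lia.
exact: h.
Qed.

Let sound_mark2 known k s : s < 3 -> sound known -> dev (nxt T s k) = act s (dev k) ->
  nxt T s (nxt T s k) = k -> sound (mark (mark known k s) (nxt T s k) s).
Proof.
move=> s3 snd h inv; apply: sound_mark => //; first exact: sound_mark.
by rewrite inv h act_inv //; exact: dev_good.
Qed.

Let known_walkP known k w k' : all (fun s => s < 3) w -> sound known ->
  known_walk T known k w = Some k' -> dev k' = actw w (dev k).
Proof.
move=> + snd; elim: w k => [|s w IH] k /= => [_ [->]|/andP[s3 aw]] //.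
by case: ifP => // kn /(IH _ aw) ->; rewrite (snd _ _ s3 kn).
Qed.

Let alt_lt3 x y l : x < 3 -> y < 3 -> all (fun s => s < 3) (alt x y l).
Proof. by elim: l x y => [|l IH] x y hx hy //=; rewrite hx IH. Qed.

Let replayP known c known' : sound known -> replay p T known c = Some known' -> sound known'.
Proof.
elim: c known => [|[k r] c IH] known snd; first by case=> <-.
rewrite /=; case E : (nth _ _ r) => [s w].
case: ifP => // /and3P[s3 /eqP kw /eqP inv].
apply: IH; have sw : (s, w) \in coxeter p.
  (* An index out of range would return the default generator 3, which the test [s < 3] rejects. *)
  have rs : r < size (coxeter p).
    by rewrite ltnNge; apply/negP => h; move: E s3; rewrite nth_default // => -[<- _].
  by rewrite -E; exact: mem_nth.
apply: sound_mark2 => //.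
rewrite (act_cox sw (dev_good k)); apply: known_walkP kw => //.
move: sw; rewrite !inE => /or4P[| | |/or3P[]] /eqP[_ ->] //; exact: alt_lt3.
Qed.

Let mark_treeP k known t known' : drop k tree = t -> sound known ->
  (forall i, i < size tree -> dev i.+1 = act (nth (0, 0) tree i).2 (dev (nth (0, 0) tree i).1)) ->
  mark_tree T known k.+1 t = Some known' -> sound known'.
Proof.
move=> + + hdev; elim: t k known => [|[j s] t IH] k known dr snd; first by case=> <-.
rewrite /=; case: ifP => // /and3P[s3 /eqP h1 /eqP h2].
have kt : k < size tree.
  by rewrite ltnNge; apply/negP => h; move: dr; rewrite drop_oversize.
have nk : nth (0, 0) tree k = (j, s).
  by have := nth_drop k (0, 0) tree 0; rewrite dr addn0.
apply: IH.
  by rewrite -addn1 addnC -drop_drop dr /= drop0.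
have := @sound_mark2 known j s s3 snd; rewrite h1 => H; apply: H => //.
by rewrite (hdev k kt) nk.
Qed.

(** The relations alone identify words as the table does, so on any set of flags where they hold the
    orbit of [x0] has at most [(size tree).+1] elements. *)
Lemma dev_nxt k s : k <= size tree -> s < 3 ->
  dev (nxt T s k) = act s (dev k) /\ nxt T s k <= size tree.
Proof.
case/andP: T_ok => /allP wok; case E1 : mark_tree => [known|//].
case E2 : replay => [known'|//] /allP H.
have snd1 : sound known.
  apply: (@mark_treeP 0 [::] tree); rewrite ?drop0 //.
    by move=> k' s' _; rewrite nth_nil.
  move=> i it; have := wok i; rewrite mem_iota /= => /(_ it)/eqP h.
  by rewrite /dev h /actw -cats1 foldl_cat.
have snd2 := replayP snd1 E2.
move=> kt s3; have := H k; rewrite mem_iota ltnS => /(_ kt)/allP/(_ s).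
rewrite !inE => h; have /andP[h1 h2] : nth false known' (3 * k + s) && (nxt T s k < (size tree).+1).
  by apply: h; case: s s3 => [|[|[|]]].
by split; [exact: snd2 | rewrite -ltnS].
Qed.

Lemma dev_walk k w : k <= size tree -> all (fun s => s < 3) w ->
  dev (walk T k w) = actw w (dev k) /\ walk T k w <= size tree.
Proof.
elim: w k => [|s w IH] k kt //= /andP[s3 aw].
by have [<- h2] := dev_nxt kt s3; apply: IH.
Qed.
End Developing.

Definition quot (qs : seq (seq nat)) (t k : nat) : nat := nth 0 (nth [::] qs t) k.
Definition typ (qs : seq (seq nat)) (i : nat) : nat := find (fun q => i \in q) qs.
Definition sec (qs : seq (seq nat)) (i : nat) : nat := index i (nth [::] qs (typ qs i)).

(** The lists [qs] send flags to the points of each type, and [sec] is a section: it picks the first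
    flag above a point. Besides ranges, the checks say that every flag comes from the picked one
    above the same point by a word of [stab], that rules lead to close points, and that every close
    pair comes from a rule. *)
Definition iso_ok (T : table) (n m : nat) (qs : seq (seq nat)) (stab : seq (seq (seq nat)))
   (rules : seq (nat * seq nat * nat)) (P : nat -> nat -> bool) : bool :=
  [&& all (fun r => [&& r.1.1 < size qs, r.2 < size qs & all (fun s => s < 3) r.1.2]) rules,
      all (all (all (fun s => s < 3))) stab,
      all (fun i => (typ qs i < size qs) && (sec qs i < n)) (iota 0 m),
      all (fun t => all (fun k =>
        [&& quot qs t k < m, typ qs (quot qs t k) == t
          & has (fun w => walk T (sec qs (quot qs t k)) w == k) (nth [::] stab t)])
        (iota 0 n)) (iota 0 (size qs)),
      all (fun r => all (fun k => P (quot qs r.1.1 k) (quot qs r.2 (walk T k r.1.2)))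
        (iota 0 n)) rules
    & all (fun i => all (fun j => P i j ==>
        has (fun r => has (fun k => (quot qs r.1.1 k == i) &&
           (quot qs r.2 (walk T k r.1.2) == j)) (iota 0 n)) rules) (iota 0 m)) (iota 0 m)].

Section Isomorphism.
Variables (Om : Type) (good : Om -> Prop) (ga gb gc : Om -> Om).
Let act := act ga gb gc.
Let actw := actw ga gb gc.
Hypothesis act_good : forall s x, good x -> good (act s x).
Hypothesis act_inv : forall s x, good x -> act s (act s x) = x.
Variable p : nat.
Hypothesis act_cox : forall s w x, (s, w) \in coxeter p -> good x -> act s x = actw w x.
Variables (T : table) (tree cert : seq (nat * nat)).
Hypothesis T_ok : table_ok p T tree cert.
Variables (m : nat) (qs : seq (seq nat)) (stab : seq (seq (seq nat))).
Variables (rules : seq (nat * seq nat * nat)) (P : nat -> nat -> bool).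
Hypothesis P_ok : iso_ok T (size tree).+1 m qs stab rules P.
Variables (V : finType) (U : rel V) (proj : nat -> Om -> V).
Hypothesis proj_stab : forall t w x, w \in nth [::] stab t -> good x -> proj t (actw w x) = proj t x.
Hypothesis proj_edge : forall t w t' x, (t, w, t') \in rules -> good x ->
  U (proj t x) (proj t' (actw w x)).
Hypothesis proj_full : forall t x v, t < size qs -> good x -> U (proj t x) v ->
  exists w t', (t, w, t') \in rules /\ v = proj t' (actw w x).
Hypothesis U_conn : forall v w, connect U v w.
Hypothesis V_big : m <= #|V|.
Variable x0 : Om.
Hypothesis x0_good : good x0.
Hypothesis m0 : 0 < m.

Let D := dev ga gb gc tree x0.
Let Dg k : good (D k) := dev_good act_good tree x0_good k.
Let f (i : nat) : V := proj (typ qs i) (D (sec qs i)).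

Let chk_rule r : r \in rules -> [/\ r.1.1 < size qs, r.2 < size qs & all (fun s => s < 3) r.1.2].
Proof. by case/and5P: P_ok => /allP h _ _ _ _ /h /and3P[]. Qed.

Let chk_i i : i < m -> typ qs i < size qs /\ sec qs i <= size tree.
Proof.
case/and5P: P_ok => _ _ /allP h _ _ im; have := h i; rewrite mem_iota leq0n add0n => /(_ im)/andP[h1].
by rewrite ltnS.
Qed.

Let chk_q t k : t < size qs -> k <= size tree ->
  quot qs t k < m /\ proj t (D k) = f (quot qs t k).
Proof.
case/and5P: P_ok => _ /allP h2 _ /allP h _ tq kt.
have := h t; rewrite mem_iota leq0n add0n => /(_ tq)/allP/(_ k); rewrite mem_iota leq0n add0n ltnS => /(_ kt).
case/and3P=> qm /eqP ty /hasP[w ws /eqP wk]; split=> //.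
have aw : all (fun s => s < 3) w.
  have tst : t < size stab.
    by rewrite ltnNge; apply/negP => le; rewrite nth_default // in ws.
  by have /allP := h2 _ (mem_nth [::] tst); apply.
have [_ sm] := chk_i qm.
have [h1 _] := dev_walk act_good act_inv act_cox T_ok x0_good sm aw.
by rewrite /f ty -{1}wk /D h1 proj_stab //; exact: Dg.
Qed.

Let chk_edge r k : r \in rules -> k <= size tree ->
  P (quot qs r.1.1 k) (quot qs r.2 (walk T k r.1.2)).
Proof.
case/and5P: P_ok => _ _ _ _ /andP[/allP h _] rin kt.
by have /allP := h r rin; apply; rewrite mem_iota leq0n add0n ltnS.
Qed.

Let chk_full i j : i < m -> j < m -> P i j -> exists r k, [/\ r \in rules, k <= size tree,
   quot qs r.1.1 k = i & quot qs r.2 (walk T k r.1.2) = j].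
Proof.
case/and5P: P_ok => _ _ _ _ /andP[_ /allP h] im jm pij.
have := h i; rewrite mem_iota leq0n add0n => /(_ im)/allP/(_ j); rewrite mem_iota leq0n add0n => /(_ jm).
rewrite pij implyTb => /hasP[r rin /hasP[k]]; rewrite mem_iota leq0n add0n ltnS => kt /andP[/eqP e1 /eqP e2].
by exists r, k.
Qed.

Let rule_q r k : r \in rules -> k <= size tree ->
  [/\ proj r.1.1 (D k) = f (quot qs r.1.1 k),
      proj r.2 (actw r.1.2 (D k)) = f (quot qs r.2 (walk T k r.1.2)) &
      quot qs r.2 (walk T k r.1.2) < m].
Proof.
move=> rin kt; have [t1 t2 aw] := chk_rule rin.
have [e1 e2] := dev_walk act_good act_inv act_cox T_ok x0_good kt aw.
have [q1 q2] := chk_q t1 kt; have [q3 q4] := chk_q t2 e2.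
by split=> //; rewrite -q4 /D e1.
Qed.

Let f_next i v : i < m -> U (f i) v -> exists j, [/\ j < m, v = f j & P i j].
Proof.
move=> im; have [ti si] := chk_i im; rewrite /f => /(proj_full ti (Dg _))[w [t' [rin ->]]].
have [h1 h2 h3] := rule_q rin si; exists (quot qs t' (walk T (sec qs i) w)); split=> //.
have := chk_edge rin si => /=; congr (P _ _).
rewrite /quot /sec nth_index //.
have tq : has (fun q => i \in q) qs by rewrite has_find.
exact: (nth_find [::] tq).
Qed.

Let f_edge i j : i < m -> j < m -> P i j -> U (f i) (f j).
Proof.
move=> im jm pij; have [[[t w] t'] [k [rin kt <- <-]]] := chk_full im jm pij.
have [/= <- <- _] := rule_q rin kt.
by apply: proj_edge rin _; exact: Dg.
Qed.

Let f_surj v : exists2 i, i < m & f i = v.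
Proof.
case/connectP: (U_conn (f 0) v) => s + ->.
have : exists2 i, i < m & f i = f 0 by exists 0.
elim: s (f 0) => [|y s IH] x //= [i im <-] /andP[/(f_next im)[j [jm -> _]] ps].
by apply: IH ps; exists j.
Qed.

(** [f] sends a point to the projection of its picked flag. Every neighbour of [f i] is some [f j]
    with [P i j], so connectedness makes [f] onto and [m <= #|V|] makes it bijective. Injectivity
    then turns an edge between [f i] and [f j] back into [P i j]. *)
Lemma developing_iso : exists2 F : V -> 'I_m, bijective F &
  forall v w, P (F v) (F w) = U v w.
Proof.
pose g (i : 'I_m) : V := f i.
have surj : forall v, exists i, g i = v.
  by move=> v; have [i im <-] := f_surj v; exists (Ordinal im).
have im_g : image g predT =i predT.
  by move=> v; have [i <-] := surj v; rewrite image_f.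
have inj : injective g.
  apply: in2T; apply/image_injP; rewrite eqn_leq leq_image_card /=.
  by rewrite (eq_card im_g) card_ord.
have [F Fg gF] : bijective g.
  by apply: inj_card_bij => //; rewrite -(eq_card im_g) leq_image_card.
exists F; first by exists g.
move=> v w; rewrite -{2}[v]gF -{2}[w]gF /g.
apply/idP/idP => [|/(f_next (ltn_ord _))[j [jm E pj]]]; first exact: f_edge.
by have -> : F w = Ordinal jm by apply: inj.
Qed.
End Isomorphism.

(* The flags of the cube (4) and of the dodecahedron (5), numbered in
   breadth-first order: a, b, c change the vertex, the edge and the face of a
   flag, tree is the search tree and cert the order in which the remaining
   adjacencies follow from the relations.  vert, edg and fac send a flag to the
   index of the point above its vertex, edge or face in the coordinate list of
   the polyhedron, of its rectification and of its dual; rfac numbers the face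
   points of the rhombic polyhedron, which come after the vertices. *)
Definition tab4a : seq nat := [:: 1; 0; 6; 5; 9; 3; 2; 13; 15; 4; 17; 19; 16; 7; 22; 8; 12; 10; 26;
  11; 24; 29; 14; 27; 20; 33; 18; 23; 36; 21; 37; 35; 39; 25; 40; 31; 28; 30; 43; 32; 34; 45; 44;
  38; 42; 41; 47; 46].
Definition tab4b : seq nat := [:: 2; 4; 0; 8; 1; 11; 12; 14; 3; 16; 18; 5; 6; 21; 7; 23; 9; 25; 10;
  27; 28; 13; 30; 15; 32; 17; 34; 19; 20; 37; 22; 38; 24; 40; 26; 41; 42; 29; 31; 44; 33; 35; 36;
  46; 39; 47; 43; 45].
Definition tab4c : seq nat := [:: 3; 5; 7; 0; 10; 1; 13; 2; 14; 17; 4; 18; 20; 6; 8; 22; 24; 9; 11;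
  26; 12; 28; 15; 31; 16; 32; 19; 35; 21; 36; 38; 23; 25; 39; 41; 27; 29; 43; 30; 33; 45; 34; 46;
  37; 47; 40; 42; 44].
Definition tree4 : seq (nat * nat) := [:: (0, 0); (0, 1); (0, 2); (1, 1); (1, 2); (2, 0); (2, 2);
  (3, 1); (4, 0); (4, 2); (5, 1); (6, 1); (6, 2); (7, 1); (8, 0); (9, 1); (9, 2); (10, 1); (11, 0);
  (12, 2); (13, 1); (14, 0); (15, 1); (16, 2); (17, 1); (18, 0); (19, 1); (20, 1); (21, 0); (22, 1);
  (23, 2); (24, 1); (25, 0); (26, 1); (27, 2); (28, 0); (29, 1); (30, 2); (32, 0); (33, 1); (34, 2);
  (36, 1); (37, 2); (39, 1); (40, 2); (42, 2); (44, 2)].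
Definition cert4 : seq (nat * nat) := [:: (12, 0); (8, 3); (11, 3); (21, 3); (25, 3); (3, 4); (7,
  4); (10, 4); (20, 4); (15, 5); (19, 5); (29, 5); (33, 5); (23, 0); (30, 0); (34, 0); (42, 0); (31,
  2); (35, 2); (43, 2); (45, 2); (31, 4); (38, 4); (41, 4); (46, 4)].
Definition vert4 : seq nat := [:: 0; 1; 0; 0; 1; 1; 2; 0; 0; 3; 1; 1; 2; 2; 0; 4; 3; 3; 1; 5; 2; 2;
  4; 4; 3; 3; 5; 5; 2; 6; 4; 4; 3; 7; 5; 5; 6; 6; 4; 7; 7; 5; 6; 6; 7; 7; 6; 7].
Definition edg4 : seq nat := [:: 0; 0; 8; 0; 10; 0; 8; 8; 4; 10; 10; 5; 1; 8; 4; 4; 1; 10; 5; 5; 1;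
  6; 4; 2; 1; 7; 5; 2; 6; 6; 9; 2; 7; 7; 11; 2; 6; 9; 9; 7; 11; 11; 3; 9; 3; 11; 3; 3].
Definition fac4 : seq nat := [:: 0; 0; 0; 2; 0; 2; 0; 4; 2; 0; 5; 2; 0; 4; 4; 2; 0; 5; 5; 2; 3; 4;
  4; 2; 3; 5; 5; 2; 3; 4; 4; 1; 3; 5; 5; 1; 3; 4; 1; 3; 5; 1; 3; 1; 3; 1; 1; 1].
Definition rfac4 : seq nat := [:: 8; 8; 8; 10; 8; 10; 8; 12; 10; 8; 13; 10; 8; 12; 12; 10; 8; 13;
  13; 10; 11; 12; 12; 10; 11; 13; 13; 10; 11; 12; 12; 9; 11; 13; 13; 9; 11; 12; 9; 11; 13; 9; 11; 9;
  11; 9; 9; 9].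
Definition tab5a : seq nat := [:: 1; 0; 6; 5; 9; 3; 2; 13; 15; 4; 17; 19; 20; 7; 23; 8; 25; 10; 28;
  11; 12; 30; 32; 14; 34; 16; 36; 38; 18; 40; 21; 43; 22; 45; 24; 47; 26; 49; 27; 51; 29; 53; 54;
  31; 56; 33; 58; 35; 60; 37; 62; 39; 64; 41; 42; 67; 44; 69; 46; 71; 48; 73; 50; 75; 52; 77; 78;
  55; 80; 57; 82; 59; 84; 61; 86; 63; 88; 65; 66; 90; 68; 92; 70; 93; 72; 95; 74; 97; 76; 98; 79;
  101; 81; 83; 103; 85; 105; 87; 89; 107; 108; 91; 109; 94; 111; 96; 112; 99; 100; 102; 115; 104;
  106; 117; 116; 110; 114; 113; 119; 118].
Definition tab5b : seq nat := [:: 2; 4; 0; 8; 1; 11; 12; 14; 3; 16; 18; 5; 6; 22; 7; 24; 9; 27; 10;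
  29; 25; 31; 13; 33; 15; 20; 37; 17; 39; 19; 42; 21; 44; 23; 40; 46; 48; 26; 50; 28; 34; 52; 30;
  55; 32; 56; 35; 59; 36; 61; 38; 62; 41; 65; 66; 43; 45; 68; 70; 47; 72; 49; 51; 74; 76; 53; 54;
  78; 57; 81; 58; 83; 60; 84; 63; 87; 64; 89; 67; 85; 91; 69; 93; 71; 73; 79; 96; 75; 98; 77; 100;
  80; 102; 82; 99; 104; 86; 106; 88; 94; 90; 109; 92; 110; 95; 112; 97; 113; 114; 101; 103; 116;
  105; 107; 108; 118; 111; 119; 115; 117].
Definition tab5c : seq nat := [:: 3; 5; 7; 0; 10; 1; 13; 2; 14; 17; 4; 18; 21; 6; 8; 23; 26; 9; 11;
  28; 30; 12; 31; 15; 35; 36; 16; 37; 19; 41; 20; 22; 43; 46; 47; 24; 25; 27; 49; 52; 53; 29; 48;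
  32; 57; 58; 33; 34; 42; 38; 63; 64; 39; 40; 60; 68; 69; 44; 45; 65; 54; 74; 75; 50; 51; 59; 79;
  80; 55; 56; 81; 77; 85; 86; 61; 62; 87; 71; 90; 66; 67; 70; 92; 94; 95; 72; 73; 76; 97; 99; 78;
  100; 82; 103; 83; 84; 104; 88; 107; 89; 91; 108; 110; 93; 96; 111; 113; 98; 101; 115; 102; 105;
  117; 106; 118; 109; 119; 112; 114; 116].
Definition tree5 : seq (nat * nat) := [:: (0, 0); (0, 1); (0, 2); (1, 1); (1, 2); (2, 0); (2, 2);
  (3, 1); (4, 0); (4, 2); (5, 1); (6, 1); (6, 2); (7, 1); (8, 0); (9, 1); (9, 2); (10, 1); (11, 0);
  (12, 0); (12, 2); (13, 1); (14, 0); (15, 1); (16, 0); (16, 2); (17, 1); (18, 0); (19, 1); (20, 2);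
  (21, 1); (22, 0); (23, 1); (24, 0); (24, 2); (25, 2); (26, 1); (27, 0); (28, 1); (29, 0); (29, 2);
  (30, 1); (31, 0); (32, 1); (33, 0); (33, 2); (34, 2); (36, 1); (37, 0); (38, 1); (39, 0); (39, 2);
  (40, 2); (42, 0); (43, 1); (44, 0); (44, 2); (45, 2); (47, 1); (48, 0); (49, 1); (50, 0); (50, 2);
  (51, 2); (53, 1); (54, 1); (55, 0); (55, 2); (56, 2); (58, 1); (59, 0); (60, 1); (61, 0); (61, 2);
  (62, 2); (64, 1); (65, 0); (66, 0); (66, 2); (67, 2); (69, 1); (70, 0); (71, 1); (72, 0); (72, 2);
  (73, 2); (75, 1); (76, 0); (77, 1); (78, 2); (80, 1); (81, 0); (82, 1); (83, 2); (84, 2); (86, 1);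
  (87, 0); (88, 1); (89, 2); (90, 1); (91, 0); (92, 1); (93, 2); (95, 1); (96, 0); (97, 1); (98, 2);
  (100, 0); (101, 1); (102, 2); (104, 0); (105, 1); (106, 2); (108, 1); (109, 2); (111, 1); (112,
  2); (114, 2); (116, 2)].
Definition cert5 : seq (nat * nat) := [:: (20, 1); (8, 3); (11, 3); (22, 3); (27, 3); (42, 3); (3,
  4); (7, 4); (10, 4); (21, 4); (26, 4); (35, 4); (41, 4); (46, 4); (52, 4); (57, 4); (63, 4); (68,
  4); (74, 4); (79, 4); (85, 4); (15, 5); (19, 5); (32, 5); (38, 5); (54, 5); (34, 1); (45, 1); (51,
  1); (67, 1); (73, 1); (35, 2); (41, 2); (57, 2); (63, 2); (79, 2); (59, 3); (70, 3); (76, 3); (91,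
  3); (96, 3); (71, 5); (82, 5); (88, 5); (101, 5); (105, 5); (83, 0); (89, 0); (102, 0); (106, 0);
  (114, 0); (94, 2); (103, 2); (107, 2); (115, 2); (117, 2); (94, 4); (99, 4); (110, 4); (113, 4);
  (118, 4)].
Definition vert5 : seq nat := [:: 0; 8; 0; 0; 8; 8; 12; 0; 0; 10; 8; 8; 12; 12; 0; 16; 10; 10; 8; 4;
  2; 12; 12; 16; 16; 2; 10; 10; 4; 4; 2; 12; 14; 16; 18; 16; 2; 10; 6; 4; 18; 4; 2; 14; 14; 1; 16;
  18; 2; 6; 6; 13; 4; 18; 17; 14; 1; 14; 1; 18; 17; 6; 13; 6; 13; 18; 17; 3; 14; 1; 1; 5; 17; 19; 6;
  13; 13; 5; 3; 17; 3; 1; 9; 5; 19; 17; 19; 13; 15; 5; 3; 3; 9; 9; 5; 19; 19; 15; 15; 5; 3; 11; 9;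
  9; 19; 7; 15; 15; 11; 11; 9; 7; 7; 15; 11; 11; 7; 7; 11; 7].
Definition edg5 : seq nat := [:: 6; 6; 14; 6; 4; 6; 14; 14; 22; 4; 4; 10; 18; 14; 22; 22; 8; 4; 10;
  10; 18; 18; 0; 22; 2; 8; 8; 12; 10; 24; 18; 0; 0; 26; 2; 2; 8; 12; 12; 15; 24; 24; 23; 0; 16; 26;
  26; 2; 23; 12; 19; 15; 15; 24; 23; 20; 16; 16; 26; 28; 23; 25; 19; 19; 15; 28; 27; 20; 20; 16; 7;
  28; 3; 25; 25; 19; 1; 28; 27; 27; 20; 7; 7; 11; 3; 3; 25; 1; 1; 17; 27; 9; 7; 11; 11; 3; 29; 1;
  17; 17; 9; 9; 5; 11; 29; 29; 21; 17; 9; 5; 5; 29; 21; 21; 13; 5; 13; 21; 13; 13].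
Definition fac5 : seq nat := [:: 8; 8; 8; 0; 8; 0; 8; 4; 0; 8; 10; 0; 8; 4; 4; 0; 8; 10; 10; 0; 8;
  6; 4; 4; 0; 8; 1; 10; 10; 0; 6; 6; 4; 4; 0; 2; 1; 1; 10; 10; 0; 5; 6; 6; 4; 4; 2; 2; 1; 1; 10; 10;
  5; 5; 6; 6; 4; 9; 2; 2; 1; 1; 10; 7; 5; 5; 6; 6; 9; 9; 2; 2; 1; 1; 7; 7; 5; 5; 6; 3; 9; 9; 2; 2;
  1; 3; 7; 7; 5; 5; 3; 9; 9; 2; 11; 3; 7; 7; 5; 11; 3; 9; 9; 11; 3; 7; 7; 11; 3; 9; 11; 3; 7; 11; 3;
  11; 3; 11; 11; 11].
Definition rfac5 : seq nat := [:: 24; 24; 24; 20; 24; 20; 24; 28; 20; 24; 25; 20; 24; 28; 28; 20;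
  24; 25; 25; 20; 24; 29; 28; 28; 20; 24; 22; 25; 25; 20; 29; 29; 28; 28; 20; 21; 22; 22; 25; 25;
  20; 30; 29; 29; 28; 28; 21; 21; 22; 22; 25; 25; 30; 30; 29; 29; 28; 26; 21; 21; 22; 22; 25; 31;
  30; 30; 29; 29; 26; 26; 21; 21; 22; 22; 31; 31; 30; 30; 29; 23; 26; 26; 21; 21; 22; 23; 31; 31;
  30; 30; 23; 26; 26; 21; 27; 23; 31; 31; 30; 27; 23; 26; 26; 27; 23; 31; 31; 27; 23; 26; 27; 23;
  31; 27; 23; 27; 23; 27; 27; 27].

Definition tab4 := [:: tab4a; tab4b; tab4c].
Definition tab5 := [:: tab5a; tab5b; tab5c].

Lemma tab4_ok : table_ok 4 tab4 tree4 cert4.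
Proof. by vm_compute. Qed.

Lemma tab5_ok : table_ok 5 tab5 tree5 cert5.
Proof. by vm_compute. Qed.

Definition close (s : seq point) (d : zphi) (i j : nat) : bool :=
  dist2 (nth (0, 0, 0)%R s i) (nth (0, 0, 0)%R s j) == d.

(* The words stabilizing the vertex, edge or face of a flag, and the words
   leading from a flag to flags over the adjacent points. *)
Definition vstab := [:: [::]; [:: 1]; [:: 2]; [:: 1; 2]; [:: 2; 1]; [:: 1; 2; 1]].
Definition estab := [:: [::]; [:: 0]; [:: 2]; [:: 0; 2]].
Definition fstab p := [seq alt 0 1 l | l <- iota 0 p.+1] ++ [seq alt 1 0 l | l <- iota 1 p].

Definition vrules := [:: (0, [:: 0], 0); (0, [:: 1; 0], 0); (0, [:: 2; 1; 0], 0)].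
Definition erules := [:: (0, [:: 1], 0); (0, [:: 2; 1], 0); (0, [:: 0; 1], 0); (0, [:: 2; 0; 1], 0)].
Definition frules p := (0, [:: 2], 0) :: [seq (0, rcons (alt 1 0 l.*2.+1) 2, 0) | l <- iota 0 p.-1].
Definition xrules p := [:: (0, [::], 1); (0, [:: 2], 1); (0, [:: 1; 2], 1)] ++
  [seq (1, alt 1 0 l.*2, 0) | l <- iota 0 p].

Lemma cube_ok : iso_ok tab4 (size tree4).+1 (size cube_vertices) [:: vert4] [:: vstab] vrules
  (close cube_vertices (zint 4)).
Proof. by vm_compute. Qed.

Lemma dodecahedron_ok : iso_ok tab5 (size tree5).+1 (size dodecahedron_vertices) [:: vert5] [:: vstab] vrules
  (close dodecahedron_vertices (8, - 4)%R).
Proof. by vm_compute. Qed.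

Lemma octahedron_ok : iso_ok tab4 (size tree4).+1 (size octahedron_vertices) [:: fac4] [:: fstab 4] (frules 4)
  (close octahedron_vertices (zint 2)).
Proof. by vm_compute. Qed.

Lemma icosahedron_ok : iso_ok tab5 (size tree5).+1 (size icosahedron_vertices) [:: fac5] [:: fstab 5] (frules 5)
  (close icosahedron_vertices (zint 4)).
Proof. by vm_compute. Qed.

Lemma cuboctahedron_ok : iso_ok tab4 (size tree4).+1 (size cuboctahedron_vertices) [:: edg4] [:: estab] erules
  (close cuboctahedron_vertices (zint 2)).
Proof. by vm_compute. Qed.

Lemma icosidodecahedron_ok : iso_ok tab5 (size tree5).+1 (size icosidodecahedron_vertices) [:: edg5] [:: estab] erules
  (close icosidodecahedron_vertices (zint 4)).
Proof. by vm_compute. Qed.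

Lemma rhombic_dodecahedron_ok : iso_ok tab4 (size tree4).+1 (size rhombic_dodecahedron_vertices)
  [:: vert4; rfac4] [:: vstab; fstab 4] (xrules 4)
  (close rhombic_dodecahedron_vertices (zint 3)).
Proof. by vm_compute. Qed.

Lemma rhombic_triacontahedron_ok : iso_ok tab5 (size tree5).+1 (size rhombic_triacontahedron_vertices)
  [:: vert5; rfac5] [:: vstab; fstab 5] (xrules 5)
  (close rhombic_triacontahedron_vertices (3, - 1)%R).
Proof. by vm_compute. Qed.

Lemma skeletonE s d i j : skeleton s d i j = close s d i j.
Proof. by rewrite /skeleton /close !(tnth_nth (0, 0, 0)%R). Qed.

(** * Flag actions of Coxeter groups *)

Section Develop.
Variables (Om : Type) (good : Om -> Prop) (ga gb gc : Om -> Om) (p : nat).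
Let act := act ga gb gc.
Let actw := actw ga gb gc.

Definition flag_action : Prop :=
  [/\ forall s x, good x -> good (act s x),
      forall s x, good x -> act s (act s x) = x &
      forall s w x, (s, w) \in coxeter p -> good x -> act s x = actw w x].

Lemma flag_actionI :
  (forall x, good x -> good (ga x) /\ ga (ga x) = x) ->
  (forall x, good x -> good (gb x) /\ gb (gb x) = x) ->
  (forall x, good x -> good (gc x) /\ gc (gc x) = x) ->
  (forall x, good x -> actw (alt 0 1 p.*2) x = x) ->
  (forall x, good x -> gb (gc (gb (gc (gb (gc x))))) = x) ->
  (forall x, good x -> ga (gc (ga (gc x))) = x) -> 0 < p -> flag_action.
Proof.
move=> ha hb hc hab hbc hac p0.
have hg s x : good x -> good (act s x).
  by rewrite /act; case: s => [/ha[]|[/hb[]|s /hc[]]].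
have hi s x : good x -> act s (act s x) = x.
  by rewrite /act; case: s => [/ha[]|[/hb[]|s /hc[]]].
have hgw w x : good x -> good (actw w x).
  by elim: w x => [|s w IH] x gx //; apply: (IH (act s x)); exact: hg.
have rev_id w x : good x -> actw (rev w) (actw w x) = x.
  elim: w x => [|s w IH] x gx //=; rewrite rev_cons -cats1 /actw actw_cat.
  by have := IH _ (hg s _ gx); rewrite /actw => ->; exact: hi.
(* A relator read backwards is a relator, and so are its rotations. *)
have solve s w x : (forall x, good x -> actw (s :: w) x = x) -> good x -> act s x = actw (rev w) x.
  move=> h gx; rewrite -[x in RHS]h //= -[in RHS]/(actw w (act s x)).
  by rewrite rev_id //; apply: hg.
have rot s w x : (forall x, good x -> actw (s :: w) x = x) -> good x -> actw (rcons w s) x = x.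
  move=> h gx; rewrite -cats1 /actw actw_cat /= -/actw -[RHS](hi s) //.
  congr (act s _); rewrite -[RHS](h _ (hg s _ gx)) /= -/act.
  by rewrite -/act hi.
have alt_last a b n : alt a b n.+1 = rcons (alt a b n) (if odd n then b else a).
  elim: n a b => [|n IH] a b //.
  by rewrite -[LHS]/(a :: alt b a n.+1) IH /=; case: (odd n).
have alt_rev a b n : rev (alt a b n) = if odd n then alt a b n else alt b a n.
  elim: n a b => [|n IH] a b //=.
  rewrite rev_cons IH; case o: (odd n) => /=.
    by rewrite -[RHS]/(alt b a n.+1) alt_last o.
  by rewrite -[RHS]/(alt a b n.+1) alt_last o.
split=> // s w x; rewrite !inE.
have pE : p.*2 = (p.*2.-1).+1 by rewrite prednK // double_gt0.
have oddp : odd p.*2.-1 by rewrite -[odd _]negbK -[~~ odd _]/(odd p.*2.-1.+1) -pE odd_double.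
case/or4P => [| | |/or3P[]] /eqP[-> ->] gx.
- rewrite (solve _ (alt 1 0 p.*2.-1)) // ?alt_rev ?oddp // => y gy.
  by rewrite -[RHS](hab y gy) pE.
- rewrite (solve _ (alt 0 1 p.*2.-1)) // ?alt_rev ?oddp // => y gy.
  have -> : 1 :: alt 0 1 p.*2.-1 = rcons (alt 1 0 p.*2.-1) 0.
    by rewrite -[LHS]/(alt 1 0 p.*2.-1.+1) alt_last oddp.
  by apply: rot => // z gz; rewrite -[RHS](hab z gz) pE.
- rewrite (solve _ (alt 2 1 5)) // => y gy.
  by apply: (rot 2 [:: 1; 2; 1; 2; 1]) => // z gz; exact: hbc.
- by rewrite (solve _ (alt 1 2 5)) // => y gy; exact: hbc.
- rewrite (solve _ (alt 2 0 3)) // => y gy.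
  by apply: (rot 2 [:: 0; 2; 0]) => // z gz; exact: hac.
- by rewrite (solve _ (alt 0 2 3)) // => y gy; exact: hac.
Qed.
End Develop.

Lemma flag_iso (Om : Type) (good : Om -> Prop) (ga gb gc : Om -> Om) (p : nat)
    (T : table) (tree cert : seq (nat * nat)) (s : seq point) (d : zphi)
    (qs : seq (seq nat)) (stab : seq (seq (seq nat))) (rules : seq (nat * seq nat * nat))
    (V : finType) (U : rel V) (proj : nat -> Om -> V) (x0 : Om) :
  table_ok p T tree cert ->
  iso_ok T (size tree).+1 (size s) qs stab rules (close s d) ->
  flag_action good ga gb gc p ->
  (forall t w x, w \in nth [::] stab t -> good x -> proj t (actw ga gb gc w x) = proj t x) ->
  (forall t w t' x, (t, w, t') \in rules -> good x ->
     U (proj t x) (proj t' (actw ga gb gc w x))) ->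
  (forall t x v, t < size qs -> good x -> U (proj t x) v ->
     exists w t', (t, w, t') \in rules /\ v = proj t' (actw ga gb gc w x)) ->
  (forall v w, connect U v w) -> good x0 -> 0 < size s <= #|V| ->
  graph_iso U (skeleton s d).
Proof.
move=> Tok Pok [h1 h2 h3] stabP ruleP fullP conn gx /andP[s0 sV].
have [F bF FE] := developing_iso h1 h2 h3 Tok Pok stabP ruleP fullP conn sV gx s0.
by exists F => // v w; rewrite skeletonE FE.
Qed.

(** * Cubic graphs *)

Lemma card2P (V : finType) (P : pred V) v : #|P| = 2 -> P v ->
  exists2 x, x != v & forall y, P y = (y == v) || (y == x).
Proof.
move=> c2 Pv; have : #|[predD1 P & v]| = 1.
  by have := cardD1 v P; rewrite c2 [v \in P]Pv => -[].
move=> /mem_card1[x hx]; exists x.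
  by have := hx x; rewrite !inE eqxx => /andP[].
move=> y; have := hx y; rewrite !inE -topredE /=.
by case: eqVneq => [->|_] //=.
Qed.

Section Walks.
Variables (V : finType) (U : rel V).
Hypothesis Us : symmetric U.

Definition degree v := #|[pred w | U v w]|.
Definition walks2 (v w : V) : nat := \sum_u (U v u && U u w).
Definition walks3 (v w : V) : nat := \sum_u U v u * walks2 u w.

Lemma walks2E v w : walks2 v w = #|[pred u | U v u && U u w]|.
Proof. by rewrite /walks2 -sum1_card [RHS]big_mkcond; apply: eq_bigr => u _; rewrite inE; case: ifP. Qed.

Lemma walks2C v w : walks2 v w = walks2 w v.
Proof. by apply: eq_bigr => u _; rewrite andbC (Us u w) (Us v u). Qed.

Lemma walks3E v w : walks3 v w = #|[pred p : V * V | [&& U v p.1, U p.1 p.2 & U p.2 w]]|.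
Proof.
rewrite -sum1_card big_mkcond /= -(pair_big predT predT (fun x y =>
  if [&& U v x, U x y & U y w] then 1 else 0)) /=; apply: eq_bigr => x _.
rewrite /walks2 big_distrr /=; apply: eq_bigr => y _.
by case: (U v x); case: (U x y && U y w); rewrite ?muln0 ?mul0n.
Qed.

Lemma walks3C v w : walks3 v w = walks3 w v.
Proof.
rewrite /walks3 /walks2; under eq_bigr do rewrite big_distrr.
under [RHS]eq_bigr do rewrite big_distrr.
rewrite exchange_big /=; apply: eq_bigr => y _; apply: eq_bigr => x _.
by rewrite -!mulnb (Us y w) (Us x y) (Us v x); lia.
Qed.

Lemma degree_enum v n : degree v = n ->
  exists s, [/\ size s = n, uniq s & forall w, U v w = (w \in s)].
Proof.
move=> d; exists (enum [pred w | U v w]); split; first by rewrite -cardE.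
  exact: enum_uniq.
by move=> w; rewrite mem_enum inE.
Qed.

Lemma degree_span v s : uniq s -> all (U v) s -> size s = degree v ->
  forall w, U v w = (w \in s).
Proof.
move=> us /allP h sz.
have sub : {subset s <= enum [pred w | U v w]} by move=> w /h; rewrite mem_enum inE.
have [|_ E] := uniq_min_size us sub; first by rewrite -cardE sz.
by move=> w; rewrite E mem_enum inE.
Qed.

(** A list closed under adjacency exhausts a connected graph. This is how local structures that
    close up early are bounded, before Euler's lower bound excludes them. *)
Lemma closed_card (s : seq V) : (forall v w, connect U v w) -> s != [::] ->
  (forall v w, v \in s -> U v w -> w \in s) -> #|V| <= size s.
Proof.
move=> conn; case: s => // v s _ cl.
have all_in w : w \in v :: s.
  case/connectP: (conn v w) => p; have : v \in v :: s by rewrite inE eqxx.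
  move: {1 3 4}v => u; elim: p u => [|y p IH] u us /=; first by move=> _ ->.
  by case/andP=> uy pp E; apply: (IH y _ pp E); apply: cl uy.
by rewrite cardE; apply: uniq_leq_size (enum_uniq V) _ => w _; exact: all_in.
Qed.

Lemma sum_degree d : irreflexive U -> (forall v, degree v = d) -> d * #|V| = 2 * #|edge U|.
Proof.
move=> Ui hd; rewrite -(sum_deg Us Ui).
rewrite (eq_bigr (fun=> d)); last by move=> v _; exact: hd.
by rewrite sum_nat_const mulnC.
Qed.
End Walks.

Section Third.
Variables (V : finType) (U : rel V).

Definition third (v a b : V) : V := odflt v [pick c | [&& U v c, c != a & c != b]].

Lemma thirdP v a b : degree U v = 3 -> U v a -> U v b -> a != b ->
  [/\ U v (third v a b), third v a b != a, third v a b != b &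
      forall w, U v w = (w \in [:: a; b; third v a b])].
Proof.
move=> U3 va vb ab.
have [c cP] : exists c, [&& U v c, c != a & c != b].
  have [s [sz us hs]] := degree_enum U3.
  have [h|/allPn[c cs]] := boolP (all (mem [:: a; b]) s).
    by have := uniq_leq_size us (allP h); rewrite sz.
  by rewrite !inE negb_or => h; exists c; rewrite hs cs.
have /and3P[h1 h2 h3] : [&& U v (third v a b), third v a b != a & third v a b != b].
  by rewrite /third; case: pickP => //= /(_ c); rewrite cP.
split=> //; apply: degree_span; last by rewrite U3.
  by rewrite /= !inE !negb_or ab eq_sym h2 eq_sym h3.
by rewrite /= va vb h1.
Qed.

Lemma third_eq v a b c : degree U v = 3 -> U v a -> U v b -> U v c -> a != b -> c != a -> c != b ->
  third v a b = c.
Proof.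
move=> U3 va vb vc ab ca cb; have [_ _ _ h] := thirdP U3 va vb ab.
by move: vc; rewrite h !inE (negPf ca) (negPf cb) /= => /eqP.
Qed.
End Third.

Section CubicFlags.
Variables (V : finType) (U : rel V).
Hypothesis Us : symmetric U.
Hypothesis U3 : forall v, degree U v = 3.

(* [nx v u1 u2 x]: the face through u2, v, u1 continues to x. *)
Variable nx : V -> V -> V -> V -> bool.
Hypothesis nx_ex : forall v u1 u2, U v u1 -> U v u2 -> u1 != u2 -> exists x, nx v u1 u2 x.
Hypothesis nx_prop : forall v u1 u2 x, U v u1 -> U v u2 -> u1 != u2 -> nx v u1 u2 x ->
  U u1 x /\ x != v.
Hypothesis nx_uniq : forall v u1 u2 x x', U v u1 -> U v u2 -> u1 != u2 ->
  nx v u1 u2 x -> nx v u1 u2 x' -> x = x'.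
Hypothesis nx_rev : forall v u1 u2 x, U v u1 -> U v u2 -> u1 != u2 ->
  nx v u1 u2 x -> nx u1 v x u2.

(** A flag is a corner: a vertex, the edge to the second entry, and the face that also contains the
    edge to the third. *)
Definition cflag : Type := (V * V * V)%type.
Definition cgood (x : cflag) : Prop := [/\ U x.1.1 x.1.2, U x.1.1 x.2 & x.1.2 != x.2].
Definition ca (x : cflag) : cflag :=
  (x.1.2, x.1.1, odflt x.1.1 [pick y | nx x.1.1 x.1.2 x.2 y]).
Definition cb (x : cflag) : cflag := (x.1.1, x.2, x.1.2).
Definition cc (x : cflag) : cflag := (x.1.1, x.1.2, third U x.1.1 x.1.2 x.2).

Lemma caE v u1 u2 x : U v u1 -> U v u2 -> u1 != u2 -> nx v u1 u2 x ->
  ca (v, u1, u2) = (u1, v, x).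
Proof.
move=> h1 h2 h3 n; rewrite /ca /=; case: pickP => [y ny|/(_ x)]; last by rewrite n.
by rewrite /= (nx_uniq h1 h2 h3 n ny).
Qed.

Lemma ccE v u1 u2 u3 : U v u1 -> U v u2 -> U v u3 -> u1 != u2 -> u3 != u1 -> u3 != u2 ->
  cc (v, u1, u2) = (v, u1, u3).
Proof. by move=> *; rewrite /cc /= (third_eq (U3 v) (c := u3)). Qed.

Variables (p : nat) (T : table) (tree cert : seq (nat * nat)) (s : seq point) (d : zphi)
  (q : seq nat).
Hypothesis Tok : table_ok p T tree cert.
Hypothesis Pok : iso_ok T (size tree).+1 (size s) [:: q] [:: vstab] vrules (close s d).
Hypothesis p0 : 0 < p.
Hypothesis cab : forall x, cgood x -> actw ca cb cc (alt 0 1 p.*2) x = x.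
Hypothesis conn : forall v w, connect U v w.
Hypothesis V0 : 0 < #|V|.
Hypothesis sV : 0 < size s <= #|V|.

Lemma cubic_iso : graph_iso U (skeleton s d).
Proof.
have fa : flag_action cgood ca cb cc p.
  apply: flag_actionI => //.
  - move=> [[v u1] u2] [/= h1 h2 h3]; have [x nxx] := nx_ex h1 h2 h3.
    have [h4 h5] := nx_prop h1 h2 h3 nxx; rewrite (caE h1 h2 h3 nxx); split.
      by split=> //=; rewrite 1?Us // eq_sym.
    have h1' : U u1 v by rewrite Us.
    have h5' : v != x by rewrite eq_sym.
    by rewrite (caE h1' h4 h5' (nx_rev h1 h2 h3 nxx)).
  - by move=> [[v u1] u2] [/= h1 h2 h3]; split=> //; split=> //=; rewrite eq_sym.
  - move=> [[v u1] u2] [/= h1 h2 h3]; have [h4 h5 h6 _] := thirdP (U3 _) h1 h2 h3.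
    split; first by split=> //=; rewrite eq_sym.
    rewrite {2}/cc /= (@ccE _ _ _ u2) // ?(eq_sym u2) // eq_sym //.
  (* The relation (bc)^3 = 1: the two maps act as adjacent transpositions on the three neighbours of
     [v]. *)
  - move=> [[v u1] u2] [/= h1 h2 h3]; have [h4 h5 h6 _] := thirdP (U3 _) h1 h2 h3.
    set u3 := third U v u1 u2 in h4 h5 h6.
    have [n1 n2 n3] : [/\ u2 != u1, u1 != u3 & u2 != u3] by rewrite ![_ == u3]eq_sym eq_sym.
    have cbE x y z : cb (x, y, z) = (x, z, y) by [].
    by rewrite (@ccE _ _ _ u3) // cbE (@ccE _ _ _ u2) // cbE (@ccE _ _ _ u1).
  (* The relation (ac)^2 = 1: the two faces along the edge from [v] to [u1] continue to different
     neighbours [x] and [x3] of [u1], since [nx] is reversible and unique. *)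
  - move=> [[v u1] u2] [/= h1 h2 h3]; have [h4 h5 h6 hw] := thirdP (U3 _) h1 h2 h3.
    set u3 := third U v u1 u2 in h4 h5 h6 hw.
    have [n1 n2 n3] : [/\ u2 != u1, u1 != u3 & u2 != u3] by rewrite ![_ == u3]eq_sym eq_sym.
    rewrite (@ccE _ _ _ u3) //.
    have [x nxx] := nx_ex h1 h2 h3; have [x3 nx3] := nx_ex h1 h4 n2.
    have [xu xv] := nx_prop h1 h2 h3 nxx; have [xu3 xv3] := nx_prop h1 h4 n2 nx3.
    have h1' : U u1 v by rewrite Us.
    have xx3 : x3 != x.
      apply/eqP => E; rewrite E in nx3; have vx : v != x by rewrite eq_sym.
      have := nx_uniq h1' xu vx (nx_rev h1 h2 h3 nxx) (nx_rev h1 h4 n2 nx3).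
      by move=> E'; rewrite E' eqxx in n3.
    rewrite (caE h1 h4 n2 nx3) (@ccE _ _ _ x) // 1?eq_sym //.
    by rewrite (caE h1' xu _ (nx_rev h1 h2 h3 nxx)) // eq_sym.
have /card_gt0P[v _] := V0.
have [s3 [sz us hs]] := degree_enum (U3 v).
case: s3 sz us hs => [|a [|b s3]] // _ us hs.
apply: (flag_iso (proj := fun _ (x : cflag) => x.1.1) (x0 := (v, a, b)) Tok Pok fa) => //.
- by case=> [|[]] //= w x; rewrite !inE => /or4P[| | |/or3P[]] /eqP ->.
- move=> t w t' [[u u1] u2]; rewrite !inE => h [/= h1 h2 h3].
  have [h4 h5 h6 hw] := thirdP (U3 _) h1 h2 h3.
  by case/or3P: h => /eqP[_ -> _] /=.
- case=> [|//] [[u u1] u2] w _ [/= h1 h2 h3] uw.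
  have [h4 h5 h6 hw] := thirdP (U3 _) h1 h2 h3.
  move: uw; rewrite hw !inE => /or3P[] /eqP ->.
  + by exists [:: 0], 0; rewrite !inE eqxx.
  + by exists [:: 1; 0], 0; rewrite !inE eqxx orbT.
  + by exists [:: 2; 1; 0], 0; rewrite !inE eqxx !orbT.
- split=> /=; rewrite ?hs ?inE ?eqxx ?orbT //.
  by move: us; rewrite /= inE negb_or => /andP[/andP[]].
Qed.
End CubicFlags.

Section CubicCases.
Variables (V : finType) (U : rel V).
Hypothesis Us : symmetric U.
Hypothesis Ui : irreflexive U.
Hypothesis U3 : forall v, degree U v = 3.
Hypothesis conn : forall v w, connect U v w.
Hypothesis V0 : 0 < #|V|.
Hypothesis gm : gridmodel (@esrc V U) (@etgt V U).

Let neq x y : U x y -> x != y.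
Proof. by apply: contraTN => /eqP ->; rewrite Ui. Qed.

Let ne2 : 3 * #|V| = 2 * #|edge U| := sum_degree Us Ui U3.
Let VE : #|V| < #|edge U|.
Proof. by move: ne2 V0; lia. Qed.

(** Two neighbours of [v] have exactly one further common neighbour; the 4-cycle through it is the
    face at that corner. *)
Lemma cubic_cube : noC3 U ->
  (forall v a b, U v a -> U v b -> a != b -> walks2 U a b = 2) -> graph_iso U cube.
Proof.
move=> n3 w2.
have other v u1 u2 : U v u1 -> U v u2 -> u1 != u2 -> exists x, [/\ U u1 x, U u2 x, x != v &
    forall y, U u1 y -> U u2 y -> y = v \/ y = x].
  move=> h1 h2 h3; have := w2 v u1 u2 h1 h2 h3; rewrite walks2E => c2.
  have [|x xv xP] := card2P c2 (v := v); first by rewrite /= Us h1.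
  have := xP x; rewrite /= eqxx orbT => /andP[x1 x2].
  exists x; split=> //; first sd.
  by move=> y y1 y2; have := xP y; rewrite /= y1 Us y2 => /esym/orP[] /eqP ->; [left|right].
pose nx v u1 u2 x := [&& U u1 x, U x u2 & x != v].
have rot v u1 u2 x : U v u1 -> U v u2 -> u1 != u2 -> nx v u1 u2 x -> nx u1 x v u2.
  move=> h1 h2 h3 /and3P[h4 h5 h6]; rewrite /nx h5 eq_sym h3 andbT /=.
  by rewrite Us.
have nx_ex v u1 u2 : U v u1 -> U v u2 -> u1 != u2 -> exists x, nx v u1 u2 x.
  move=> h1 h2 h3; have [x [x1 x2 xv _]] := other _ _ _ h1 h2 h3.
  by exists x; rewrite /nx x1 Us x2 xv.
have nx_prop v u1 u2 x : U v u1 -> U v u2 -> u1 != u2 -> nx v u1 u2 x -> U u1 x /\ x != v.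
  by move=> _ _ _ /and3P[].
have nx_uniq v u1 u2 x x' : U v u1 -> U v u2 -> u1 != u2 ->
    nx v u1 u2 x -> nx v u1 u2 x' -> x = x'.
  move=> h1 h2 h3 /and3P[a1 a2 a3] /and3P[b1 b2 b3].
  have [y [_ _ yv yP]] := other _ _ _ h1 h2 h3.
  rewrite Us in a2; rewrite Us in b2.
  have := yP _ a1 a2; have := yP _ b1 b2.
  by case=> E; rewrite E ?eqxx // in b3 *; case=> E'; rewrite E' ?eqxx // in a3 *.
have nx_rev v u1 u2 x : U v u1 -> U v u2 -> u1 != u2 -> nx v u1 u2 x -> nx u1 v x u2.
  by move=> h1 h2 h3 /and3P[h4 h5 h6]; rewrite /nx h2 Us h5 eq_sym h3.
apply: (cubic_iso Us U3 nx_ex nx_prop nx_uniq nx_rev tab4_ok cube_ok) => //.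
- move=> [[v u1] u2] [/= h1 h2 h3].
  have E w0 w1 w2' w3 : U w1 w2' -> U w1 w0 -> w2' != w0 -> nx w1 w2' w0 w3 ->
     cb (ca nx (w1, w2', w0)) = (w2', w3, w1).
    by move=> k1 k2 k3 n; rewrite (caE nx_uniq k1 k2 k3 n).
  have [x n1] := nx_ex _ _ _ h1 h2 h3; have /and3P[a1 a2 a3] := n1.
  have n2 := rot _ _ _ _ h1 h2 h3 n1.
  have h1' : U u1 v by rewrite Us.
  have n3' := rot _ _ _ _ a1 h1' a3 n2.
  have a1' : U x u1 by rewrite Us.
  have h3' : u2 != u1 by sd.
  have n4 := rot _ _ _ _ a2 a1' h3' n3'.
  have h2' : U u2 v by rewrite Us.
  have a2' : U u2 x by rewrite Us.
  rewrite /= (E _ _ _ _ h1 h2 h3 n1) (E _ _ _ _ a1 h1' a3 n2).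
  have a3' : v != x by sd.
  by rewrite (E _ _ _ _ a2 a1' h3' n3') (E _ _ _ _ h2' a2' a3' n4).
- have -> : size cube_vertices = 8 by [].
  by have := euler4 Us Ui gm V0 VE n3; move: ne2; lia.
Qed.

(** The unique 3-walk between two neighbours of [v] closes to the pentagon that serves as the face
    at that corner. For cubic graphs [euler5] asks for at least 20 vertices. *)
Lemma cubic_dodecahedron : noC3 U -> noC4 U ->
  (forall v a b, U v a -> U v b -> a != b -> walks3 U a b = 1) -> graph_iso U dodecahedron.
Proof.
move=> n3 n4 w3.
pose pent v u1 x y u2 := [&& U v u1, U u1 x, U x y, U y u2 & U u2 v].
have pent_rot v u1 x y u2 : pent v u1 x y u2 = pent u1 x y u2 v.
  by apply/and5P/and5P => -[*]; split.
have pent_flip v u1 x y u2 : pent v u1 x y u2 = pent v u2 y x u1.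
  by apply/and5P/and5P => -[*]; split; sd.
have ex v u1 u2 : U v u1 -> U v u2 -> u1 != u2 -> exists x y, pent v u1 x y u2 /\
    forall x' y', pent v u1 x' y' u2 -> x' = x /\ y' = y.
  move=> h1 h2 h3; have := w3 v u1 u2 h1 h2 h3; rewrite walks3E => /mem_card1[[x y] h].
  exists x, y; have h2' : U u2 v by sd.
  have E x' y' : pent v u1 x' y' u2 = ((x', y') == (x, y)).
    by have := h (x', y'); rewrite !inE /= => <-; rewrite /pent h1 h2' /= andbT.
  by rewrite E eqxx; split=> // x' y'; rewrite E => /eqP[].
pose nx v u1 u2 x := [exists y, pent v u1 x y u2].
have nx_ex v u1 u2 : U v u1 -> U v u2 -> u1 != u2 -> exists x, nx v u1 u2 x.
  move=> h1 h2 h3; have [x [y [h _]]] := ex _ _ _ h1 h2 h3.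
  by exists x; apply/existsP; exists y.
have pent_neq v u1 x y u2 : u1 != u2 -> pent v u1 x y u2 ->
    [/\ x != v, y != u1, u2 != x & v != y].
  move=> ne /and5P[h1 h2 h3 h4 h5].
  split; apply/eqP => E; rewrite E in h1 h2 h3 h4 h5 *.
  - exact: (n3 v y u2).
  - by apply: (n3 v u1 u2).
  - by apply: (n3 v u1 x).
  - by apply: (n3 y u1 x).
have nx_prop v u1 u2 x : U v u1 -> U v u2 -> u1 != u2 -> nx v u1 u2 x -> U u1 x /\ x != v.
  move=> h1 h2 h3 /existsP[y hp]; have [? _ _ _] := pent_neq _ _ _ _ _ h3 hp.
  by case/and5P: hp.
have nx_uniq v u1 u2 x x' : U v u1 -> U v u2 -> u1 != u2 ->
    nx v u1 u2 x -> nx v u1 u2 x' -> x = x'.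
  move=> h1 h2 h3 /existsP[y hp] /existsP[y' hp'].
  have [x0 [y0 [_ h]]] := ex _ _ _ h1 h2 h3.
  by have [-> _] := h _ _ hp; have [-> _] := h _ _ hp'.
have nx_rev v u1 u2 x : U v u1 -> U v u2 -> u1 != u2 -> nx v u1 u2 x -> nx u1 v x u2.
  move=> h1 h2 h3 /existsP[y hp]; apply/existsP; exists y.
  by rewrite pent_flip -pent_rot.
apply: (cubic_iso Us U3 nx_ex nx_prop nx_uniq nx_rev tab5_ok dodecahedron_ok) => //.
- move=> [[v u1] u2] [/= h1 h2 h3].
  have E w1 w2 w3' w4 w0 : pent w1 w2 w3' w4 w0 -> w2 != w0 ->
     cb (ca nx (w1, w2, w0)) = (w2, w3', w1).
    move=> hp k3; have /and5P[k1 _ _ _ k2] := hp; rewrite Us in k2.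
    by rewrite (caE nx_uniq k1 k2 k3 (x := w3')) //; apply/existsP; exists w4.
  have [x [y [p1 _]]] := ex _ _ _ h1 h2 h3.
  have [e1 e2 e3 e4] := pent_neq _ _ _ _ _ h3 p1.
  have p2 : pent u1 x y u2 v by rewrite -pent_rot.
  have p3 : pent x y u2 v u1 by rewrite -pent_rot.
  have p4 : pent y u2 v u1 x by rewrite -pent_rot.
  have p5 : pent u2 v u1 x y by rewrite -pent_rot.
  by rewrite /= (E _ _ _ _ _ p1 h3) (E _ _ _ _ _ p2 e1) (E _ _ _ _ _ p3 e2)
    (E _ _ _ _ _ p4 e3) (E _ _ _ _ _ p5 e4).
- have -> : size dodecahedron_vertices = 20 by [].
  by have := euler5 Us Ui gm V0 VE n3 n4; move: ne2; lia.
Qed.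

Lemma cubic_tetrahedron : (forall v a b, U v a -> U v b -> a != b -> U a b) ->
  graph_iso U tetrahedron.
Proof.
move=> adj; have /card_gt0P[v _] := V0.
have [s [sz us hs]] := degree_enum (U3 v).
have cl x y : x \in v :: s -> U x y -> y \in v :: s.
  rewrite !inE => /orP[/eqP ->|xs]; first by rewrite hs => ->; rewrite orbT.
  move=> xy; have [->|yv] := eqVneq y v; first by [].
  have xv : U x v by rewrite Us hs.
  by rewrite -hs Us (adj x y v xy xv yv).
have all_in w : w \in v :: s.
  case/connectP: (conn v w) => p; have : v \in v :: s by rewrite inE eqxx.
  move: {1 3 4}v => u; elim: p u => [|y p IH] u uin /=; first by move=> _ ->.
  by case/andP=> uy pp E; apply: (IH y _ pp E); apply: cl uy.
have nv : v \notin s by rewrite -hs Ui.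
have c4 : #|V| = 4.
  rewrite -[4]/(3.+1) -sz -[(size s).+1]/(size (v :: s)).
  have u4 : uniq (v :: s) by rewrite /= nv.
  by rewrite -(card_uniqP u4); apply: eq_card => w; rewrite all_in.
have UE x y : U x y = (x != y).
  have [->|xy] := eqVneq x y; first by rewrite Ui.
  move: (all_in x) (all_in y); rewrite !inE => /orP[/eqP xv|xs] /orP[/eqP yv|ys].
  - by rewrite xv yv eqxx in xy.
  - by rewrite xv hs ys.
  - by rewrite yv Us hs xs.
  - by apply: (adj v); rewrite ?hs.
have TE (i j : 'I_4) : tetrahedron i j = (i != j).
  rewrite /tetrahedron skeletonE.
  by case: i j => -[|[|[|[|]]]] //= hi [] [|[|[|[|]]]].
have := @enum_rank_bij V; move: (@enum_rank V).
rewrite -[#|[eta V]|]/(#|V|) c4 => f bf.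
exists f => // x y; rewrite TE UE; congr (~~ _).
exact: (inj_eq (bij_inj bf)).
Qed.

(** The common vertex itself is counted, so [1 <= k <= 3] without triangles. For [k = 1] a 3-walk is
    fixed by its first step away from [v], so [l <= 2]. The excluded values [l = 0], [l = 2] and
    [k = 3] stand for girth at least 6, the Petersen graph and [K33]. *)
Lemma cubic_main :
  (exists b, forall v x y, U v x -> U v y -> x != y -> U x y = b) ->
  (exists k, forall v x y, U v x -> U v y -> x != y -> walks2 U x y = k) ->
  (exists k, forall v x y, U v x -> U v y -> x != y -> walks3 U x y = k) ->
  graph_iso U tetrahedron \/ graph_iso U cube \/ graph_iso U dodecahedron.
Proof.
move=> [[] hb]; first by left; apply: cubic_tetrahedron => v a b; exact: hb.
move=> [k hk] [l hl]; right.
have n3 : noC3 U.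
  move=> x y z xy yz zx; have yx : U y x by sd.
  have xz : x != z by rewrite eq_sym; exact: neq.
  by move: zx; rewrite Us (hb _ _ _ yx yz xz).
have /card_gt0P[v _] := V0.
have [s [sz us hs]] := degree_enum (U3 v).
case: s sz us hs => [|a [|b [|c []]]] // _ us hs.
have [va vb vc] : [/\ U v a, U v b & U v c] by rewrite !hs !inE !eqxx !orbT.
move: us; rewrite /= !inE !negb_or => /and3P[/andP[ab ac] bc _].
have kE := hk v a b va vb ab; rewrite walks2E in kE.
have k0 : 0 < k by rewrite -kE; apply/card_gt0P; exists v; rewrite inE Us va.
have k3 : k <= 3.
  rewrite -kE -(U3 a); apply: subset_leq_card; apply/subsetP => u.
  by rewrite !inE => /andP[].
case: k hk kE k0 k3 => [|[|[|[|]]]] // hk kE _ _.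
- right.
  have n4 : noC4 U.
    move=> x y z t xy yz zt tx xz yt; have xt : U x t by sd.
    have := hk x y t xy xt yt; rewrite walks2E => /eqP; apply/negP.
    rewrite neq_ltn; apply/orP; right; apply/card_gt1P; exists x, z.
    by split=> //; rewrite !inE ?yz ?zt // Us xy.
  have lE v' x y : U v' x -> U v' y -> x != y ->
      #|[pred p : V * V | [&& U x p.1, U p.1 p.2 & U p.2 y]]| = l.
    by move=> h1 h2 h3; rewrite -walks3E (hl v').
  have l0 : 0 < l.
    rewrite lt0n; apply/eqP => l0.
    suff n5 : noC5 U by have := euler6 Us Ui gm V0 VE n3 n4 n5; move: ne2; lia.
    move=> x y z t u xy yz zt tu ux un.
    have yu : y != u by move: un; rewrite /= !inE !negb_or => /and5P[_ /and3P[]].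
    have xu : U x u by sd.
    have := card0_eq (etrans (lE x y u xy xu yu) l0) (z, t).
    by rewrite !inE /= yz zt tu.
  have inj v' x y p q : U v' x -> U v' y -> x != y ->
      [&& U x p.1, U p.1 p.2 & U p.2 y] -> [&& U x q.1, U q.1 q.2 & U q.2 y] -> p.1 = q.1 -> p = q.
    case: p q => [p1 p2] [q1 q2] /= h1 h2 h3 /and3P[a1 a2 a3] /and3P[b1 b2 b3] E.
    rewrite -{}E in b1 b2 *; congr pair; apply/eqP/negPn/negP => ne.
    have p1y : p1 != y.
      apply/eqP => E; rewrite E in a1; have yv : U y v' by sd.
      exact: (n3 v' x y).
    apply: (n4 p1 p2 y q2) => //; sd.
  have sub2 v' x y p : U v' x -> U v' y -> x != y ->
      [&& U x p.1, U p.1 p.2 & U p.2 y] -> p.1 != v'.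
    move=> h1 h2 h3 /and3P[a1 a2 a3]; apply/eqP => E; rewrite E in a1 a2.
    have yv : U y v' by sd.
    exact: (n3 v' p.2 y).
  have l2 : l <= 2.
    rewrite -(lE v a b va vb ab).
    rewrite -(card_in_image (f := fst)); last first.
      by move=> p q; rewrite !inE => hp hq; exact: (inj v a b).
    have : #|[predD1 [pred u | U a u] & v]| = 2.
      have := cardD1 v [pred u | U a u]; rewrite -/(degree U a) U3 inE Us va.
      by case.
    move=> <-; apply: subset_leq_card; apply/subsetP => u /imageP[p]; rewrite inE => hp ->.
    rewrite !inE (sub2 v a b) //=.
    by case/and3P: hp.
  case: l hl lE l0 l2 => [|[|[|]]] // hl lE _ _; first exact: cubic_dodecahedron.
  (* the Petersen graph: everything lies within distance two of v *)
  exfalso.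
  have reach u w y : U v u -> U v w -> u != w -> U w y -> y != v ->
      exists x, [/\ U u x, x != v & U x y].
    move=> h1 h2 h3 wy yv.
    have wu : w != u by sd.
    have c2 := lE v w u h2 h1 wu.
    pose P := [pred p : V * V | [&& U w p.1, U p.1 p.2 & U p.2 u]].
    have cimg : #|image fst P| = 2.
      by rewrite (card_in_image (f := fst)) //; move=> p q; rewrite !inE => hp hq; exact: (inj v w u).
    have cD : #|[predD1 [pred u | U w u] & v]| = 2.
      have := cardD1 v [pred u | U w u]; rewrite -/(degree U w) U3 inE Us h2.
      by case.
    have sb : image fst P \subset [predD1 [pred u | U w u] & v].
      apply/subsetP => z /imageP[p]; rewrite inE => hp ->.
      rewrite !inE (sub2 v w u) //=.
      by case/and3P: hp.
    have yin : y \in image fst P.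
      have /subset_cardP /(_ sb) -> : #|image fst P| = #|[predD1 [pred u | U w u] & v]| by rewrite cimg cD.
      by rewrite !inE yv.
    case/imageP: yin => p; rewrite inE => /and3P[a1 a2 a3] E; exists p.2; split; try sd.
      apply/eqP => E2; rewrite E2 in a2.
      have wv : U w v by sd.
      have vp : U v p.1 by sd.
      exact: (n3 w p.1 v).
    by rewrite E; sd.
  have nb w : U v w -> exists x y, forall z, U w z = (z \in [:: v; x; y]).
    move=> vw; have [s [sz us hs']] := degree_enum (U3 w).
    have vs : v \in s by rewrite -hs' Us.
    have := perm_to_rem vs; case E : (rem v s) => [|x [|y [|]]] pm;
      move: (perm_size pm); rewrite sz //= => _.
    by exists x, y => z; rewrite hs' (perm_mem pm).
  have [a1 [a2 na]] := nb a va; have [b1 [b2 nbb]] := nb b vb.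
  have [c1 [c2 nc]] := nb c vc.
  have cl : #|V| <= size [:: v; a; b; c; a1; a2; b1; b2; c1; c2].
    apply: (closed_card conn) => // x y.
    (* Each of the other two neighbours [u], [u'] of [v] has, by [reach], a neighbour adjacent to
       [z]. Together with [w] these are all neighbours of [z]. *)
    have far w u u' z : U v w -> U v u -> U v u' -> u != w -> u' != w -> u != u' ->
        U w z -> z != v -> forall t, U z t -> [|| t == w, U u t | U u' t].
      move=> h1 h2 h3 h4 h5 h6 wz zv t zt.
      have [p [up pv pz]] := reach u w z h2 h1 h4 wz zv.
      have [q [u'q qv qz]] := reach u' w z h3 h1 h5 wz zv.
      have zs : uniq [:: w; p; q].
        have uv : U u v by sd.
        have u'v : U u' v by sd.
        have wp : w != p by apply/eqP => E; rewrite -E Us in up; exact: (n3 w u v).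
        have wq : w != q by apply/eqP => E; rewrite -E Us in u'q; exact: (n3 w u' v).
        have pq : p != q.
          apply/eqP => E; rewrite -E in u'q.
          have pu' : U p u' by sd.
          by apply: (n4 v u p u') => //; sd.
        by rewrite /= !inE !negb_or wp wq pq.
      have za : all (U z) [:: w; p; q] by rewrite /= Us wz Us pz Us qz.
      have := degree_span zs za; rewrite U3 => /(_ erefl t); rewrite zt => /esym.
      by rewrite !inE => /or3P[] /eqP ->; rewrite ?eqxx ?up ?u'q ?orbT.
    have ba : b != a by sd.
    have ca : c != a by sd.
    have cb : c != b by sd.
    have fin w t : [|| t == w, U a t | U b t] || [|| t == w, U a t | U c t] ||
        [|| t == w, U b t | U c t] -> w \in [:: a; b; c] ->
        t \in [:: v; a; b; c; a1; a2; b1; b2; c1; c2].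
      rewrite !na !nbb !nc !inE => h1 h2; move: h1.
      by do !case/orP; try (move/eqP ->); rewrite ?eqxx ?orbT //; case/or3P: h2 => ->; rewrite ?orbT.
    have stepw w z : w \in [:: a; b; c] -> U w z -> z != v -> forall t, U z t ->
        t \in [:: v; a; b; c; a1; a2; b1; b2; c1; c2].
      move=> win wz zv t zt; apply: (fin w t) => //.
      move: win; rewrite !inE => /or3P[] /eqP E; rewrite E in wz *.
      - by have := far a b c z va vb vc ba ca bc wz zv t zt => ->; rewrite !orbT.
      - by have := far b a c z vb va vc ab cb ac wz zv t zt => ->; rewrite !orbT.
      - by have := far c a b z vc va vb ac bc ab wz zv t zt => ->; rewrite ?orbT.
    have near w z : w \in [:: a; b; c] -> U w z -> z \in [:: v; a; b; c; a1; a2; b1; b2; c1; c2].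
      by rewrite !inE => /or3P[] /eqP ->; rewrite ?na ?nbb ?nc !inE => /or3P[] /eqP ->;
         rewrite eqxx ?orbT.
    have zs w z : w \in [:: a; b; c] -> U w z -> U z y -> y \in [:: v; a; b; c; a1; a2; b1; b2; c1; c2].
      move=> win wz zy; have [E|zv] := eqVneq z v; last exact: (stepw w z).
      move: zy; rewrite E hs !inE => /or3P[] /eqP ->; rewrite eqxx ?orbT //.
    move=> xin xy; have xin' := xin; rewrite !inE in xin'; move: xin'.
    do 9?case/orP; move/eqP => E; rewrite E in xy.
    - by move: xy; rewrite hs !inE => /or3P[] /eqP ->; rewrite eqxx ?orbT.
    - by apply: (near a) => //; rewrite !inE eqxx.
    - by apply: (near b) => //; rewrite !inE eqxx ?orbT.
    - by apply: (near c) => //; rewrite !inE eqxx ?orbT.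
    - by apply: (zs a a1); rewrite ?na ?inE ?eqxx ?orbT.
    - by apply: (zs a a2); rewrite ?na ?inE ?eqxx ?orbT.
    - by apply: (zs b b1); rewrite ?nbb ?inE ?eqxx ?orbT.
    - by apply: (zs b b2); rewrite ?nbb ?inE ?eqxx ?orbT.
    - by apply: (zs c c1); rewrite ?nc ?inE ?eqxx ?orbT.
    - by apply: (zs c c2); rewrite ?nc ?inE ?eqxx ?orbT.
  by have := euler5 Us Ui gm V0 VE n3 n4; move: ne2 cl => /=; lia.
- by left; apply: cubic_cube.
- (* vertices at distance two have the same neighbours *)
  exfalso.
  have twin v' x y : U v' x -> U v' y -> x != y -> forall z, U x z -> U y z.
    move=> h1 h2 h3 z xz; have := hk v' x y h1 h2 h3; rewrite walks2E => c3.
    have sb : [pred u | U x u && U u y] \subset [pred u | U x u].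
      by apply/subsetP => u; rewrite !inE => /andP[].
    have /subset_cardP /(_ sb) E : #|[pred u | U x u && U u y]| = #|[pred u | U x u]|.
      by rewrite c3 -/(degree U x) U3.
    by have := E z; rewrite !inE xz Us => /andP[].
  have [sa [sza usa hsa]] := degree_enum (U3 a).
  have cl : #|V| <= size ([:: a; b; c] ++ sa).
    apply: (closed_card conn) => // x y; rewrite !mem_cat -!hsa -!hs => /orP[vx|ax] xy.
      have [E|xa] := eqVneq x a; first by rewrite -E xy orbT.
      by rewrite (twin v x a vx va xa y xy) orbT.
    have av : U a v by sd.
    have [E|xv] := eqVneq x v; first by rewrite -E xy.
    by rewrite (twin a x v ax av xv y xy).
  have := euler4 Us Ui gm V0 VE n3; move: ne2 cl; rewrite size_cat sza /=; lia.
Qed.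
End CubicCases.

(** * Regular graphs of degree four and five *)

Section TwoRegular.
Variables (V : finType) (N : pred V) (r : rel V).
Hypothesis rs : symmetric r.
Hypothesis ri : irreflexive r.
Hypothesis rN : forall x y, r x y -> N x.
Hypothesis r_ex : forall x, N x -> exists a b, [/\ r x a, r x b & a != b].
Hypothesis r_two : forall x a b c, r x a -> r x b -> a != b -> r x c -> c = a \/ c = b.

Let neq x y : r x y -> x != y.
Proof. by apply: contraTN => /eqP ->; rewrite ri. Qed.

Let in_span (s : seq V) : uniq s -> all N s -> #|N| = size s -> forall x, N x = (x \in s).
Proof.
move=> us /allP h c; have sub : {subset s <= enum N} by move=> w /h; rewrite mem_enum.
have [|_ E] := uniq_min_size us sub; first by rewrite -cardE c.
by move=> x; rewrite E mem_enum.
Qed.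

Let other_in (s : seq V) : size s < #|N| -> exists2 t, N t & t \notin s.
Proof.
move=> lt; have [h|/allPn[t]] := boolP (all (mem s) (enum N)).
  by have := uniq_leq_size (enum_uniq N) (allP h); rewrite -cardE leqNgt lt.
by rewrite mem_enum => Nt ts; exists t.
Qed.

(** A shorter cycle would leave too few vertices for a second one, so a walk without backtracking
    runs through all of [N] and closes after four steps. The sixth vertex is included to fix the
    direction in which the walk goes on. *)
Lemma two_regular4 u0 u1 u2 u3 u4 u5 : #|N| = 4 ->
  r u0 u1 -> r u1 u2 -> r u2 u3 -> r u3 u4 -> r u4 u5 ->
  u2 != u0 -> u3 != u1 -> u4 != u2 -> u5 != u3 ->
  [/\ u4 = u0, u5 = u1 & forall x, N x = (x \in [:: u0; u1; u2; u3])].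
Proof.
move=> c4 r01 r12 r23 r34 r45 n20 n31 n42 n53.
have r10 : r u1 u0 by sd. have r21 : r u2 u1 by sd. have r32 : r u3 u2 by sd.
have r43 : r u4 u3 by sd.
have n02 : u0 != u2 by sd.
have n13 : u1 != u3 by sd. have n24 : u2 != u4 by sd.
have n01 := neq r01; have n12 := neq r12; have n23 := neq r23; have n34 := neq r34.
have n30 : u3 != u0.
  apply/eqP => E; rewrite E in r23 r32.
  have [|t Nt tn] := @other_in [:: u0; u1; u2]; first by rewrite c4.
  have [y [_ [ty _ _]]] := r_ex Nt.
  have NE : forall x, N x = (x \in [:: t; u0; u1; u2]).
    apply: in_span; rewrite ?c4 //=; first by rewrite tn; neqs.
    by rewrite Nt (rN r01) (rN r12) (rN r23).
  have yt : r y t by sd.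
  move: (rN yt); rewrite NE inE => /orP[/eqP E'|]; first by rewrite E' ri in ty.
  rewrite !inE in tn; rewrite !inE => /or3P[] /eqP E'; rewrite E' in yt.
  - by case: (r_two r01 r32 n12 yt) => E''; rewrite E'' eqxx ?orbT in tn.
  - by case: (r_two r10 r12 n02 yt) => E''; rewrite E'' eqxx ?orbT in tn.
  - by case: (r_two r21 r23 _ yt) => [|E''|E'']; [sd| |]; rewrite ?E'' ?eqxx ?orbT in tn.
have NE : forall x, N x = (x \in [:: u0; u1; u2; u3]).
  apply: in_span; rewrite ?c4 //=; first by neqs.
  by rewrite (rN r01) (rN r12) (rN r23) (rN r34).
have e4 : u4 = u0.
  move: (rN r45); rewrite NE !inE => /or4P[] /eqP // E.
  - rewrite E in r43; case: (r_two r10 r12 n02 r43) => E'; by rewrite E' eqxx in n30 n23.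
  - by rewrite E eqxx in n42.
  - by rewrite E eqxx in n34.
split=> //; rewrite e4 in r45 r43.
by case: (r_two r01 r43 n13 r45) => // E; rewrite E eqxx in n53.
Qed.

Lemma two_regular5 u0 u1 u2 u3 u4 u5 u6 : #|N| = 5 ->
  r u0 u1 -> r u1 u2 -> r u2 u3 -> r u3 u4 -> r u4 u5 -> r u5 u6 ->
  u2 != u0 -> u3 != u1 -> u4 != u2 -> u5 != u3 -> u6 != u4 ->
  [/\ u5 = u0, u6 = u1 & forall x, N x = (x \in [:: u0; u1; u2; u3; u4])].
Proof.
move=> c5 r01 r12 r23 r34 r45 r56 n20 n31 n42 n53 n64.
have r10 : r u1 u0 by sd. have r21 : r u2 u1 by sd. have r32 : r u3 u2 by sd.
have r43 : r u4 u3 by sd. have r54 : r u5 u4 by sd.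
have n02 : u0 != u2 by sd.
have n13 : u1 != u3 by sd. have n24 : u2 != u4 by sd. have n35 : u3 != u5 by sd.
have n01 := neq r01; have n12 := neq r12; have n23 := neq r23; have n34 := neq r34.
have n45 := neq r45.
have n30 : u3 != u0.
  apply/eqP => E; rewrite E in r23 r32.
  have [|t Nt tn] := @other_in [:: u0; u1; u2]; first by rewrite c5.
  have tri y : r t y -> y \notin [:: u0; u1; u2].
    move=> ty; have yt : r y t by sd.
    apply/negP; rewrite !inE in tn; rewrite !inE => /or3P[] /eqP E'; rewrite E' in yt.
    - by case: (r_two r01 r32 n12 yt) => E''; rewrite E'' eqxx ?orbT in tn.
    - by case: (r_two r10 r12 n02 yt) => E''; rewrite E'' eqxx ?orbT in tn.
    - by case: (r_two r21 r23 _ yt) => [|E''|E'']; [sd| |]; rewrite ?E'' ?eqxx ?orbT in tn.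
  have [y [y' [ty ty' yy']]] := r_ex Nt.
  have NE : forall x, N x = (x \in [:: y; t; u0; u1; u2]).
    apply: in_span; rewrite ?c5 //=.
      by move: (tri _ ty) tn (neq ty); rewrite !inE !negb_or => /and3P[? ? ?] /and3P[? ? ?] ?; neqs.
    by rewrite Nt (rN r01) (rN r12) (rN r23) (rN (etrans (rs y t) ty)).
  move: (rN (etrans (rs y' t) ty')); rewrite NE inE => /orP[/eqP E'|].
    by rewrite E' eqxx in yy'.
  rewrite inE => /orP[/eqP E'|]; first by rewrite E' ri in ty'.
  by rewrite (negPf (tri _ ty')).
have n40 : u4 != u0.
  apply/eqP => E; rewrite E in r34 r43.
  have [|t Nt tn] := @other_in [:: u0; u1; u2; u3]; first by rewrite c5.
  have [y [_ [ty _ _]]] := r_ex Nt; have yt : r y t by sd.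
  have NE : forall x, N x = (x \in [:: t; u0; u1; u2; u3]).
    apply: in_span; rewrite ?c5 //=; first by rewrite tn; neqs.
    by rewrite Nt (rN r01) (rN r12) (rN r23) (rN r32).
  move: (rN yt); rewrite NE inE => /orP[/eqP E'|]; first by rewrite E' ri in ty.
  rewrite !inE in tn; rewrite !inE => /or4P[] /eqP E'; rewrite E' in yt.
  - by case: (r_two r01 r43 n13 yt) => E''; rewrite E'' eqxx ?orbT in tn.
  - by case: (r_two r10 r12 n02 yt) => E''; rewrite E'' eqxx ?orbT in tn.
  - by case: (r_two r21 r23 n13 yt) => E''; rewrite E'' eqxx ?orbT in tn.
  - by case: (r_two r32 r34 n20 yt) => E''; rewrite E'' eqxx ?orbT in tn.
have n41 : u4 != u1.
  apply/eqP => E; rewrite E in r43.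
  by case: (r_two r10 r12 n02 r43) => E'; rewrite E' eqxx in n30 n23.
have NE : forall x, N x = (x \in [:: u0; u1; u2; u3; u4]).
  apply: in_span; rewrite ?c5 //=; first by neqs.
  by rewrite (rN r01) (rN r12) (rN r23) (rN r34) (rN r45).
have e5 : u5 = u0.
  move: (rN r56); rewrite NE !inE => /or4P[| | |/orP[]] /eqP // E.
  - rewrite E in r54; case: (r_two r10 r12 n02 r54) => E'; by rewrite E' eqxx in n40 n42.
  - rewrite E in r54; case: (r_two r21 r23 n13 r54) => E'; by rewrite E' eqxx in n41 n34.
  - by rewrite E eqxx in n53.
  - by rewrite E eqxx in n45.
split=> //; rewrite e5 in r56 r54.
have n14 : u1 != u4 by sd.
by case: (r_two r01 r54 n14 r56) => // E; rewrite E eqxx in n64.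
Qed.
End TwoRegular.

(** * Two triangles on each edge: octahedron and icosahedron *)

Section LocallyCyclic.
Variables (V : finType) (U : rel V).
Hypothesis Us : symmetric U.
Hypothesis Ui : irreflexive U.
Hypothesis conn : forall v w, connect U v w.
Hypothesis V0 : 0 < #|V|.
Hypothesis w2 : forall v w, U v w -> walks2 U v w = 2.

(** Flags are read in the dual: the triangle [a b c] is a vertex of the cube or dodecahedron, its
    side [a b] an edge and [a] a face. So [ta], which replaces the triangle, is the change of
    vertex, and [tc] is the change of face. *)
Definition tflag : Type := (V * V * V)%type.
Definition tgood (x : tflag) : Prop := [/\ U x.1.1 x.1.2, U x.1.2 x.2 & U x.2 x.1.1].
Definition apex (a b c : V) : V := odflt c [pick d | [&& U a d, U d b & d != c]].
Definition ta (x : tflag) : tflag := (x.1.1, x.1.2, apex x.1.1 x.1.2 x.2).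
Definition tb (x : tflag) : tflag := (x.1.1, x.2, x.1.2).
Definition tc (x : tflag) : tflag := (x.1.2, x.1.1, x.2).

Lemma apexP a b c : U a b -> U b c -> U c a ->
  [/\ U a (apex a b c), U (apex a b c) b, apex a b c != c &
      forall d, U a d -> U d b -> d = c \/ d = apex a b c].
Proof.
move=> ab bc ca; have := w2 ab; rewrite walks2E => c2.
have [|x xc xP] := card2P c2 (v := c); first by rewrite /= Us ca Us bc.
have := xP x; rewrite /= eqxx orbT => /andP[x1 x2].
have E : apex a b c = x.
  rewrite /apex; case: pickP => [y /and3P[y1 y2 y3]|/(_ x)]; last by rewrite x1 x2 xc.
  by have := xP y; rewrite /= y1 y2 (negPf y3) /= => /esym/eqP.
rewrite E; split=> // y y1 y2.
by have := xP y; rewrite /= y1 y2 => /esym/orP[] /eqP ->; [left|right].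
Qed.

Lemma apex_eq a b c d : U a b -> U b c -> U c a -> U a d -> U d b -> d != c -> apex a b c = d.
Proof.
move=> ab bc ca ad db dc; have [_ _ _ h] := apexP ab bc ca.
by case: (h d ad db) => // E; rewrite E eqxx in dc.
Qed.

Let link a : rel V := fun u w => [&& U a u, U a w & U u w].
Let link_sym a : symmetric (link a).
Proof. by move=> u w; apply/and3P/and3P => -[*]; split; sd. Qed.

Let linkN a : forall x y, link a x y -> [pred w | U a w] x.
Proof. by move=> x y /and3P[]. Qed.

Let link_irr a : irreflexive (link a).
Proof. by move=> x; rewrite /link Ui !andbF. Qed.

Let link_ex a x : [pred w | U a w] x -> exists u w, [/\ link a x u, link a x w & u != w].
Proof.
move=> /= ax; have := w2 ax; rewrite walks2E => c2.
have /card_gt0P[u] : 0 < #|[pred u | U a u && U u x]| by rewrite c2.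
rewrite inE => /andP[au ux]; have [|w wu wP] := card2P c2 (v := u); first by rewrite /= au.
have := wP w; rewrite /= eqxx orbT => /andP[aw wx].
by exists u, w; rewrite /link ax au aw (Us x) ux (Us x) wx eq_sym.
Qed.

Let link_two a x u w y : link a x u -> link a x w -> u != w -> link a x y -> y = u \/ y = w.
Proof.
move=> /and3P[ax au xu] /and3P[_ aw xw] uw /and3P[_ ay xy].
have := w2 ax; rewrite walks2E => c2.
have [|z zu zP] := card2P c2 (v := u); first by rewrite /= au Us xu.
have := zP w; rewrite /= aw (Us w) xw eq_sym (negPf uw) /= => /esym/eqP ->.
by have := zP y; rewrite /= ay (Us y) xy => /esym/orP[] /eqP ->; [left|right].
Qed.

(* Turning around y1: (y1, w, u) goes to (y1, x, w), where u, w, x are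
   consecutive on the link of y1. *)
Let turn a u w : tgood (a, w, u) -> let x := apex a w u in
  [/\ tb (ta (a, w, u)) = (a, x, w), tgood (a, x, w), link a w x & x != u].
Proof.
move=> [/= aw wu ua]; have [h1 h2 h3 _] := apexP aw wu ua.
by split=> //; [split=> //=; sd | rewrite /link aw h1 Us h2].
Qed.

Let tgood_link a w u : tgood (a, w, u) -> link a u w.
Proof. by move=> [/= aw wu ua]; rewrite /link Us ua aw Us wu. Qed.

Let t_action p : 0 < p -> (forall x, tgood x -> actw ta tb tc (alt 0 1 p.*2) x = x) ->
  flag_action tgood ta tb tc p.
Proof.
move=> p0 hab; apply: flag_actionI => //.
- move=> [[a b] c] [/= ab bc ca]; have [h1 h2 h3 _] := apexP ab bc ca.
  have h2' : U b (apex a b c) by sd.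
  have h1' : U (apex a b c) a by sd.
  split; first by split.
  by rewrite /ta /= (@apex_eq _ _ _ c) //; sd.
- by move=> [[a b] c] [/= ab bc ca]; split=> //; split=> /=; sd.
- by move=> [[a b] c] [/= ab bc ca]; split=> //; split=> /=; sd.
- by move=> [[a b] c].
- move=> [[a b] c] [/= ab bc ca]; have [h1 h2 h3 _] := apexP ab bc ca.
  have [ba cb ac] : [/\ U b a, U c b & U a c] by split; sd.
  have h2' : U b (apex a b c) by sd.
  have h1' : U (apex a b c) a by sd.
  rewrite /ta /tc /= (@apex_eq b a c (apex a b c)) // (@apex_eq _ _ _ c) //; sd.
Qed.

Lemma locally_C4 : (forall v, degree U v = 4) -> 6 <= #|V| -> graph_iso U octahedron.
Proof.
move=> U4 V6.
have seq4 a w u : tgood (a, w, u) -> exists x y, [/\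
    tb (ta (a, w, u)) = (a, x, w), tb (ta (a, x, w)) = (a, y, x),
    tb (ta (a, y, x)) = (a, u, y), tb (ta (a, u, y)) = (a, w, u) &
    forall z, U a z = (z \in [:: u; w; x; y])].
  move=> g0; have [e1 g1 l1 n1] := turn g0; have [e2 g2 l2 n2] := turn g1.
  have [e3 g3 l3 n3] := turn g2; have [e4 g4 l4 n4] := turn g3.
  move: e1 e2 e3 e4 g1 g2 g3 g4 l1 l2 l3 l4 n1 n2 n3 n4.
  set x := apex a w u; set y := apex a x w; set z := apex a y x; set t := apex a z y.
  move=> e1 e2 e3 e4 g1 g2 g3 g4 l1 l2 l3 l4 n1 n2 n3 n4.
  have [E1 E2 NE] := two_regular4 (link_sym a) (link_irr a) (@linkN a) (@link_ex a)
    (@link_two a) (U4 a) (tgood_link g0) l1 l2 l3 l4 n1 n2 n3 n4.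
  by exists x, y; split=> //; rewrite ?e2 ?e3 -?E1 ?e4 ?E2.
have fa : flag_action tgood ta tb tc 4.
  apply: t_action => // -[[a w] u] g0; have [x [y [e1 e2 e3 e4 _]]] := seq4 _ _ _ g0.
  by rewrite /= e1 e2 e3 e4.
have /card_gt0P[v _] := V0.
have [s [sz us hs]] := degree_enum (U4 v).
case: s sz us hs => [|b s] // _ us hs; have vb : U v b by rewrite hs inE eqxx.
have [c [_ [l _ _]]] := link_ex (vb : [pred w | U v w] b).
apply: (flag_iso (proj := fun _ (x : tflag) => x.1.1) (x0 := (v, b, c)) tab4_ok octahedron_ok fa) => //.
- case=> [|[]] //= w [[a b'] c']; rewrite /fstab /= !inE => h _.
  by do !case/orP: h => [/eqP -> //|h]; move/eqP: h => ->.
- move=> t w t' [[a w'] u]; rewrite /frules /= !inE => h g0.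
  have [x [y [e1 e2 e3 e4 NE]]] := seq4 _ _ _ g0.
  have g0' : tgood (a, u, w') by case: g0 => /= *; split=> /=; sd.
  have [h1 h2 h3 _] : [/\ U a w', U w' u, U u a & True] by case: g0.
  have [x' [y' [k1 k2 k3 k4 NE']]] := seq4 _ _ _ g0'.
  have a1 : apex a u w' = x' by case: k1.
  have a2 : apex a x' u = y' by case: k2.
  case/or4P: h => /eqP[_ -> _] //=; first (by sd); rewrite ?a1 ?a2 NE' !inE eqxx ?orbT //.
- case=> [|//] [[a w'] u] z _ g0 /= az.
  have g0' : tgood (a, u, w') by case: g0 => /= *; split=> /=; sd.
  have [x' [y' [k1 k2 k3 k4 NE']]] := seq4 _ _ _ g0'.
  have a1 : apex a u w' = x' by case: k1.
  have a2 : apex a x' u = y' by case: k2.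
  move: az; rewrite NE' !inE => /or4P[] /eqP ->.
  + by exists [:: 2], 0; rewrite /frules /= !inE.
  + by exists [:: 1; 2], 0; rewrite /frules /= !inE.
  + by exists [:: 1; 0; 1; 2], 0; rewrite /frules /= !inE ?a1.
  + by exists [:: 1; 0; 1; 0; 1; 2], 0; rewrite /frules /= !inE ?a1 ?a2.
- by move/and3P: l => [_ vc bc]; split=> //=; sd.
Qed.

Lemma locally_C5 : (forall v, degree U v = 5) -> 12 <= #|V| -> graph_iso U icosahedron.
Proof.
move=> U5 V12.
have seq5 a w u : tgood (a, w, u) -> exists x y z, [/\
    [/\ tb (ta (a, w, u)) = (a, x, w), tb (ta (a, x, w)) = (a, y, x),
    tb (ta (a, y, x)) = (a, z, y), tb (ta (a, z, y)) = (a, u, z) &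
    tb (ta (a, u, z)) = (a, w, u)] &
    forall t, U a t = (t \in [:: u; w; x; y; z])].
  move=> g0; have [e1 g1 l1 n1] := turn g0; have [e2 g2 l2 n2] := turn g1.
  have [e3 g3 l3 n3] := turn g2; have [e4 g4 l4 n4] := turn g3.
  have [e5 g5 l5 n5] := turn g4.
  move: e1 e2 e3 e4 e5 g1 g2 g3 g4 l1 l2 l3 l4 l5 n1 n2 n3 n4 n5 {g5}.
  set x := apex a w u; set y := apex a x w; set z := apex a y x; set t := apex a z y.
  set t' := apex a t z.
  move=> e1 e2 e3 e4 e5 g1 g2 g3 g4 l1 l2 l3 l4 l5 n1 n2 n3 n4 n5.
  have [E1 E2 NE] := two_regular5 (link_sym a) (link_irr a) (@linkN a) (@link_ex a)
    (@link_two a) (U5 a) (tgood_link g0) l1 l2 l3 l4 l5 n1 n2 n3 n4 n5.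
  exists x, y, z; split=> //; split=> //; first by rewrite e4 E1.
  by rewrite -{1}E1 e5 E1 E2.
have fa : flag_action tgood ta tb tc 5.
  apply: t_action => // -[[a w] u] g0; have [x [y [z [[e1 e2 e3 e4 e5] _]]]] := seq5 _ _ _ g0.
  by rewrite /= e1 e2 e3 e4 e5.
have /card_gt0P[v _] := V0.
have [s [sz us hs]] := degree_enum (U5 v).
case: s sz us hs => [|b s] // _ us hs; have vb : U v b by rewrite hs inE eqxx.
have [c [_ [l _ _]]] := link_ex (vb : [pred w | U v w] b).
apply: (flag_iso (proj := fun _ (x : tflag) => x.1.1) (x0 := (v, b, c)) tab5_ok icosahedron_ok fa) => //.
- case=> [|[]] //= w [[a b'] c']; rewrite /fstab /= !inE => h _.
  by do !case/orP: h => [/eqP -> //|h]; move/eqP: h => ->.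
- move=> t w t' [[a w'] u]; rewrite /frules /= !inE => h g0.
  have g0' : tgood (a, u, w') by case: g0 => /= *; split=> /=; sd.
  have [h1 h2 h3 _] : [/\ U a w', U w' u, U u a & True] by case: g0.
  have [x' [y' [z' [[k1 k2 k3 k4 k5] NE']]]] := seq5 _ _ _ g0'.
  have a1 : apex a u w' = x' by case: k1.
  have a2 : apex a x' u = y' by case: k2.
  have a3 : apex a y' x' = z' by case: k3.
  case/or4P: h => [| | |/orP[]] /eqP[_ -> _] //=; first (by sd);
    rewrite ?a1 ?a2 ?a3 NE' !inE eqxx ?orbT //.
- case=> [|//] [[a w'] u] z _ g0 /= az.
  have g0' : tgood (a, u, w') by case: g0 => /= *; split=> /=; sd.
  have [x' [y' [z' [[k1 k2 k3 k4 k5] NE']]]] := seq5 _ _ _ g0'.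
  have a1 : apex a u w' = x' by case: k1.
  have a2 : apex a x' u = y' by case: k2.
  have a3 : apex a y' x' = z' by case: k3.
  move: az; rewrite NE' !inE => /or4P[| | |/orP[]] /eqP ->.
  + by exists [:: 2], 0; rewrite /frules /= !inE.
  + by exists [:: 1; 2], 0; rewrite /frules /= !inE.
  + by exists [:: 1; 0; 1; 2], 0; rewrite /frules /= !inE ?a1.
  + by exists [:: 1; 0; 1; 0; 1; 2], 0; rewrite /frules /= !inE ?a1 ?a2.
  + by exists [:: 1; 0; 1; 0; 1; 0; 1; 2], 0; rewrite /frules /= !inE ?a1 ?a2 ?a3.
- by move/and3P: l => [_ vc bc]; split=> //=; sd.
Qed.
End LocallyCyclic.

Lemma card2_all (V : finType) (P Q : pred V) : #|P| = 2 -> #|Q| = 2 ->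
  (forall x, P x -> Q x) -> forall x, Q x -> P x.
Proof.
move=> cP cQ sub x Qx; have s : P \subset Q by apply/subsetP => y; exact: sub.
have /subset_cardP /(_ s)/(_ x) : #|P| = #|Q| by rewrite cP.
by rewrite -!topredE /= Qx.
Qed.

(** * Degree four with one triangle on each edge *)

Section OneTriangle.
Variables (V : finType) (U : rel V).
Hypothesis Us : symmetric U.
Hypothesis Ui : irreflexive U.
Hypothesis U4 : forall v, degree U v = 4.
Hypothesis w2 : forall v w, U v w -> walks2 U v w = 1.

Let neq x y : U x y -> x != y.
Proof. by apply: contraTN => /eqP ->; rewrite Ui. Qed.

Definition tri (u v : V) : V := odflt u [pick t | U u t && U t v].

Lemma triP u v : U u v -> [/\ U u (tri u v), U (tri u v) v &
  forall t, U u t -> U t v -> t = tri u v].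
Proof.
move=> uv; have := w2 uv; rewrite walks2E => /mem_card1[t tP].
have tE x : U u x && U x v = (x == t) by have := tP x; rewrite !inE.
have E : tri u v = t.
  rewrite /tri; case: pickP => [y|/(_ t)]; rewrite tE ?eqxx //= => /eqP //.
have := tE t; rewrite eqxx => /andP[h1 h2]; rewrite E; split=> // x h3 h4.
by apply/eqP; rewrite -tE h3.
Qed.

Lemma one_triangle x y t t' : U x y -> U y t -> U t x -> U y t' -> U t' x -> t = t'.
Proof.
move=> xy yt tx yt' t'x; have [_ _ h] := triP xy.
by rewrite (h t) 1?(h t') //; sd.
Qed.

Lemma tri_neq u v : U u v -> tri u v != v.
Proof. by case/triP => _ /neq. Qed.

Lemma tri_tri u v : U u v -> tri u (tri u v) = v.
Proof.
move=> uv; have [h1 h2 _] := triP uv; have [_ _ h] := triP h1.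
by rewrite -(h v) //; sd.
Qed.

Lemma nbrs u v x : U u v -> U u x -> x != v -> x != tri u v ->
  forall w, U u w = (w \in [:: v; tri u v; x; tri u x]).
Proof.
move=> uv ux xv xt; have [h1 h2 h3] := triP uv; have [k1 k2 k3] := triP ux.
apply: degree_span; rewrite ?U4 //=; last by rewrite uv h1 ux k1.
have e1 : v != tri u x.
  by apply/eqP => E; case/eqP: xt; apply: h3 => //; rewrite E; sd.
have e2 : tri u v != tri u x.
  by apply/eqP => E; case/eqP: xv; rewrite -(tri_tri uv) E tri_tri.
have n1 : v != tri u v by rewrite eq_sym tri_neq.
have n2 : x != tri u x by rewrite eq_sym tri_neq.
by neqs.
Qed.

Lemma nbr_ex u v : U u v -> exists x, [/\ U u x, x != v & x != tri u v].
Proof.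
move=> uv; have [s [sz us hs]] := degree_enum (U4 u).
have [h|/allPn[c cs]] := boolP (all (mem [:: v; tri u v]) s).
  by have := uniq_leq_size us (allP h); rewrite sz.
by rewrite !inE negb_or => /andP[h1 h2]; exists c; rewrite hs.
Qed.

Lemma nbrs_adj u v x x' : U u v -> U u x -> x != v -> x != tri u v ->
  U u x' -> x' != v -> x' != tri u v -> x != x' -> U x x'.
Proof.
move=> uv ux xv xt ux' xv' xt' xx'.
move: (ux'); rewrite (nbrs uv ux xv xt) !inE (negPf xv') (negPf xt') eq_sym (negPf xx') /=.
by move/eqP ->; have [_ ? _] := triP ux; sd.
Qed.

Lemma card_others u v : U u v -> #|[pred x | [&& U u x, x != v & x != tri u v]]| = 2.
Proof.
move=> uv; have [x [ux xv xt]] := nbr_ex uv; have nb := nbrs uv ux xv xt.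
have [h1 h2 h3] := triP uv; have [k1 k2 k3] := triP ux.
have n2 : x != tri u x by rewrite eq_sym tri_neq.
have -> : 2 = #|[set x; tri u x]| by rewrite cards2 n2.
apply: eq_card => w; rewrite !inE nb !inE.
have [->|_] := eqVneq w v.
  rewrite /= eq_sym (negPf xv); apply/esym/negbTE/eqP => E.
  by case/eqP: xt; apply: h3 => //; rewrite E; sd.
have [->|//] := eqVneq w (tri u v); last by rewrite andbT.
rewrite /= eq_sym (negPf xt); apply/esym/negbTE/eqP => E.
by case/eqP: xv; rewrite -(tri_tri uv) E tri_tri.
Qed.

(* [nx u v w]: the face through the edge v u that is not a triangle continues to w. *)
Section Flags.
Variable nx : V -> V -> V -> bool.
Hypothesis nx_ex : forall u v, U u v -> exists h, nx u v h.
Hypothesis nx_prop : forall u v h, U u v -> nx u v h -> [/\ U u h, h != v & ~~ U h v].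
Hypothesis nx_uniq : forall u v h h', U u v -> nx u v h -> nx u v h' -> h = h'.
Hypothesis nx_rev : forall u v h, U u v -> nx u v h -> nx u h v.

(** The graph is read as a rectified cube or dodecahedron: for a flag [(u, v)] the point [u] is an
    edge, the triangle on [u v] a vertex, and the other face on [u v] a face. So [fa] changes the
    triangle, [fb] the point and [fc] the other face. *)
Definition fgood (x : V * V) : Prop := U x.1 x.2.
Definition fa (x : V * V) : V * V := (x.1, odflt x.1 [pick y | nx x.1 x.2 y]).
Definition fb (x : V * V) : V * V := (x.2, x.1).
Definition fc (x : V * V) : V * V := (x.1, tri x.1 x.2).

Lemma faE u v h : U u v -> nx u v h -> fa (u, v) = (u, h).
Proof.
move=> uv n; rewrite /fa /=; case: pickP => [y ny|/(_ h)]; last by rewrite n.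
by rewrite /= (nx_uniq uv n ny).
Qed.

Variables (p : nat) (T : table) (tree cert : seq (nat * nat)) (s : seq point) (d : zphi)
  (q : seq nat).
Hypothesis Tok : table_ok p T tree cert.
Hypothesis Pok : iso_ok T (size tree).+1 (size s) [:: q] [:: estab] erules (close s d).
Hypothesis p0 : 0 < p.
Hypothesis fab : forall x, fgood x -> actw fa fb fc (alt 0 1 p.*2) x = x.
Hypothesis conn : forall v w, connect U v w.
Hypothesis V0 : 0 < #|V|.
Hypothesis sV : 0 < size s <= #|V|.

Lemma one_triangle_iso : graph_iso U (skeleton s d).
Proof.
(* The two larger faces at [u] use each of its four neighbours once, so [h] and [h'] span the second
   triangle at [u]. *)
have full u v h h' : U u v -> nx u v h -> nx u (tri u v) h' ->
    h' = tri u h /\ forall w, U u w = (w \in [:: v; tri u v; h; h']).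
  move=> uv n n'; have [h1 h2 h3] := triP uv.
  have [uh hv hnv] := nx_prop uv n; have [uh' hv' hnv'] := nx_prop h1 n'.
  have ht : h != tri u v by apply: contraNneq hnv => ->.
  have nb := nbrs uv uh hv ht.
  suff E : h' = tri u h by rewrite E; split.
  move: uh'; rewrite nb !inE (negPf hv') => /or4P[] //; last by move/eqP.
    by move/eqP=> E; move: hnv'; rewrite E Us h2.
  move/eqP => E; rewrite E in n'.
  have := nx_uniq uh (nx_rev uv n) (nx_rev h1 n') => E'.
  by have := tri_neq uv; rewrite -E' eqxx.
have act : flag_action fgood fa fb fc p.
  apply: flag_actionI => //.
  - move=> [u v] uv; have [h n] := nx_ex uv; have [uh hv hnv] := nx_prop uv n.
    by rewrite (faE uv n) (faE uh (nx_rev uv n)).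
  - by move=> [u v] uv; split=> //; rewrite /fgood /= Us.
  - move=> [u v] uv; have [h1 h2 h3] := triP uv; split=> //.
    by rewrite /fc /= tri_tri.
  - move=> [u v] uv; have [/= h1 h2 h3] := triP uv; rewrite /fc /fb /=.
    have vt : U v (tri u v) by sd.
    have tu : U (tri u v) u by sd.
    have [_ _ k1] := triP tu; rewrite -(k1 v) //; last sd.
    have [_ _ k2] := triP vt; rewrite -(k2 u) //; sd.
  - move=> [u v] uv; have [/= h1 h2 h3] := triP uv.
    have [h n] := nx_ex uv; have [h' n'] := nx_ex h1.
    have [uh hv hnv] := nx_prop uv n; have [uh' hv' hnv'] := nx_prop h1 n'.
    have [E _] := full _ _ _ _ uv n n'.
    rewrite {2}/fc /= (faE h1 n') /fc /= E tri_tri //.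
    by rewrite (faE uh (nx_rev uv n)).
have /card_gt0P[v _] := V0.
have [s3 [sz us hs]] := degree_enum (U4 v).
case: s3 sz us hs => [|a s3] // _ us hs.
apply: (flag_iso (proj := fun _ (x : V * V) => x.1) (x0 := (v, a)) Tok Pok act) => //.
- by case=> [|[]] //= w x; rewrite !inE => /or4P[] /eqP ->.
- move=> t w t' [u x]; rewrite !inE => h ux; have [/= h1 h2 h3] := triP ux.
  have [y n] := nx_ex ux; have [y' n'] := nx_ex h1.
  have [E nb] := full _ _ _ _ ux n n'.
  rewrite /fgood /= in ux n nb E *.
  have e1 : odflt u [pick y | nx u x y] = y by have [] := faE ux n.
  have e2 : odflt u [pick y | nx u (tri u x) y] = y' by have [] := faE h1 n'.
  case/or4P: h => /eqP[_ -> _] //=.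
  + by rewrite e1 nb !inE eqxx ?orbT.
  + by rewrite e2 nb !inE eqxx ?orbT.
- case=> [|//] [u x] w _ ux uw; have [/= h1 h2 h3] := triP ux.
  have [y n] := nx_ex ux; have [y' n'] := nx_ex h1.
  have [E nb] := full _ _ _ _ ux n n'.
  rewrite /fgood /= in ux n nb E uw *.
  have e1 : odflt u [pick y | nx u x y] = y by have [] := faE ux n.
  have e2 : odflt u [pick y | nx u (tri u x) y] = y' by have [] := faE h1 n'.
  move: uw; rewrite nb !inE => /or4P[] /eqP ->.
  + by exists [:: 1], 0; rewrite !inE eqxx.
  + by exists [:: 2; 1], 0; rewrite !inE eqxx orbT.
  + by exists [:: 0; 1], 0; rewrite !inE eqxx !orbT /= e1.
  + by exists [:: 2; 0; 1], 0; rewrite !inE eqxx !orbT /= e2.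
- by rewrite /fgood /= hs inE eqxx.
Qed.
End Flags.

Section Cases.
Hypothesis conn : forall v w, connect U v w.
Hypothesis V0 : 0 < #|V|.
Hypothesis gm : gridmodel (@esrc V U) (@etgt V U).

Let ne2 : 4 * #|V| = 2 * #|edge U| := sum_degree Us Ui U4.
Let VE : #|V| < #|edge U|.
Proof. by move: ne2 V0; lia. Qed.

Definition quad u v y h := [&& U v y, U y h, U h u, h != v & y != u].

(** The degenerate 3-walks go to [v] at once or return to [u] before the last step; [u v u v] does
    both, so there are 4 + 4 - 1 = 7. *)
Lemma card_walks3 u v : U u v ->
  walks3 U u v = 7 + #|[pred p : V * V | quad u v p.2 p.1]|.
Proof.
move=> uv; rewrite walks3E.
pose A := [set p : V * V | (p.1 == v) && U v p.2].
pose B := [set p : V * V | (p.2 == u) && U u p.1].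
pose Q := [set p : V * V | quad u v p.2 p.1].
have cA : #|A| = 4.
  rewrite -(U4 v); have <- : #|[set (v, y) | y in [pred y | U v y]]| = degree U v.
    by rewrite card_imset // => x y [].
  apply: eq_card => -[x y]; rewrite !inE /=; apply/andP/imsetP => [[/eqP -> h]|[z]].
    by exists y.
  by rewrite inE => h [-> ->].
have cB : #|B| = 4.
  rewrite -(U4 u); have <- : #|[set (x, u) | x in [pred y | U u y]]| = degree U u.
    by rewrite card_imset // => x y [].
  apply: eq_card => -[x y]; rewrite !inE /=; apply/andP/imsetP => [[/eqP -> h]|[z]].
    by exists x.
  by rewrite inE => h [-> ->].
have cAB : #|A :&: B| = 1.
  have -> : A :&: B = [set (v, u)].
    apply/setP => -[x y]; rewrite !inE /= xpair_eqE.
    by case: eqVneq => [->|]; case: eqVneq => [->|]; rewrite ?andbF //= uv Us uv.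
  exact: cards1.
have cU : #|A :|: B| = 7 by have := cardsUI A B; rewrite cA cB cAB addn1 => -[].
have dQ : [disjoint A :|: B & Q].
  rewrite -setI_eq0; apply/eqP/setP => -[x y]; rewrite !inE /=; apply/negP.
  by case/andP=> /orP[] /andP[/eqP -> _] /and5P[_ _ _]; rewrite eqxx.
have -> : #|[pred p : V * V | quad u v p.2 p.1]| = #|Q| by apply: eq_card => p; rewrite !inE.
rewrite -cU; have <- : #|(A :|: B) :|: Q| = #|A :|: B| + #|Q|.
  by rewrite -cardsUI (disjoint_setI0 dQ) cards0 addn0.
apply: eq_card => -[x y]; rewrite !inE /= /quad.
have [->|xv] := eqVneq x v; first by rewrite uv !andbF orbF /= (Us y v) andbb; case: eqP => [->|]; rewrite ?uv ?orbF ?orbT ?andbF // Us.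
have [->|yu] := eqVneq y u; first by rewrite uv !andbF orbF /= (Us x u) andbT; case: (U u x).
by rewrite /= !andbT (Us y v) (Us y x) (Us x u); case: (U v y); case: (U x y); case: (U u x).
Qed.

Lemma square_rot u v y h : U u v -> quad u v y h -> quad v y h u.
Proof. by move=> uv /and5P[h1 h2 h3 h4 h5]; apply/and5P; split=> //; sd. Qed.

Lemma square_flip u v y h : U u v -> quad u v y h -> quad u h y v.
Proof. by move=> uv /and5P[h1 h2 h3 h4 h5]; apply/and5P; split=> //; sd. Qed.

Lemma square_nadj u v y h : U u v -> quad u v y h -> ~~ U h v.
Proof.
move=> uv /and5P[h1 h2 h3 h4 h5]; apply/negP => hv; case/eqP: h5.
by apply: (@one_triangle h v) => //; sd.
Qed.

(** Two choices for the fourth corner would be the two neighbours of [v] outside the triangle on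
    [u v], hence adjacent. Their edge would lie in one triangle with [v] and in another with [h]. *)
Lemma square_uniq u v y y' h : U u v -> quad u v y h -> quad u v y' h -> y = y'.
Proof.
move=> uv S S'; have /and5P[h1 h2 h3 h4 h5] := S; have /and5P[k1 k2 k3 k4 k5] := S'.
apply/eqP/negPn/negP => yy'; have vu : U v u by sd.
have nt z : quad u v z h -> z != tri v u.
  move=> /and5P[l1 l2 l3 l4 l5]; apply/eqP => E.
  have S1 : quad v u h z by apply/and5P; split; sd.
  by have := square_nadj vu S1; have [_ e1 _] := triP vu; rewrite E e1.
have yy : U y y' by apply: (@nbrs_adj v u) => //; exact: nt.
by case/eqP: h4; apply: (@one_triangle y y') => //; sd.
Qed.

Lemma cuboctahedron_case :
  (forall u v, U u v -> #|[pred p : V * V | quad u v p.2 p.1]| = 1) ->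
  graph_iso U cuboctahedron.
Proof.
move=> c1; pose nx u v h := [exists y, quad u v y h].
have ex u v : U u v -> exists h y, quad u v y h /\
    forall y' h', quad u v y' h' -> y' = y /\ h' = h.
  move=> /c1/mem_card1[[h y] hP]; exists h, y.
  have E y' h' : quad u v y' h' = ((h', y') == (h, y)) by have := hP (h', y'); rewrite !inE.
  by rewrite E eqxx; split=> // y' h'; rewrite E => /eqP[].
have nx_ex u v : U u v -> exists h, nx u v h.
  by move=> /ex[h [y [S _]]]; exists h; apply/existsP; exists y.
have nx_prop u v h : U u v -> nx u v h -> [/\ U u h, h != v & ~~ U h v].
  move=> uv /existsP[y S]; have := square_nadj uv S.
  by move/and5P: S => [*]; split=> //; sd.
have nx_uniq u v h h' : U u v -> nx u v h -> nx u v h' -> h = h'.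
  move=> uv /existsP[y S] /existsP[y' S']; have [h0 [y0 [_ un]]] := ex u v uv.
  by have [_ ->] := un _ _ S; have [_ ->] := un _ _ S'.
have nx_rev u v h : U u v -> nx u v h -> nx u h v.
  by move=> uv /existsP[y S]; apply/existsP; exists y; exact: square_flip.
apply: (one_triangle_iso nx_ex nx_prop nx_uniq nx_rev tab4_ok cuboctahedron_ok) => //.
- move=> [u v] uv; have [h [y [S _]]] := ex u v uv.
  have E a b c e : U a b -> quad a b c e -> fb (fa nx (a, b)) = (e, a).
    by move=> ab S'; rewrite (faE nx_uniq ab (h := e)) //; apply/existsP; exists c.
  have S1 := square_rot uv S; have /and5P[h1 h2 h3 h4 h5] := S.
  have S2 := square_rot h1 S1; have S3 := square_rot h2 S2.
  by rewrite /= (E _ _ _ _ uv S) (E _ _ _ _ h3 S3) (E _ _ _ _ h2 S2) (E _ _ _ _ h1 S1).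
- have -> : size cuboctahedron_vertices = 12 by [].
  by have := euler_tri4 Us Ui gm V0 VE one_triangle; move: ne2; lia.
Qed.

Lemma square_others u v y h : U u v -> quad u v y h -> [&& U u h, h != v & h != tri u v].
Proof.
move=> uv S; have nh := square_nadj uv S; move/and5P: S => [_ _ hu -> _].
rewrite Us hu /=; apply: contraNneq nh => ->.
by have [] := triP uv.
Qed.

Lemma card_squares u v : U u v -> #|[pred p : V * V | quad u v p.2 p.1]| <= 2.
Proof.
move=> uv; rewrite -(card_in_image (f := fst)); last first.
  move=> [h y] [h' y']; rewrite !inE /= => S S' E; rewrite -E in S' *.
  by rewrite (square_uniq uv S S').
rewrite -(card_others uv); apply: subset_leq_card; apply/subsetP => h /imageP[p].
by rewrite !inE => S ->; exact: square_others S.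
Qed.

(** The graph is forced to look like the 3 by 3 rook graph: the two triangles at [v] are a row and a
    column, and the fourth corners of the squares at [v] fill the rest. Euler asks for 12
    vertices. *)
Lemma two_squares_card :
  (forall u v, U u v -> #|[pred p : V * V | quad u v p.2 p.1]| = 2) -> #|V| <= 9.
Proof.
move=> c2.
have sq u v h : U u v -> U u h -> h != v -> h != tri u v -> exists y, quad u v y h.
  move=> uv uh hv ht; pose P := [pred p : V * V | quad u v p.2 p.1].
  have cP : #|[pred x | x \in image fst P]| = 2.
    rewrite -(c2 _ _ uv) -(card_in_image (f := fst) (A := P)) //.
    move=> [h' y] [h'' y']; rewrite !inE /= => S S' E; rewrite -E in S' *.
    by rewrite (square_uniq uv S S').
  have : [pred x | x \in image fst P] h.
    apply: (card2_all cP (card_others uv)) => /=; last by rewrite uh hv ht.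
    by move=> x /imageP[p]; rewrite inE => S ->; exact: square_others S.
  by move=> /imageP[[h' y]]; rewrite inE /= => S ->; exists y.
have /card_gt0P[v _] := V0; have [s [sz us hs]] := degree_enum (U4 v).
case: s sz us hs => [|a s] // _ _ hs; have {hs}va : U v a by rewrite hs inE eqxx.
have [b [vb ba bt]] := nbr_ex va; have nv := nbrs va vb ba bt.
set a' := tri v a in bt nv; set b' := tri v b in nv.
have [va' aa' _] := triP va; have [vb' bb' _] := triP vb; rewrite -/a' -/b' in va' aa' vb' bb'.
have ea : tri v a' = a by rewrite /a' tri_tri.
have eb : tri v b' = b by rewrite /b' tri_tri.
have [n1 n2] : b' != a /\ b' != a'.
  split; apply/eqP => E; first by case/eqP: bt; rewrite -eb E.
  by case/eqP: ba; rewrite -eb E ea.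
have [yab S1] := sq v a b va vb ba bt.
have [yab' S2] := sq v a b' va vb' n1 n2.
have [|ya'b S3] := sq v a' b va' vb bt; first by rewrite ea.
have [|ya'b' S4] := sq v a' b' va' vb' n2; first by rewrite ea.
have nb x x' z z' y y' : U v x -> U x' x -> U v x' -> U z z' -> U v z -> U v z' -> x' != z ->
    quad v x y z -> quad v x y' z' ->
    U y y' /\ forall w, U x w = (w \in [:: v; x'; y; y']).
  move=> vx x'x vx' zz' vz vz' xz S S'; have xv : U x v by sd.
  have tx : tri x v = x' by have [_ _ h] := triP xv; rewrite -(h x') //; sd.
  have /and5P[k1 k2 k3 k4 k5] := S; have /and5P[l1 l2 l3 l4 l5] := S'.
  have nx : x' != y.
    apply/eqP => E; rewrite -E in k2; have x'v : U x' v by sd.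
    case/eqP: k4; apply: (@one_triangle v x') => //; sd.
  have nx' : x' != y'.
    apply/eqP => E; rewrite -E in l2; have x'v : U x' v by sd.
    case/eqP: l4; apply: (@one_triangle v x') => //; sd.
  have yy' : y != y'.
    apply/eqP => E; rewrite -E in l2; case/eqP: k5.
    by apply: (@one_triangle z z') => //; sd.
  have ny : y != tri x v by rewrite tx eq_sym.
  have ny' : y' != tri x v by rewrite tx eq_sym.
  have yy := nbrs_adj xv k1 k5 ny l1 l5 ny' yy'; split=> // w.
  have nb := nbrs xv k1 k5 ny; rewrite nb tx.
  have -> : tri x y = y'.
    by have [_ _ h] := triP k1; rewrite -(h y') //; sd.
  by [].
have T1 := square_flip va S1; have T2 := square_flip va S2.
have T3 := square_flip va' S3; have T4 := square_flip va' S4.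
have [b'b a'a] : U b b' /\ U a a' by split; sd.
have [ab' a'b'] : a != b' /\ a' != b' by split; sd.
have [ab a'b] : a != b /\ a' != b by split; sd.
have [ub' ub] : b' != a' /\ b != a' by split; sd.
have [A1 NA] := nb a a' b b' _ _ va aa' va' b'b vb vb' a'b S1 S2.
have [A2 NA'] := nb a' a b b' _ _ va' a'a va b'b vb vb' ab S3 S4.
have [B1 NB] := nb b b' a a' _ _ vb bb' vb' a'a va va' n1 T1 T3.
have [B2 NB'] := nb b' b a a' _ _ vb' b'b vb a'a va va' ba T2 T4.
have deg4 y p q r t : U y p -> U y q -> U p q -> U y r -> U y t -> r != p -> r != q -> U r t ->
    forall w, U y w = (w \in [:: p; q; r; t]).
  move=> yp yq pq yr yt rp rq rt w; have [_ _ h] := triP yp; have [_ _ h'] := triP yr.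
  have pE : tri y p = q by rewrite -(h q) //; sd.
  have rE : tri y r = t by rewrite -(h' t) //; sd.
  by rewrite (nbrs yp yr rp) ?pE ?rE.
have /and5P[s11 s12 _ s13 s14] := S1; have /and5P[s21 s22 _ s23 s24] := S2.
have /and5P[s31 s32 _ s33 s34] := S3; have /and5P[s41 s42 _ s43 s44] := S4.
have lst (S : seq V) p q r t w :
    p \in S -> q \in S -> r \in S -> t \in S -> w \in [:: p; q; r; t] -> w \in S.
  by move=> h1 h2 h3 h4; rewrite !inE => /or4P[] /eqP ->.
apply: (closed_card conn (s := [:: v; a; a'; b; b'; yab; yab'; ya'b; ya'b'])) => // x y.
rewrite 9!in_cons in_nil orbF => /or4P[| | |/or4P[| | |/or3P[]]] /eqP -> xy.
- by move: xy; rewrite nv; apply: lst; rewrite !inE eqxx ?orbT.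
- by move: xy; rewrite NA; apply: lst; rewrite !inE eqxx ?orbT.
- by move: xy; rewrite NA'; apply: lst; rewrite !inE eqxx ?orbT.
- by move: xy; rewrite NB; apply: lst; rewrite !inE eqxx ?orbT.
- by move: xy; rewrite NB'; apply: lst; rewrite !inE eqxx ?orbT.
- have e : b != yab' by apply: contraNneq (square_nadj va S1) => ->; sd.
  move: xy; rewrite (deg4 yab a yab' b ya'b) //; try sd.
  by apply: lst; rewrite !inE eqxx ?orbT.
- have e : b' != yab by apply: contraNneq (square_nadj va S2) => ->; sd.
  move: xy; rewrite (deg4 yab' a yab b' ya'b') //; try sd.
  by apply: lst; rewrite !inE eqxx ?orbT.
- have e : b != ya'b' by apply: contraNneq (square_nadj va' S3) => ->; sd.
  move: xy; rewrite (deg4 ya'b a' ya'b' b yab) //; try sd.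
  by apply: lst; rewrite !inE eqxx ?orbT.
- have e : b' != ya'b by apply: contraNneq (square_nadj va' S4) => ->; sd.
  move: xy; rewrite (deg4 ya'b' a' ya'b b' yab') //; try sd.
  by apply: lst; rewrite !inE eqxx ?orbT.
Qed.

Definition pent u v y q p :=
  [&& U u v, U v y, U y q, U q p & U p u] && uniq [:: u; v; y; q; p].

Lemma pent_rot u v y q p : pent u v y q p -> pent v y q p u.
Proof.
case/andP=> /and5P[h1 h2 h3 h4 h5] un; apply/andP; split; first exact/and5P.
by rewrite -(rot_uniq 1) in un.
Qed.

Lemma pent_flip u v y q p : pent u v y q p -> pent v u p q y.
Proof.
case/andP=> /and5P[h1 h2 h3 h4 h5] un; apply/andP; split; first by apply/and5P; split; sd.
by rewrite -(rev_uniq) -(rot_uniq 3).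
Qed.

Definition pents u v := #|[pred t : V * V * V | pent u v t.1.1 t.1.2 t.2]|.

Lemma pents_sym u v : pents u v = pents v u.
Proof.
have inj : injective (fun t : V * V * V => (t.2, t.1.2, t.1.1)).
  by move=> [[a b] c] [[a' b'] c'] [-> -> ->].
rewrite /pents -(card_image inj); apply: eq_card => -[[y q] p]; rewrite !inE /=.
apply/imageP/idP => [[[[y' q'] p']]|h].
  by rewrite inE /= => h [-> -> ->]; exact: pent_flip.
by exists (p, q, y); rewrite ?inE //=; exact: pent_flip.
Qed.

Section NoSquare.
Hypothesis n4 : noC4 U.

Lemma pent_nadj u v y q p : pent u v y q p -> ~~ U p v.
Proof.
case/andP=> /and5P[h1 h2 h3 h4 h5] un; apply/negP => pv.
apply: (n4 pv h2 h3 h4); move: un; rewrite /= !inE !negb_or; first by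
  case/and5P => _ _ /andP[_ ?] _ _; sd.
by case/and5P => _ /and3P[].
Qed.

Lemma pent_others u v y q p : pent u v y q p -> [&& U u p, p != v & p != tri u v].
Proof.
move=> P; have nd := pent_nadj P; move/andP: P => [/and5P[h1 h2 h3 h4 h5]].
rewrite /= !inE !negb_or => /and5P[_ /and3P[_ _ vp] _ _ _].
rewrite Us h5 eq_sym vp /=; apply: contraNneq nd => ->.
by have [] := triP h1.
Qed.

(** Two pentagons on the path [p u v] that differ at [y] have adjacent choices there. Following them
    round yields a 4-cycle or a second triangle on one edge. *)
Lemma pent_inj u v y q p y' q' : pent u v y q p -> pent u v y' q' p -> y = y' /\ q = q'.
Proof.
move=> P P'; have /and3P[up pv pt] := pent_others P.
have P1 := pent_rot P; have P1' := pent_rot P'.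
have /and3P[vu' uy ut] := pent_others P1.
have /andP[/and5P[h1 h2 h3 h4 h5]] := P; have /andP[/and5P[k1 k2 k3 k4 k5]] := P'.
rewrite /= !inE !negb_or => /and5P[/and4P[l1 l2 l3 l4] /and3P[l5 l6 l7] /andP[l8 l9] l10 _].
move=> /and5P[/and4P[m1 m2 m3 m4] /and3P[m5 m6 m7] /andP[m8 m9] m10 _].
have vu : U v u by sd.
have E : y = y'.
  apply/eqP/negPn/negP => yy'.
  have nd : ~~ U u y by have := pent_nadj (pent_rot P).
  have nd' : ~~ U u y' by have := pent_nadj (pent_rot P').
  have [e1 _ _] := triP vu; have [_ e2 _] := triP vu.
  have ny : y != tri v u by apply: contraNneq nd => ->; sd.
  have ny' : y' != tri v u by apply: contraNneq nd' => ->; sd.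
  have yu : y != u by sd.
  have yu' : y' != u by sd.
  have yy := nbrs_adj vu h2 yu ny k2 yu' ny' yy'.
  have [Eq|qq'] := eqVneq q q'.
    rewrite -Eq in k3; case/eqP: m6.
    by apply: (@one_triangle y y') => //; sd.
  have pq : U p q by sd.
  have pq' : U p q' by sd.
  have pu : U p u by sd.
  have [_ e3 _] := triP pu.
  have nq : ~~ U q u by exact: (pent_nadj (pent_rot (pent_rot (pent_rot (pent_rot P))))).
  have nq' : ~~ U q' u by exact: (pent_nadj (pent_rot (pent_rot (pent_rot (pent_rot P'))))).
  have tq : q != tri p u by apply: contraNneq nq => ->.
  have tq' : q' != tri p u by apply: contraNneq nq' => ->.
  have qu : q != u by sd.
  have qu' : q' != u by sd.
  have qq := nbrs_adj pu pq qu tq pq' qu' tq' qq'.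
  have q'y' : U q' y' by sd.
  have y'y : U y' y by sd.
  have qy' : q != y'.
    by apply/eqP => Eq; rewrite Eq in h4; apply: (n4 h4 h5 h1 k2) => //; sd.
  have [Eq|yq'] := eqVneq y q'; last by apply: (n4 h3 qq q'y' y'y).
  by rewrite -Eq in k4; apply: (n4 k4 h5 h1 h2) => //; sd.
split=> //; rewrite -E in k3; apply/eqP/negPn/negP => qq'.
by apply: (n4 h3 h4 (t := q')) => //; sd.
Qed.

Lemma card_pents u v : U u v -> pents u v <= 2.
Proof.
move=> uv; rewrite /pents -(card_in_image (f := snd)); last first.
  move=> [[y q] p] [[y' q'] p']; rewrite !inE /= => P P' E; rewrite -E in P' *.
  by have [-> ->] := pent_inj P P'.
rewrite -(card_others uv); apply: subset_leq_card; apply/subsetP => h /imageP[p].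
by rewrite !inE => P ->; exact: pent_others P.
Qed.

Lemma icosidodecahedron_case : (forall u v, U u v -> pents u v = 1) ->
  graph_iso U icosidodecahedron.
Proof.
move=> c1; pose nx u v h := [exists y, exists q, pent u v y q h].
have nxI u v y q h : pent u v y q h -> nx u v h.
  by move=> P; apply/existsP; exists y; apply/existsP; exists q.
have ex u v : U u v -> exists y q p, pent u v y q p /\
    forall y' q' p', pent u v y' q' p' -> p' = p.
  move=> /c1/mem_card1[[[y q] p] hP]; exists y, q, p.
  have E y' q' p' : pent u v y' q' p' = ((y', q', p') == (y, q, p)).
    by have := hP (y', q', p'); rewrite !inE.
  by rewrite E eqxx; split=> // y' q' p'; rewrite E => /eqP[].
have nx_ex u v : U u v -> exists h, nx u v h.
  by move=> /ex[y [q [h [P _]]]]; exists h; exact: nxI P.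
have nx_prop u v h : U u v -> nx u v h -> [/\ U u h, h != v & ~~ U h v].
  move=> uv /existsP[y /existsP[q P]]; have := pent_nadj P.
  by have /and3P[] := pent_others P.
have nx_uniq u v h h' : U u v -> nx u v h -> nx u v h' -> h = h'.
  move=> uv /existsP[y /existsP[q P]] /existsP[y' /existsP[q' P']].
  have [y0 [q0 [p0 [_ un]]]] := ex u v uv.
  by rewrite (un _ _ _ P) (un _ _ _ P').
have nx_rev u v h : U u v -> nx u v h -> nx u h v.
  move=> uv /existsP[y /existsP[q P]]; apply: (nxI _ _ q y).
  by apply/pent_flip/pent_rot/pent_rot/pent_rot/pent_rot.
apply: (one_triangle_iso nx_ex nx_prop nx_uniq nx_rev tab5_ok icosidodecahedron_ok) => //.
- move=> [u v] uv; have [y [q [h [P _]]]] := ex u v uv.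
  have E a b c e f : pent a b c e f -> fb (fa nx (a, b)) = (f, a).
    move=> P'; have /andP[/and5P[ab _ _ _ _] _] := P'.
    by rewrite (faE nx_uniq ab (h := f)) //; exact: nxI P'.
  have P1 := pent_rot P; have P2 := pent_rot P1; have P3 := pent_rot P2; have P4 := pent_rot P3.
  by rewrite /= (E _ _ _ _ _ P) (E _ _ _ _ _ P4) (E _ _ _ _ _ P3) (E _ _ _ _ _ P2) (E _ _ _ _ _ P1).
- have -> : size icosidodecahedron_vertices = 30 by [].
  by have := euler_tri5 Us Ui gm V0 VE one_triangle n4; move: ne2; lia.
Qed.

(** [D] is the ball of radius 2 around [u]. A vertex [x] at distance two has at most one neighbour
    [zz x] outside the ball, and the neighbours of that one are all back in it: 1 + 4 + 12 + 12 =
    29, one less than Euler requires. *)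
Lemma two_pents_card : (forall u v, U u v -> pents u v = 2) -> #|V| <= 29.
Proof.
move=> c2.
have pentE u v p : U u v -> U u p -> p != v -> ~~ U p v -> exists y q, pent u v y q p.
  move=> uv up pv npv; pose P := [pred t : V * V * V | pent u v t.1.1 t.1.2 t.2].
  have cP : #|[pred x | x \in image snd P]| = 2.
    rewrite -(c2 _ _ uv) /pents -(card_in_image (f := snd) (A := P)) //.
    move=> [[y q] p'] [[y' q'] p'']; rewrite !inE /= => P1 P2 E; rewrite -E in P2 *.
    by have [-> ->] := pent_inj P1 P2.
  have : [pred x | x \in image snd P] p.
    apply: (card2_all cP (card_others uv)) => /=.
      by move=> x /imageP[t]; rewrite inE => S ->; exact: pent_others S.
    by rewrite up pv /=; apply: contraNneq npv => ->; have [] := triP uv.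
  by move=> /imageP[[[y q] p']]; rewrite inE /= => S ->; exists y, q.
have /card_gt0P[u _] := V0.
pose D x := [|| x == u, U u x | [exists a, U u a && U a x]].
have D2 a x : U u a -> U a x -> D x.
  by move=> ua ax; rewrite /D; apply/or3P/Or33/existsP; exists a; rewrite ua.
have D1 x : U u x -> D x by rewrite /D => ->; rewrite orbT.
have nbx p q w : U p q -> U p w -> w != q -> w != tri p q -> forall t, U p t ->
    t \in [:: q; tri p q; w; tri p w].
  by move=> h1 h2 h3 h4 t; rewrite (nbrs h1 h2 h3 h4).
have child a x : U u a -> U a x -> x != u -> ~~ U u x -> exists q1,
    [/\ U x q1, D q1, q1 != a, q1 != tri x a & exists b, pent a x q1 b u].
  move=> ua ax xu nux; have au : U a u by sd.
  have ux : u != x by sd.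
  have [q1 [b P]] := pentE a x u ax au ux nux; exists q1.
  have /andP[/and5P[h1 h2 h3 h4 h5] _] := P; have ub : U u b by sd.
  have P' := pent_flip P; have xa : U x a by sd.
  have /and3P[k1 k2 k3] := pent_others P'.
  split=> //; last by exists b.
  by apply: (D2 b) => //; sd.
pose zz x := odflt u [pick w | U x w && ~~ D w].
have zP a x : U u a -> U a x -> x != u -> ~~ U u x ->
    (forall w, U x w -> ~~ D w -> w = zz x) /\
    (forall w, U x w -> ~~ D w -> forall t, U w t -> D t).
  move=> ua ax xu nux; have xa : U x a by sd.
  have [q1 [xq1 Dq1 q1a q1t [b P]]] := child a x ua ax xu nux.
  have tD : D (tri x a) by apply: (D2 a) => //; have [_ ? _] := triP xa; sd.
  (* Of the four neighbours of [x], the three [a], [tri x a] and [q1] lie in the ball. *)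
  have only w : U x w -> ~~ D w -> w = tri x q1.
    move=> xw; have := nbx _ _ _ xa xq1 q1a q1t w xw; rewrite !inE => /or4P[] /eqP -> //.
    - by rewrite D1.
    - by rewrite tD.
    - by rewrite Dq1.
  split=> [w xw nD|w xw nD t wt].
    rewrite /zz; case: pickP => [z /andP[xz nz]|/(_ w)]; last by rewrite xw nD.
    by rewrite /= (only _ xw nD) (only _ xz nz).
  have wE := only _ xw nD.
  have au : U a u by sd.
  set a' := tri u a; have [ua' a'a _] := triP ua; rewrite -/a' in ua' a'a.
  have na'x : ~~ U a' x.
    apply/negP => a'x; case/eqP: xu; apply: (@one_triangle a a') => //; sd.
  have a'x : a' != x by apply: contraNneq nux => <-.
  have aa' : U a a' by sd.
  (* The pentagon on [x a a'] has to leave [x] through [w], which gives [w] a neighbour [q] next to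
     [a']. The triangles on [w x] and [w q] then account for all neighbours of [w]. *)
  have [y [q P']] := pentE a x a' ax aa' a'x na'x.
  have /andP[/and5P[h1 h2 h3 h4 h5] un] := P'.
  move: un; rewrite /= !inE !negb_or => /and5P[/and4P[m1 m2 m3 m4] /and3P[m5 m6 m7] /andP[m8 m9] m10 _].
  have yw : y = w.
    have P2 := pent_flip P'; have /and3P[k1 k2 k3] := pent_others P2.
    have := nbx _ _ _ xa xq1 q1a q1t y k1; rewrite !inE (negPf k2) (negPf k3) wE /=.
    case/orP => /eqP // E; rewrite E in P2.
    have [E' _] := pent_inj (pent_flip P) P2.
    by rewrite -E' Ui in ua'.
  rewrite yw in h2 h3 P' m2 m5 m8 m9.
  have wx : U w x by sd.
  have qu : q != u by apply: contraNneq nD => E; rewrite E in h3; rewrite D1 //; sd.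
  have nuq : ~~ U u q by apply: contra nD => uq; apply: (D2 q) => //; sd.
  have a'q : U a' q by sd.
  have Dq : D q := D2 _ _ ua' a'q.
  have [q1' [qq1 Dq1' q1a' q1t' _]] := child a' q ua' a'q qu nuq.
  have qa' : U q a' by sd.
  have qw : U q w by sd.
  have wE' : w = tri q q1'.
    have := nbx _ _ _ qa' qq1 q1a' q1t' w qw; rewrite !inE => /or4P[] /eqP // E; rewrite E in nD.
    - by rewrite D1 in nD.
    - have [_ ? _] := triP qa'; case/negP: nD; apply: (D2 a') => //; sd.
    - by rewrite Dq1' in nD.
  have tx : tri w x = q1.
    have [e1 e2 _] := triP xq1; have [_ _ h] := triP wx.
    have wq1 : U w q1 by rewrite wE.
    by rewrite -(h q1) //; sd.
  have tq : tri w q = q1'.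
    have [e1 e2 _] := triP qq1; have [_ _ h] := triP h3.
    have wq1 : U w q1' by rewrite wE'.
    by rewrite -(h q1') //; sd.
  have nqx : q != tri w x.
    apply/eqP => E; have [_ e _] := triP wx; rewrite -E in e.
    have xa2 : U x a by sd.
    by apply: (n4 e xa2 aa' a'q) => //; sd.
  have qx : q != x by sd.
  have := nbx _ _ _ wx h3 qx nqx t wt; rewrite tx tq !inE => /or4P[] /eqP -> //.
  exact: (D2 a).
have [s [sz us hs]] := degree_enum (U4 u).
have rem_nb a : U u a -> exists l, size l = 3 /\ forall w, U a w -> w != u -> w \in l.
  move=> ua; have [sa [sza usa hsa]] := degree_enum (U4 a).
  have uin : u \in sa by rewrite -hsa Us.
  exists (rem u sa); rewrite size_rem ?sza //; split=> // w aw wu.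
  by rewrite (rem_filter u usa) mem_filter /= wu -hsa.
case: s sz us hs => [|a [|b [|c [|d []]]]] // _ us hs.
have [va vb vc vd] : [/\ U u a, U u b, U u c & U u d] by rewrite !hs !inE !eqxx !orbT.
have [la [sa la1]] := rem_nb a va; have [lb [sb lb1]] := rem_nb b vb.
have [lc [sc lc1]] := rem_nb c vc; have [ld [sd' ld1]] := rem_nb d vd.
have [L [sL LP]] : exists L, size L = 12 /\
    forall p w, U u p -> U p w -> w != u -> w \in L.
  exists (la ++ lb ++ lc ++ ld); rewrite !size_cat sa sb sc sd'; split=> // p w.
  rewrite hs !inE => /or4P[] /eqP -> pw wu; rewrite !mem_cat.
  - by rewrite la1.
  - by rewrite lb1 ?orbT.
  - by rewrite lc1 ?orbT.
  - by rewrite ld1 ?orbT.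
pose S := u :: [:: a; b; c; d] ++ L ++ map zz L.
have DS w : D w -> w \in S.
  case/or3P => [/eqP ->|uw|/existsP[p /andP[up pw]]]; first by rewrite inE eqxx.
    by rewrite inE mem_cat -hs uw orbT.
  have [->|wu] := eqVneq w u; first by rewrite inE eqxx.
  by rewrite inE !mem_cat (LP p) ?orbT.
have cl : #|V| <= size S.
  pose B w := D w || [exists x, D x && U x w].
  have BS w : B w -> w \in S.
    case/orP => [/DS //|/existsP[x /andP[Dx xw]]].
    have [/DS //|nD] := boolP (D w).
    have [E|xu] := eqVneq x u; first by rewrite E in xw; rewrite D1 in nD.
    have [ux|nux] := boolP (U u x); first by rewrite (D2 x) in nD.
    move: Dx; rewrite /D (negPf xu) (negPf nux) /= => /existsP[p /andP[up px]].
    have [h _] := zP p x up px xu nux; rewrite (h w xw nD).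
    by rewrite inE !mem_cat map_f ?orbT //; apply: (LP p).
  have Bcl x w : B x -> U x w -> B w.
    move=> Bx xw; have [Dx|nDx] := boolP (D x).
      by rewrite /B; apply/orP; right; apply/existsP; exists x; rewrite Dx.
    move: Bx; rewrite /B (negPf nDx) /= => /existsP[y /andP[Dy yx]].
    have [E|yu] := eqVneq y u; first by rewrite E in yx; rewrite D1 in nDx.
    have [uy|nuy] := boolP (U u y); first by rewrite (D2 y) in nDx.
    move: Dy; rewrite /D (negPf yu) (negPf nuy) /= => /existsP[p /andP[up py]].
    by have [_ h] := zP p y up py yu nuy; apply/orP; left; exact: (h x yx nDx w xw).
  have Bu : B u by rewrite /B /D eqxx.
  have all_in w : w \in S.
    have go p x : B x -> path U x p -> B (last x p).
      elim: p x => [|y p IH] x Bx //= /andP[xy pp]; apply: (IH y _ pp); exact: Bcl xy.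
    by apply: BS; case/connectP: (conn u w) => p pp ->; exact: go.
  by rewrite cardE; apply: uniq_leq_size (enum_uniq V) _ => w _; exact: all_in.
by move: cl; rewrite /S /= size_cat size_map sL.
Qed.

(** Walks [u p q y v], closed to a 5-cycle by the edge from [v] to [u]. The restriction on [y] is
    visible to the colors and leaves a constant number of degenerate walks. *)
Definition walks5 u v : nat := \sum_y [&& U y v, y != u & ~~ U u y] * walks3 U u y.

Lemma walks5E u v : U u v -> walks5 u v = 4 + pents u v.
Proof.
move=> uv; have vu : U v u by sd.
pose W := [pred x : V * V * V | [&& U x.1.1 v, x.1.1 != u & ~~ U u x.1.1] &&
  [&& U u x.2, U x.2 x.1.2 & U x.1.2 x.1.1]].
have -> : walks5 u v = #|W|.
  rewrite -sum1_card big_mkcond /= -(pair_big predT predT (fun a p => if W (a, p) then 1 else 0)) /=.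
  rewrite -(pair_big predT predT (fun y q => \sum_p if W (y, q, p) then 1 else 0)) /=.
  apply: eq_bigr => y _; rewrite exchange_big /= /walks3 big_distrr; apply: eq_bigr => p _ /=.
  rewrite /walks2 !big_distrr; apply: eq_bigr => q _ /=.
  by case: [&& _, _ & _]; case: (U u p); case: (_ && _); rewrite ?muln0 ?mul0n.
have [y1 [vy1 y1u y1t]] := nbr_ex vu; have nv := nbrs vu vy1 y1u y1t.
set t := tri v u in y1t nv; set y2 := tri v y1 in nv.
have [vt tu tP] := triP vu; have [vy2 y21 y2P] := triP vy1; rewrite -/t -/y2 in vt tu tP vy2 y21 y2P.
have y2u : y2 != u by apply/eqP => E; case/eqP: y1t; apply: tP => //; rewrite -E; sd.
have y2t : y2 != t.
  by apply/eqP => E; case/eqP: y1u; apply: (@one_triangle v t) => //; rewrite -?E; sd.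
have nuy y : U v y -> y != u -> y != t -> ~~ U u y.
  by move=> vy yu yt; apply/negP => uy; case/eqP: yt; apply: tP => //; sd.
(* Triples [(y, q, p)] of the degenerate walks: [u v y2 y1 v], [u v y1 y2 v], [u t v y1 v] and
   [u t v y2 v]. *)
pose D := [:: (y1, y2, v); (y2, y1, v); (y1, v, t); (y2, v, t)].
have n12 : y1 != y2 by rewrite eq_sym; exact: neq.
have uD : uniq D.
  have [vy1' vt'] : v != y1 /\ v != t by split; exact: neq.
  rewrite /= !inE !xpair_eqE !negb_or (negPf n12) (eq_sym y2) (negPf n12) (negPf vt') /=.
  by rewrite !andbF.
have cD : #|[set x in D]| = 4 by rewrite cardsE (card_uniqP uD).
pose P := [set x : V * V * V | pent u v x.1.1 x.1.2 x.2].
have -> : pents u v = #|P| by apply: eq_card => x; rewrite !inE.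
have dj : [disjoint [set x in D] & P].
  rewrite -setI_eq0; apply/eqP/setP => x; rewrite !inE; apply/negP => /andP[].
  have t2 : tri u v = t by have [_ _ h] := triP uv; rewrite -(h t) //; sd.
  by case/or4P => /eqP -> /pent_others /and3P[_]; rewrite ?eqxx ?t2 ?eqxx.
rewrite -cD; have <- : #|[set x in D] :|: P| = #|[set x in D]| + #|P|.
  by rewrite -cardsUI (disjoint_setI0 dj) cards0 addn0.
apply: eq_card => -[[y q] p]; rewrite !inE /= -/(D).
apply/idP/idP => [|/orP[]].
- case/andP => /and3P[yv yu uy] /and3P[up pq qy]; have vy : U v y by sd.
  have yt : y != t by apply: contraNneq uy => ->; sd.
  have yin : y \in [:: y1; y2].
    by move: vy; rewrite nv !inE (negPf yu) (negPf yt).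
  have [E|pv] := eqVneq p v.
    rewrite E in pq; apply/orP; left; rewrite !xpair_eqE E eqxx !andbT.
    have -> : q = if y == y1 then y2 else y1.
      move: yin; rewrite !inE => /orP[] /eqP Ey; rewrite Ey ?eqxx in qy *; first exact: y2P.
      by rewrite eq_sym (negPf n12); apply: (@one_triangle v y2) => //; sd.
    by move: yin; rewrite !inE => /orP[] /eqP ->; rewrite !eqxx ?orbT // eq_sym (negPf n12) !eqxx ?orbT.
  have [E|pt] := eqVneq p t.
    have qv : q = v.
      apply/eqP/negPn/negP => qv; rewrite E in pq; have tv : U t v by sd.
      have yq : U y q by sd.
      have qt : U q t by sd.
      by apply: (n4 tv vy yq qt); sd.
    apply/orP; left; rewrite !xpair_eqE E qv !eqxx !andbT.
    by move: yin; rewrite !inE => /orP[] ->; rewrite ?orbT.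
  apply/orP; right; apply/andP; split; first by apply/and5P; split; sd.
  have n1 : q != v.
    by apply: contraNneq pt => E; rewrite E in pq; apply/eqP/tP; sd.
  have n2 : q != u by apply: contraNneq uy => <-; sd.
  have n3 : p != y by apply: contraNneq uy => <-.
  have [n4' n5 n6] : [/\ u != v, u != p & v != y] by split; exact: neq.
  have [n7 n8] : q != y /\ p != q by split; exact: neq.
  by neqs.
- case/or4P => /eqP[-> -> ->]; rewrite ?(Us y1 v) ?(Us y2 v) ?vy1 ?vy2 ?y1u ?y2u ?nuy // ?uv /=;
    rewrite ?vt ?(Us u t) ?(Us t v) ?tu ?vt //; by [|rewrite Us].
- move=> Pq; have nd := pent_nadj (pent_rot Pq); have /andP[/and5P[h1 h2 h3 h4 h5]] := Pq.
  rewrite /= !inE !negb_or => /and5P[/and4P[_ uy _ _] _ _ _ _].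
  by rewrite Us h2 eq_sym uy nd Us h5 Us h4 Us h3.
Qed.

End NoSquare.

(** Constancy of [walks5] comes along one orientation of each edge only, whence the disjunction in
    the hypothesis; the symmetry of [pents] undoes it. At most two squares and at most two pentagons
    fit on an edge, and only a single one survives Euler's bound. *)
Lemma one_triangle_main :
  (exists k, forall u v, U u v -> walks3 U u v = k) ->
  (exists k, forall u v, U u v -> walks5 u v = k \/ walks5 v u = k) ->
  graph_iso U cuboctahedron \/ graph_iso U icosidodecahedron.
Proof.
move=> [k hk] [l hl].
have [u [v uv]] : exists u v, U u v.
  have /card_gt0P[u _] := V0; have [s [sz us hs]] := degree_enum (U4 u).
  by case: s sz us hs => [|a s] // _ _ hs; exists u, a; rewrite hs inE eqxx.
have sqk a b : U a b -> #|[pred p : V * V | quad a b p.2 p.1]| = k - 7.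
  by move=> ab; rewrite -(hk a b ab) card_walks3 // addKn.
have := card_squares uv; rewrite sqk //.
case E: (k - 7) => [|[|[|]]] // _; rewrite {}E in sqk.
- right; have n4 : noC4 U.
    move=> x y z t xy yz zt tx xz yt.
    have := card0_eq (sqk x y xy) (t, z); rewrite !inE /= /quad yz zt tx.
    by rewrite eq_sym yt eq_sym xz.
  have pk a b : U a b -> pents a b = l - 4.
    move=> ab; have ba : U b a by sd.
    case: (hl a b ab) => <-; rewrite walks5E // ?(pents_sym b) addKn //.
  have := card_pents n4 uv; rewrite pk //.
  case E: (l - 4) => [|[|[|]]] // _; rewrite {}E in pk.
  + have n5 : noC5 U.
      move=> x y z t w xy yz zt tw wx un.
      have := card0_eq (pk x y xy) (z, t, w).
      by rewrite inE /= /pent xy yz zt tw wx un.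
    by have := euler_tri6 Us Ui gm V0 VE one_triangle n4 n5; move: ne2; lia.
  + exact: icosidodecahedron_case.
  + have := two_pents_card n4 pk; have := euler_tri5 Us Ui gm V0 VE one_triangle n4.
    by move: ne2; lia.
- by left; exact: cuboctahedron_case.
- have := two_squares_card sqk; have := euler_tri4 Us Ui gm V0 VE one_triangle.
  by move: ne2; lia.
Qed.
End Cases.
End OneTriangle.

(** * Degrees four and five by the number of triangles on an edge *)

Section RegularCases.
Variables (V : finType) (U : rel V).
Hypothesis Us : symmetric U.
Hypothesis Ui : irreflexive U.
Hypothesis conn : forall v w, connect U v w.
Hypothesis V0 : 0 < #|V|.
Hypothesis gm : gridmodel (@esrc V U) (@etgt V U).

Lemma walks2_lt u v : U u v -> walks2 U u v < degree U u.
Proof.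
move=> uv; rewrite walks2E; apply: proper_card; apply/properP; split.
  by apply/subsetP => x; rewrite !inE => /andP[].
by exists v; rewrite !inE ?uv ?Ui.
Qed.

Lemma walks2_noC3 : (forall u v, U u v -> walks2 U u v = 0) -> noC3 U.
Proof.
move=> w0 x y z xy yz zx; have := w0 x y xy; rewrite walks2E => /card0_eq/(_ z).
by rewrite !inE Us zx Us yz.
Qed.

Lemma complete_card d : (forall v, degree U v = d.+1) ->
  (forall u v, U u v -> walks2 U u v = d) -> #|V| <= d.+2.
Proof.
move=> Ud w2; have /card_gt0P[u _] := V0.
have [s [sz us hs]] := degree_enum (Ud u).
rewrite -sz -[(size s).+1]/(size (u :: s)); apply: (closed_card conn) => // x y.
rewrite !inE => /orP[/eqP ->|]; first by rewrite -hs => ->; rewrite orbT.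
rewrite -!hs => ux xy; have [//|yu] := eqVneq y u; rewrite /=.
have cN : #|[predD1 [pred w | U x w] & u]| = d.
  have := cardD1 u [pred w | U x w]; rewrite -/(degree U x) Ud inE Us ux.
  by case.
have sb : [pred w | U x w && U w u] \subset [predD1 [pred w | U x w] & u].
  apply/subsetP => w; rewrite !inE => /andP[-> wu]; rewrite andbT.
  by apply/eqP => E; rewrite E Ui in wu.
have /subset_cardP /(_ sb)/(_ y) : #|[pred w | U x w && U w u]| = #|[predD1 [pred w | U x w] & u]|.
  by rewrite cN -walks2E w2 // Us.
by rewrite !inE yu xy /= Us => ->.
Qed.

Lemma quartic_main : (forall v, degree U v = 4) ->
  (exists k, forall u v, U u v -> walks2 U u v = k) ->
  (exists k, forall u v, U u v -> walks3 U u v = k) ->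
  (exists k, forall u v, U u v -> walks5 U u v = k \/ walks5 U v u = k) ->
  graph_iso U octahedron \/ graph_iso U cuboctahedron \/ graph_iso U icosidodecahedron.
Proof.
move=> U4 [k hk] w3 w5.
have ne2 : 4 * #|V| = 2 * #|edge U| := sum_degree Us Ui U4.
have VE : #|V| < #|edge U| by move: ne2 V0; lia.
have [u [v uv]] : exists u v, U u v.
  have /card_gt0P[u _] := V0; have [s [sz us hs]] := degree_enum (U4 u).
  by case: s sz us hs => [|a s] // _ _ hs; exists u, a; rewrite hs inE eqxx.
have := walks2_lt uv; rewrite U4 hk //.
have e3 := euler3 Us Ui gm V0 VE.
(* For [k = 0] the bound for triangle-free graphs fails, and for [k = 3] there are at most 5
   vertices where Euler asks for 6. *)
case: k hk => [|[|[|[|]]]] // hk _.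
- by have := euler4 Us Ui gm V0 VE (walks2_noC3 hk); move: ne2; lia.
- by right; apply: one_triangle_main.
- by left; apply: locally_C4 => //; move: ne2 e3; lia.
- by have := complete_card U4 hk; move: ne2 e3; lia.
Qed.

Lemma quintic_main : (forall v, degree U v = 5) ->
  (exists k, forall u v, U u v -> walks2 U u v = k) -> graph_iso U icosahedron.
Proof.
move=> U5 [k hk].
have ne2 : 5 * #|V| = 2 * #|edge U| := sum_degree Us Ui U5.
have VE : #|V| < #|edge U| by move: ne2 V0; lia.
have [u [v uv]] : exists u v, U u v.
  have /card_gt0P[u _] := V0; have [s [sz us hs]] := degree_enum (U5 u).
  by case: s sz us hs => [|a s] // _ _ hs; exists u, a; rewrite hs inE eqxx.
have kle := walks2_lt uv; rewrite U5 hk // in kle.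
have e3 := euler3 Us Ui gm V0 VE.
(* The neighbours of [u] induce a [k]-regular graph on 5 vertices, so [k] is even. *)
have keven : exists n, 5 * k = 2 * n.
  pose r : rel V := fun x y => [&& U u x, U u y & U x y].
  have rs : symmetric r by move=> x y; apply/and3P/and3P => -[*]; split; sd.
  have ri : irreflexive r by move=> x; rewrite /r Ui !andbF.
  exists #|edge r|; rewrite -(npairs_edge rs ri) /npairs -sum1_card big_mkcond /=.
  rewrite -(pair_big predT predT (fun x y => if r x y then 1 else 0)) /=.
  rewrite (eq_bigr (fun x => if U u x then k else 0)).
    by rewrite -big_mkcond sum_nat_const -(U5 u).
  move=> x _; case: ifP => ux; last by rewrite big1 // => y _; rewrite /r ux.
  rewrite -(hk _ _ ux); apply: eq_bigr => y _; rewrite /r ux (Us y x).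
  by case: (U u y && U x y).
case: k hk kle keven => [|[|[|[|[|]]]]] // hk _ [n kn]; try lia.
- by have := euler4 Us Ui gm V0 VE (walks2_noC3 hk); move: ne2; lia.
- by apply: locally_C5 => //; move: ne2 e3; lia.
- by have := complete_card U5 hk; move: ne2 e3; lia.
Qed.
End RegularCases.

(** * Bipartite graphs *)

Section BipartiteCount.
Variables (V : finType) (U : rel V) (X : pred V) (c d : nat).
Hypothesis Us : symmetric U.
Hypothesis Ui : irreflexive U.
Hypothesis bip : forall v w, U v w -> X w = ~~ X v.
Hypothesis degX : forall v, X v -> degree U v = c.
Hypothesis degY : forall v, ~~ X v -> degree U v = d.

Lemma bip_noC3 : noC3 U.
Proof. by move=> x y z /bip h1 /bip h2 /bip; rewrite h2 h1 negbK; case: (X x). Qed.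

Lemma bip_noC5 : noC5 U.
Proof.
by move=> x y z t u /bip h1 /bip h2 /bip h3 /bip h4 /bip; rewrite h4 h3 h2 h1 !negbK; case: (X x).
Qed.

Lemma bip_count : c * #|X| = d * #|predC X| /\ #|edge U| = c * #|X|.
Proof.
have e1 : \sum_(v | X v) degree U v = c * #|X|.
  by rewrite (eq_bigr (fun=> c)) ?sum_nat_const 1?mulnC // => v /degX.
have e2 : \sum_(v | ~~ X v) degree U v = d * #|predC X|.
  by rewrite (eq_bigr (fun=> d)) ?sum_nat_const 1?mulnC // => v /degY.
have degE v : degree U v = \sum_w U v w.
  by rewrite /degree -sum1_card big_mkcond; apply: eq_bigr => w _; rewrite inE; case: (U v w).
have e3 : \sum_(v | X v) degree U v = \sum_(v | ~~ X v) degree U v.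
  under eq_bigr do rewrite degE; under [RHS]eq_bigr do rewrite degE.
  rewrite exchange_big /= (bigID X) /= big1 ?add0n.
    apply: eq_bigr => w Xw; rewrite [RHS](bigID X) /= [X in _ + X]big1 ?addn0.
      by apply: eq_bigr => v _; rewrite Us.
    by move=> v Xv; case h : (U w v) => //; have := bip h; rewrite (negPf Xv) (negPf Xw).
  move=> w Xw; apply: big1 => v Xv; case h : (U v w) => //.
  by have := bip h; rewrite Xv Xw.
split; first by rewrite -e1 e3 e2.
have := sum_deg Us Ui; rewrite (bigID X) /=.
rewrite -[X in X + _]/(\sum_(v | X v) degree U v) -[X in _ + X]/(\sum_(v | ~~ X v) degree U v).
by rewrite -e3 e1; lia.
Qed.

End BipartiteCount.

Section Bipartite.
Variables (V : finType) (U : rel V) (X : pred V) (d : nat).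
Hypothesis Us : symmetric U.
Hypothesis Ui : irreflexive U.
Hypothesis conn : forall v w, connect U v w.
Hypothesis V0 : 0 < #|V|.
Hypothesis gm : gridmodel (@esrc V U) (@etgt V U).
Hypothesis bip : forall v w, U v w -> X w = ~~ X v.
Hypothesis degX : forall v, X v -> degree U v = 3.
Hypothesis degY : forall v, ~~ X v -> degree U v = d.
Hypothesis d3 : 3 <= d <= 5.

(** There are no triangles, so [euler4] applies. The cube, the rhombic dodecahedron and the rhombic
    triacontahedron attain the three bounds. *)
Lemma bip_card : 8 <= #|V| /\ (d = 4 -> 14 <= #|V|) /\ (d = 5 -> 32 <= #|V|).
Proof.
have [e1 e2] := bip_count Us Ui bip degX degY; have e3 := cardC X.
have VE : #|V| < #|edge U|.
  move: e1 e2 e3 V0 d3; move: #|X| #|predC X| #|V| #|edge U| => a b c e; nia.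
have := euler4 Us Ui gm V0 VE (bip_noC3 bip).
move: e1 e2 e3 d3; move: #|X| #|predC X| #|V| #|edge U| => a b c e e1 e2 e3 dd h.
have : d = 3 \/ d = 4 \/ d = 5 by lia.
by case=> [E|[E|E]]; rewrite E in e1 *; split; try split; lia.
Qed.

Variable k : nat.
Hypothesis hk : forall x y y', X x -> U x y -> U x y' -> y != y' -> walks2 U y y' = k.

(** Counting the 2-walks that leave [a] for another vertex shows that [k] divides [2 * d]. The value
    1 excludes 4-cycles and violates Euler; the value [d] gives all neighbours of a vertex of [X]
    the same neighbourhood, so that at most [d + 3] vertices remain. With [3 <= d <= 5] only 2 is
    left. *)
Lemma bip_k : k = 2.
Proof.
have [x Xx] : exists x, X x.
  have /card_gt0P[v _] := V0; have [Xv|nXv] := boolP (X v); first by exists v.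
  have [s [sz us hs]] := degree_enum (degY nXv).
  case: s sz us hs => [|a s] /=; first by lia.
  by move=> _ _ hs; exists a; rewrite (bip (_ : U v a)) // hs inE eqxx.
have [s [sz us hs]] := degree_enum (degX Xx).
case: s sz us hs => [|a [|b [|c []]]] // _ us hs.
have [xa xb xc] : [/\ U x a, U x b & U x c] by rewrite !hs !inE !eqxx !orbT.
move: us; rewrite /= !inE !negb_or => /and3P[/andP[ab ac] bc _].
have nXa : ~~ X a by rewrite (bip xa) Xx.
have degUa := degY nXa.
have kE := hk Xx xa xb ab; rewrite walks2E in kE.
have k0 : 0 < k by rewrite -kE; apply/card_gt0P; exists x; rewrite inE Us xa.
have kd : k <= d.
  by rewrite -kE -degUa; apply: subset_leq_card; apply/subsetP => u; rewrite !inE => /andP[].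
have [m mE] : exists m, k * m = 2 * d.
  exists #|[pred y | (y != a) && (walks2 U a y != 0)]|.
  have -> : k * #|[pred y | (y != a) && (walks2 U a y != 0)]| = \sum_(y | y != a) walks2 U a y.
    rewrite [RHS](bigID (fun y => walks2 U a y != 0)) /= [X in _ + X]big1 ?addn0; last first.
      by move=> y /andP[_]; rewrite negbK => /eqP.
    rewrite (eq_bigr (fun=> k)) ?sum_nat_const 1?mulnC // => y /andP[ya].
    rewrite walks2E -lt0n => /card_gt0P[u]; rewrite inE => /andP[au uy].
    rewrite -walks2E; apply: (@hk u) => //; try sd.
    by rewrite (bip au).
  rewrite exchange_big /= -degUa mulnC -sum_nat_const [RHS]big_mkcond /=.
  apply: eq_bigr => u _; rewrite inE; have [au|] := boolP (U a u); last by rewrite big1.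
  have Xu : X u by rewrite (bip au).
  have <- : #|[predD1 [pred w | U u w] & a]| = 2.
    by have := cardD1 a [pred w | U u w]; rewrite -/(degree U u) degX // inE Us au; case.
  by rewrite -sum1_card big_mkcond [RHS]big_mkcond /=; apply: eq_bigr => y _; rewrite !inE; case: (y != a); case: (U u y).
have k1 : k != 1.
  apply/eqP => k1; have [e1 e2] := bip_count Us Ui bip degX degY; have e3 := cardC X.
  have VE : #|V| < #|edge U|.
    move: e1 e2 e3 V0 d3; move: #|X| #|predC X| #|V| #|edge U| => a' b' c' e; nia.
  have n4 : noC4 U.
    have main p q r t : X p -> U p q -> U q r -> U r t -> U t p -> p != r -> q != t -> False.
      move=> Xp pq qr rt tp pr qt; have pt : U p t by sd.
      have := hk Xp pq pt qt; rewrite k1 walks2E => /eqP; apply/negP.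
      rewrite neq_ltn; apply/orP; right; apply/card_gt1P; exists p, r.
      by split=> //; rewrite !inE ?qr ?rt // Us pq.
    move=> p q r t pq qr rt tp pr qt; have [Xp|nXp] := boolP (X p).
      exact: (main p q r t).
    apply: (main q r t p) => //; last by sd.
    by rewrite (bip pq).
  have := euler6 Us Ui gm V0 VE (bip_noC3 bip) n4 (bip_noC5 bip).
  by move: e1 e2 e3 d3; move: #|X| #|predC X| #|V| #|edge U| => a' b' c' e; nia.
have kd' : k != d.
  apply/eqP => kd'.
  have twin u y y' : X u -> U u y -> U u y' -> forall z, U y z -> U y' z.
    move=> Xu uy uy' z yz; have [<-//|yy'] := eqVneq y y'.
    have := hk Xu uy uy' yy'; rewrite kd' walks2E => c3.
    have sb : [pred u | U y u && U u y'] \subset [pred u | U y u].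
      by apply/subsetP => v; rewrite !inE => /andP[].
    have /subset_cardP /(_ sb) E : #|[pred u | U y u && U u y']| = #|[pred u | U y u]|.
      by rewrite c3 -/(degree U y) degY // (bip uy) Xu.
    by have := E z; rewrite !inE yz Us => /andP[].
  have [sa [sza usa hsa]] := degree_enum degUa.
  have cl : #|V| <= size ([:: a; b; c] ++ sa).
    apply: (closed_card conn) => // p q; rewrite !mem_cat -!hsa -!hs => /orP[xp|ap] pq.
      by rewrite (twin x p a Xx xp xa q pq) orbT.
    have Xp : X p by rewrite (bip ap).
    have pa : U p a by sd.
    have qx : U q x by apply: (twin p a q Xp pa pq); sd.
    by rewrite Us qx.
  have [c8 [c14 c32]] := bip_card; rewrite size_cat sza /= in cl.
  have : d = 3 \/ d = 4 \/ d = 5 by move: d3; lia.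
  case=> [E|[E|E]]; first by move: (leq_trans c8 cl); rewrite E.
    by move: (leq_trans (c14 E) cl); rewrite E.
  by move: (leq_trans (c32 E) cl); rewrite E.
have : k = 1 \/ k = 2 \/ k = 3 \/ k = 4 \/ k = 5 by move: d3; lia.
by case=> [E|[//|[E|[E|E]]]]; move: mE kd kd' k1 d3; rewrite E => *; lia.
Qed.
End Bipartite.

(** * Flags of the rhombic polyhedra *)

Section Rhombic.
Variables (V : finType) (U : rel V) (X : pred V) (d : nat).
Hypothesis Us : symmetric U.
Hypothesis conn : forall v w, connect U v w.
Hypothesis bip : forall v w, U v w -> X w = ~~ X v.
Hypothesis degX : forall v, X v -> degree U v = 3.
Hypothesis degY : forall v, ~~ X v -> degree U v = d.
Hypothesis X0 : exists x, X x.
Hypothesis two : forall x y y', X x -> U x y -> U x y' -> y != y' -> walks2 U y y' = 2.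
Hypothesis ntw : forall x x' a b c, U x a -> U x b -> U x c -> U x' a -> U x' b -> U x' c ->
  X x -> uniq [:: a; b; c] -> x = x'.

Definition opp x y y' := odflt x [pick x' | [&& U y x', U y' x' & x' != x]].

Lemma oppP x y y' : X x -> U x y -> U x y' -> y != y' ->
  [/\ X (opp x y y'), U y (opp x y y'), U y' (opp x y y'), opp x y y' != x &
      forall z, U y z -> U y' z -> z != x -> z = opp x y y'].
Proof.
move=> Xx xy xy' yy'; have := two Xx xy xy' yy'; rewrite walks2E => c2.
have [|z zx zP] := card2P c2 (v := x); first by rewrite /= Us xy.
have := zP z; rewrite /= eqxx orbT => /andP[yz zy'].
have E : opp x y y' = z.
  rewrite /opp; case: pickP => [w /and3P[w1 w2 w3]|/(_ z)]; last by rewrite yz Us zy' zx.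
  by have := zP w; rewrite /= w1 Us w2 (negPf w3) /= => /esym/eqP.
rewrite E; split=> //; first by rewrite (bip yz) (bip xy) Xx.
  by sd.
move=> w w1 w2 w3; have := zP w; rewrite /= w1 (Us w) w2 (negPf w3) /= => /esym/eqP //.
Qed.

(** [x] is a vertex of the cube or dodecahedron and [y1], [y2], [y3] are the faces around it. The
    flag consists of [x], the edge between [y1] and [y2], and the face [y1]; carrying [y3] along
    makes [rb] and [rc] plain transpositions. *)
Definition rflag : Type := (V * V * V * V)%type.
Definition rgood (f : rflag) : Prop :=
  let: (x, y1, y2, y3) := f in
  [/\ X x, [/\ U x y1, U x y2 & U x y3] & [/\ y1 != y2, y1 != y3 & y2 != y3]].
Definition ra (f : rflag) : rflag :=
  let: (x, y1, y2, y3) := f in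
  let x' := opp x y1 y2 in (x', y1, y2, third U x' y1 y2).
Definition rb (f : rflag) : rflag := let: (x, y1, y2, y3) := f in (x, y1, y3, y2).
Definition rc (f : rflag) : rflag := let: (x, y1, y2, y3) := f in (x, y2, y1, y3).

Lemma rgoodN x y1 y2 y3 : rgood (x, y1, y2, y3) -> forall w, U x w = (w \in [:: y1; y2; y3]).
Proof.
move=> [Xx [h1 h2 h3] [n1 n2 n3]]; apply: degree_span; rewrite ?degX //=; last by rewrite h1 h2 h3.
by neqs.
Qed.

Lemma raP x y1 y2 y3 : rgood (x, y1, y2, y3) -> exists x' z,
  [/\ ra (x, y1, y2, y3) = (x', y1, y2, z), rgood (x', y1, y2, z), x' != x,
      ra (x', y1, y2, z) = (x, y1, y2, y3) &
      forall w, U y1 w -> U y2 w -> w != x -> w = x'].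
Proof.
move=> [Xx [h1 h2 h3] [n1 n2 n3]]; have [k1 k2 k3 k4 k5] := oppP Xx h1 h2 n1.
set x' := opp x y1 y2 in k1 k2 k3 k4 k5.
have [x1 x2] : U x' y1 /\ U x' y2 by split; sd.
have [t1 t2 t3 _] := thirdP (degX k1) x1 x2 n1.
exists x', (third U x' y1 y2); split=> //; first by split=> //; split=> //; sd.
have [_ _ _ _ l5] := oppP k1 x1 x2 n1.
have E : opp x' y1 y2 = x by rewrite -(l5 x) //; sd.
by rewrite /ra E (third_eq (degX Xx) (c := y3)) //; sd.
Qed.

(** Links two neighbours of [y] that lie on a common rhombus with [y]. Once this relation is known
    to be a single cycle, it orders the vertices around the face [y]. *)
Definition rlink y : rel V := fun x x' => [&& U y x, U y x', x != x' &
  [exists z, [&& z != y, U z x & U z x']]].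

Lemma rlink_sym y : symmetric (rlink y).
Proof.
by move=> x x'; apply/and4P/and4P => -[h1 h2 h3 /existsP[z /and3P[? ? ?]]]; split=> //; try sd;
  apply/existsP; exists z; apply/and3P.
Qed.

Lemma rlink_irr y : irreflexive (rlink y).
Proof. by move=> x; rewrite /rlink eqxx !andbF. Qed.

Lemma rlinkN y x x' : rlink y x x' -> [pred w | U y w] x.
Proof. by case/and4P. Qed.

Lemma flag_ex x y : X x -> U x y -> exists y2 y3, rgood (x, y, y2, y3).
Proof.
move=> Xx xy; have [s [sz us hs]] := degree_enum (degX Xx).
have ys : y \in s by rewrite -hs.
have := perm_to_rem ys; case E : (rem y s) => [|y2 [|y3 [|]]] pm;
  move: (perm_size pm); rewrite sz //= => _.
have := perm_uniq pm; rewrite us /= !inE !negb_or => /esym/and3P[/andP[n1 n2] n3 _].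
exists y2, y3; split=> //; split=> //; rewrite hs (perm_mem pm) !inE eqxx ?orbT //.
Qed.

Lemma rlinkP x y y2 y3 x' : rgood (x, y, y2, y3) ->
  rlink y x x' = (x' == opp x y y2) || (x' == opp x y y3).
Proof.
move=> g; have N := rgoodN g; move: g => [Xx [h1 h2 h3] [n1 n2 n3]].
have [k1 k2 k3 k4 k5] := oppP Xx h1 h2 n1; have [l1 l2 l3 l4 l5] := oppP Xx h1 h3 n2.
apply/idP/idP.
  case/and4P=> yx yx' xx' /existsP[z /and3P[zy zx zx']].
  have x'x : x' != x by sd.
  have : U x z by sd.
  rewrite N !inE (negPf zy) /= => /orP[] /eqP E; rewrite E in zx'.
    by rewrite (k5 x') ?eqxx.
  by rewrite (l5 x') ?eqxx ?orbT.
case/orP=> /eqP ->; apply/and4P; split; try sd; apply/existsP.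
  by exists y2; apply/and3P; split; sd.
by exists y3; apply/and3P; split; sd.
Qed.

(** If the two rhombi at [x] and [y] had the same far corner, it would have the same three
    neighbours as [x]. *)
Lemma opp_neq x y y2 y3 : rgood (x, y, y2, y3) -> opp x y y2 != opp x y y3.
Proof.
move=> [Xx [h1 h2 h3] [n1 n2 n3]].
have [k1 k2 k3 k4 k5] := oppP Xx h1 h2 n1; have [l1 l2 l3 l4 l5] := oppP Xx h1 h3 n2.
apply/eqP => E; rewrite -E in l3; move: k4; rewrite eq_sym => /eqP; apply.
by apply: (@ntw _ _ y y2 y3) => //; [sd|sd|sd|neqs].
Qed.

Lemma rlink_ex y x : ~~ X y -> [pred w | U y w] x -> exists a b, [/\ rlink y x a, rlink y x b & a != b].
Proof.
move=> nXy /= yx; have Xx : X x by rewrite (bip yx).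
have xy : U x y by sd.
have [y2 [y3 g]] := flag_ex Xx xy; exists (opp x y y2), (opp x y y3).
by rewrite !(rlinkP _ g) !eqxx orbT; split=> //; exact: opp_neq.
Qed.

Lemma rlink_two y x a b c : ~~ X y -> rlink y x a -> rlink y x b -> a != b -> rlink y x c ->
  c = a \/ c = b.
Proof.
move=> nXy xa; have yx := rlinkN xa; have Xx : X x by rewrite (bip yx).
have xy : U x y by rewrite Us.
have [y2 [y3 g]] := flag_ex Xx xy; move: xa; rewrite !(rlinkP _ g).
by do 2![case/orP => /eqP ->]; rewrite ?eqxx // => _; case/orP => /eqP ->; tauto.
Qed.

Lemma rturn x y p q : rgood (x, y, p, q) -> exists x' p',
  [/\ rb (ra (x, y, p, q)) = (x', y, p', p), rgood (x', y, p', p), rlink y x x' &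
      forall x'' p'', rb (ra (x', y, p', p)) = (x'', y, p'', p') -> x'' != x].
Proof.
move=> g; have [x' [z [e1 g1 n1 e2 un]]] := raP g; exists x', z; rewrite e1.
have [Xx [h1 h2 h3] [m1 m2 m3]] := g; have [Xx' [k1 k2 k3] [l1 l2 l3]] := g1.
have g2 : rgood (x', y, z, p) by split=> //; split=> //; sd.
split=> //; first (apply/and4P; split; try sd; apply/existsP; exists p; apply/and3P; split; sd).
move=> x'' p''; have [x2 [z2 [e3 g3 n3 e4 un3]]] := raP g2; rewrite e3 => -[<- _].
have [Xx2 [j1 j2 j3] _] := g3.
apply/eqP => E; rewrite E in j1 j2 j3; move: n1; rewrite eq_sym => /eqP; apply.
by apply: (@ntw _ _ y p z) => //; neqs.
Qed.

Lemma flag_eq x x' y p q p' q' : rgood (x, y, p, q) -> rgood (x, y, p', q') -> x != x' ->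
  U x' y -> U x' p -> U x' p' -> p' = p /\ q' = q.
Proof.
move=> g g' xx' x'y x'p x'p'; have N := rgoodN g.
have [Xx [h1 h2 h3] [m1 m2 m3]] := g; have [_ [k1 k2 k3] [l1 l2 l3]] := g'.
have E : p' = p.
  apply/eqP/negPn/negP => pp; case/eqP: xx'.
  by apply: (@ntw _ _ y p p') => //; neqs.
split=> //; move: k3; rewrite N !inE => /or3P[] /eqP // E'.
  by rewrite E' eqxx in l2.
by rewrite E' -E eqxx in l3.
Qed.

Let r_action p : 0 < p -> (forall x, rgood x -> actw ra rb rc (alt 0 1 p.*2) x = x) ->
  flag_action rgood ra rb rc p.
Proof.
move=> p0 hab; apply: flag_actionI => //.
- by move=> [[[x y1] y2] y3] g; have [x' [z [e1 g1 n1 e2 un]]] := raP g; rewrite e1.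
- by move=> [[[x y1] y2] y3] [h1 [h2 h3 h4] [n1 n2 n3]]; split=> //; split=> //; split=> //; sd.
- by move=> [[[x y1] y2] y3] [h1 [h2 h3 h4] [n1 n2 n3]]; split=> //; split=> //; split=> //; sd.
- by move=> [[[x y1] y2] y3].
- move=> [[[x y1] y2] y3] g; have [x' [z [e1 g1 n1 e2 un]]] := raP g.
  have [Xx [h1 h2 h3] [m1 m2 m3]] := g.
  have g' : rgood (x, y2, y1, y3) by split=> //; split=> //; sd.
  have [x2 [z2 [f1 g2 n2 f2 un2]]] := raP g'; rewrite -[rc (x, y1, y2, y3)]/(x, y2, y1, y3) f1.
  have [Xx2 [k1 k2 k3] [l1 l2 l3]] := g2.
  have E : x2 = x' by apply: un => //; sd.
  have [Xx1 [j1 j2 j3] [i1 i2 i3]] := g1.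
  have Ez : z2 = z.
    move: k3; rewrite E (rgoodN g1) !inE => /or3P[] /eqP // E'.
      by rewrite E' eqxx in l3.
    by rewrite E' eqxx in l2.
  by rewrite -[rc _]/(x2, y1, y2, z2) E Ez e2.
Qed.

Let proj (t : nat) (f : rflag) : V := let: (x, y1, _, _) := f in if t is 0 then x else y1.

Section Develop.
Variables (p : nat) (T : table) (tree cert : seq (nat * nat)) (s : seq point) (l : zphi)
  (q1 q2 : seq nat).
Hypothesis Tok : table_ok p T tree cert.
Hypothesis Pok : iso_ok T (size tree).+1 (size s) [:: q1; q2] [:: vstab; fstab p] (xrules p) (close s l).
Hypothesis p0 : 0 < p.
Hypothesis sV : 0 < size s <= #|V|.
Hypothesis rab : forall f, rgood f -> actw ra rb rc (alt 0 1 p.*2) f = f.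
Hypothesis rN : forall f w, rgood f -> U (proj 1 f) w -> exists2 n, n < p &
  w = proj 0 (actw ra rb rc (alt 1 0 n.*2) f).

Lemma rhombic_iso : graph_iso U (skeleton s l).
Proof.
have [x Xx] := X0; have [s3 [sz us hs]] := degree_enum (degX Xx).
case: s3 sz us hs => [|a s3] // _ us hs; have xa : U x a by rewrite hs inE eqxx.
have [b [c g0]] := flag_ex Xx xa.
have fa := r_action p0 rab; have [gd _ _] := fa.
have gdw w f : rgood f -> rgood (actw ra rb rc w f).
  by elim: w f => [|i w IH] f gf //=; apply/IH/gd.
have p1ab i f : rgood f -> i < 2 -> proj 1 (act ra rb rc i f) = proj 1 f.
  case: f => [[[x' y1] y2] y3]; case: i => [|[|]] //= g _.
have p1w w f : rgood f -> all (fun i => i < 2) w -> proj 1 (actw ra rb rc w f) = proj 1 f.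
  elim: w f => [|i w IH] f gf //= /andP[i2 h]; rewrite IH //; last exact: gd.
  exact: p1ab.
have alt2 i j n : i < 2 -> j < 2 -> all (fun i => i < 2) (alt i j n).
  by elim: n i j => [|n IH] i j hi hj //=; rewrite hi IH.
apply: (flag_iso (proj := proj) (x0 := (x, a, b, c)) Tok Pok fa) => //.
- case=> [|[|[]]] //= w [[[x' y1] y2] y3].
    by rewrite !inE => /or4P[| | |/or3P[]] /eqP ->.
  rewrite /fstab mem_cat => /orP[] /mapP[n _ ->] g; exact: p1w (alt2 _ _ _ _ _).
- move=> t w t' f; rewrite /xrules mem_cat => /orP[].
    case: f => [[[x' y1] y2] y3]; rewrite !inE => h [Xx' [h1 h2 h3] _].
    by case/or3P: h => /eqP[-> -> ->].
  case/mapP=> n _ [-> -> ->] g.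
  rewrite -(p1w (alt 1 0 n.*2) f) ?alt2 //.
  by have := gdw (alt 1 0 n.*2) f g; case: (actw _ _ _ _ _) => [[[x' y1] y2] y3] [_ [? _ _] _] /=; sd.
- case=> [|[|]] //= f w _ g.
    case: f g => [[[x' y1] y2] y3] g; rewrite /= (rgoodN g) !inE => /or3P[] /eqP ->.
    + by exists [::], 1; rewrite !inE.
    + by exists [:: 2], 1; rewrite !inE.
    + by exists [:: 1; 2], 1; rewrite !inE.
  move=> /(rN g)[n np ->]; exists (alt 1 0 n.*2), 0; split=> //.
  by rewrite /xrules mem_cat; apply/orP; right; apply/mapP; exists n; rewrite ?mem_iota.
Qed.
End Develop.

Lemma rhombic_dodecahedron_case : d = 4 -> 14 <= #|V| -> graph_iso U rhombic_dodecahedron.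
Proof.
move=> d4 V14; have tour f : rgood f -> let t := fun f => rb (ra f) in
    t (t (t (t f))) = f /\ forall w, U (proj 1 f) w ->
     w \in [:: proj 0 f; proj 0 (t f); proj 0 (t (t f)); proj 0 (t (t (t f)))].
  case: f => [[[x0 y] p0] q0] g0 t.
  have [x1 [p1 [e1 g1 l1 n1]]] := rturn g0; have [x2 [p2 [e2 g2 l2 n2]]] := rturn g1.
  have [x3 [p3 [e3 g3 l3 n3]]] := rturn g2; have [x4 [p4 [e4 g4 l4 n4]]] := rturn g3.
  (* One turn beyond the cycle: [x5 = x1] shows that the returning flag goes on like the first one,
     and [flag_eq] then identifies the two. *)
  have [x5 [p5 [e5 g5 l5 _]]] := rturn g4.
  have nXy : ~~ X y by case: g0 => Xx [/bip -> _ _] _; rewrite Xx.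
  have c4 : #|[pred w | U y w]| = 4 by rewrite -d4; exact: degY.
  have [E4 E5 N] := two_regular4 (@rlink_sym y) (@rlink_irr y) (@rlinkN y)
    (fun x => @rlink_ex y x nXy) (fun x a b c => @rlink_two y x a b c nXy) c4 l1 l2 l3 l4 l5
    (n1 _ _ e2) (n2 _ _ e3) (n3 _ _ e4) (n4 _ _ e5).
  rewrite /t e1 e2 e3 e4; split; last first.
    by move=> w yw; rewrite /= -N.
  rewrite E4 in g4 *; rewrite E5 in g5.
  have [Xx1 [k1 k2 k3] _] := g1; have [_ [j1 j2 j3] _] := g5.
  have x01 : x0 != x1 by case/and4P: l1.
  by have [-> ->] := flag_eq g0 g4 x01 k1 k3 j3.
apply: (rhombic_iso tab4_ok rhombic_dodecahedron_ok) => //.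
- by move=> f g; have [h _] := tour f g.
- move=> f w g fw; have g' : rgood (rb f).
    by case: f g {fw} => [[[x y] p] q] [h1 [h2 h3 h4] [n1 n2 n3]]; split=> //; split=> //; sd.
  have [_ N] := tour (rb f) g'.
  have p1 : proj 1 (rb f) = proj 1 f by case: f {fw g g' N} => [[[x y] p] q].
  have p0 h : proj 0 (rb h) = proj 0 h by case: h => [[[x y] p] q].
  move: (N w); rewrite p1 => /(_ fw); rewrite !inE !p0 => /or4P[] /eqP ->.
  + by exists 0.
  + by exists 1.
  + by exists 2.
  + by exists 3.
Qed.

Lemma rhombic_triacontahedron_case : d = 5 -> 32 <= #|V| -> graph_iso U rhombic_triacontahedron.
Proof.
move=> d5 V32; have tour f : rgood f -> let t := fun f => rb (ra f) in
    t (t (t (t (t f)))) = f /\ forall w, U (proj 1 f) w ->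
     w \in [:: proj 0 f; proj 0 (t f); proj 0 (t (t f)); proj 0 (t (t (t f))); proj 0 (t (t (t (t f))))].
  case: f => [[[x0 y] p0] q0] g0 t.
  have [x1 [p1 [e1 g1 l1 n1]]] := rturn g0; have [x2 [p2 [e2 g2 l2 n2]]] := rturn g1.
  have [x3 [p3 [e3 g3 l3 n3]]] := rturn g2; have [x4 [p4 [e4 g4 l4 n4]]] := rturn g3.
  have [x5 [p5 [e5 g5 l5 n5]]] := rturn g4; have [x6 [p6 [e6 g6 l6 _]]] := rturn g5.
  have nXy : ~~ X y by case: g0 => Xx [/bip -> _ _] _; rewrite Xx.
  have c5 : #|[pred w | U y w]| = 5 by rewrite -d5; exact: degY.
  have [E5 E6 N] := two_regular5 (@rlink_sym y) (@rlink_irr y) (@rlinkN y)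
    (fun x => @rlink_ex y x nXy) (fun x a b c => @rlink_two y x a b c nXy) c5 l1 l2 l3 l4 l5 l6
    (n1 _ _ e2) (n2 _ _ e3) (n3 _ _ e4) (n4 _ _ e5) (n5 _ _ e6).
  rewrite /t e1 e2 e3 e4 e5; split; last first.
    by move=> w yw; rewrite /= -N.
  rewrite E5 in g5 *; rewrite E6 in g6.
  have [Xx1 [k1 k2 k3] _] := g1; have [_ [j1 j2 j3] _] := g6.
  have x01 : x0 != x1 by case/and4P: l1.
  by have [-> ->] := flag_eq g0 g5 x01 k1 k3 j3.
apply: (rhombic_iso tab5_ok rhombic_triacontahedron_ok) => //.
- by move=> f g; have [h _] := tour f g.
- move=> f w g fw; have g' : rgood (rb f).
    by case: f g {fw} => [[[x y] p] q] [h1 [h2 h3 h4] [n1 n2 n3]]; split=> //; split=> //; sd.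
  have [_ N] := tour (rb f) g'.
  have p1 : proj 1 (rb f) = proj 1 f by case: f {fw g g' N} => [[[x y] p] q].
  have p0 h : proj 0 (rb h) = proj 0 h by case: h => [[[x y] p] q].
  move: (N w); rewrite p1 => /(_ fw); rewrite !inE !p0 => /or4P[| | |/orP[]] /eqP ->.
  + by exists 0.
  + by exists 1.
  + by exists 2.
  + by exists 3.
  + by exists 4.
Qed.
End Rhombic.

(** * Minors of lattice models and the exclusion of twins *)

Lemma step_sym : symmetric step.
Proof.
move=> x y; rewrite /step /adj4 (eq_sym y x); congr (_ || _).
by rewrite orbA (orbC (y == rgt x)) -orbA; congr [|| _, _ | _]; rewrite orbC.
Qed.

Section Minor.
Variables (V : finType) (U : rel V) (W : finType) (U' : rel W) (pi : V -> W) (rep : W -> V).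
Hypothesis Us : symmetric U.
Hypothesis Ui : irreflexive U.
Hypothesis gm : gridmodel (@esrc V U) (@etgt V U).
Hypothesis fiber : forall v,
  connect (fun a b => [&& U a b, pi a == pi v & pi b == pi v]) (rep (pi v)) v.
Hypothesis lift_edge : forall w w', U' w w' -> exists u u', [/\ pi u = w, pi u' = w' & U u u'].

(** Contracting connected fibres merely merges labels. The walk of an edge runs inside the fibre of
    its source to a lifted edge, crosses along that edge, and runs on inside the fibre of its
    target. *)
Lemma gridmodel_minor : gridmodel (@esrc W U') (@etgt W U').
Proof.
case: gm => N [base [mu [W1 [W2 [box walks]]]]].
pose lw w x y := exists L, [/\ path step x L, last x L = y &
  {in x :: L, forall z, omap pi (mu z) = Some w}].
have hop u u' : U u u' -> exists A B, [/\ path step (base u) (A ++ B),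
    last (base u) (A ++ B) = base u', {in base u :: A, forall x, mu x = Some u},
    {in B, forall x, mu x = Some u'} & B != [::]].
  move=> uu'; have [e [[h1 h2]|[h1 h2]]] := edge_exists Us Ui uu'.
    by have := walks e; rewrite h1 h2 => -[*]; exists (W1 e), (W2 e).
  have := walks e; rewrite h1 h2; case: (W2 e) => [|y B] [pth lst l1 l2] // _.
  exists (rev (belast y B)), (rev (base u' :: W1 e)).
  have E : rev (belast y B) ++ rev (base u' :: W1 e) = rev (belast (base u') (W1 e ++ y :: B)).
    by rewrite -rev_cat belast_cat lastI -cats1 -catA.
  split.
  - rewrite E -lst rev_path -(eq_path (e := step)) // => a b; exact: step_sym.
  - by rewrite last_cat rev_cons last_rcons.
  - move=> x xin; apply: l2; rewrite lastI.
    by move: lst xin; rewrite last_cat /= => ->; rewrite mem_rcons !inE mem_rev.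
  - by move=> x; rewrite mem_rev; exact: l1.
  - by rewrite rev_cons; case: rev.
have lw_trans w x y z : lw w x y -> lw w y z -> lw w x z.
  move=> [L [p1 e1 l1]] [M [p2 e2 l2]]; exists (L ++ M); split.
  - by rewrite cat_path p1 e1.
  - by rewrite last_cat e1.
  - move=> t; rewrite inE mem_cat orbA => /orP[h|h]; first by apply: l1; rewrite inE.
    by apply: l2; rewrite inE h orbT.
have lw_sym w x y : lw w x y -> lw w y x.
  move=> [L [p1 e1 l1]]; exists (rev (belast x L)); split.
  - by rewrite -e1 rev_path -(eq_path (e := step)) // => a b; exact: step_sym.
  - by case: L {p1 l1} e1 => [|a L] //= _; rewrite rev_cons last_rcons.
  - by move=> t tin; apply: l1; rewrite lastI e1 mem_rcons inE -mem_rev.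
(* Labels are known only along walks, so the base of an isolated vertex may lack its label. *)
have base_mu v : mu (base v) = Some v \/ (forall u, ~~ U v u).
  have [/existsP[u vu]|] := boolP [exists u, U v u].
    by left; have [A [B [_ _ h _ _]]] := hop _ _ vu; apply: h; rewrite inE eqxx.
  by rewrite negb_exists => /forallP h; right.
have lw_path w r p : path (fun a b => [&& U a b, pi a == w & pi b == w]) r p -> p != [::] ->
    lw w (base r) (base (last r p)).
  elim: p r => [|a p IH] r //= /andP[/and3P[ra /eqP pr /eqP pa] pth] _.
  have st : lw w (base r) (base a).
    have [A [B [p1 e1 l1 l2 _]]] := hop _ _ ra; exists (A ++ B); split=> // t.
    rewrite inE mem_cat orbA => /orP[h|h]; first by rewrite l1 ?inE //= pr.
    by rewrite l2 //= pa.
  by case: p pth IH => [|b p] // pth IH; apply: lw_trans st (IH a pth isT).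
have lw_fib v : lw (pi v) (base (rep (pi v))) (base v) \/ rep (pi v) = v.
  have /connectP[p pth E] := fiber v; have [p0|p0] := eqVneq p [::].
    by right; move: E; rewrite p0 /= => <-.
  by left; have := lw_path _ _ _ pth p0; rewrite -E.
have lwU u u' : U u u' -> lw (pi u) (base (rep (pi u))) (base u).
  move=> uu'; case: (lw_fib u) => // E; exists [::]; split=> //; first by rewrite /= E.
  move=> t; rewrite inE => /eqP ->; rewrite E; case: (base_mu u) => [->//|/(_ u')].
  by rewrite uu'.
have walk' (e : edge U') : exists P : seq pt * seq pt, let B := fun w => base (rep w) in
    [/\ path step (B (esrc e)) (P.1 ++ P.2), last (B (esrc e)) (P.1 ++ P.2) = B (etgt e),
    {in B (esrc e) :: P.1, forall x, omap pi (mu x) = Some (esrc e)},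
    {in P.2, forall x, omap pi (mu x) = Some (etgt e)} & P.2 != [::]].
  have [u [u' [p1 p2 uu']]] := lift_edge (edgeU e); have u'u : U u' u by sd.
  have [L [q1 q2 q3]] := lwU _ _ uu'; rewrite p1 in q1 q2 q3.
  have [M [s1 s2 s3]] := lw_sym _ _ _ (lwU _ _ u'u); rewrite p2 in s2 s3.
  have [A [B [t1 t2 t3 t4 t5]]] := hop _ _ uu'.
  move: t1 t2; rewrite cat_path last_cat => /andP[tA tB] lB.
  exists (L ++ A, B ++ M) => /=; split.
  - by rewrite !cat_path !last_cat q1 q2 tA tB lB.
  - by rewrite !last_cat q2 lB.
  - move=> x; rewrite inE mem_cat orbA => /orP[h|h]; first by apply: q3; rewrite inE.
    by rewrite t3 ?inE ?h ?orbT //= p1.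
  - move=> x; rewrite mem_cat => /orP[h|h]; first by rewrite t4 //= p2.
    by apply: s3; rewrite inE h orbT.
  - by case: B t5 {t4 tB lB}.
have [P PP] := fin_all_exists walk'.
exists N, (fun w => base (rep w)), (fun x => omap pi (mu x)), (fun e => (P e).1), (fun e => (P e).2).
split=> [x w|e]; last exact: PP.
by case E : (mu x) => [v|] //= _; apply: box E.
Qed.
End Minor.

Definition K33 : rel (bool * option bool) := fun p q => p.1 != q.1.

(** Six vertices and nine edges without triangles violate [euler4], as 9 + 4 exceeds 2 * 6. *)
Lemma K33_nongrid : gridmodel (@esrc _ K33) (@etgt _ K33) -> False.
Proof.
move=> gm; have Ks : symmetric K33 by move=> p q; rewrite /K33 eq_sym.
have Ki : irreflexive K33 by move=> p; rewrite /K33 eqxx.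
have dK p : degree K33 p = 3.
  rewrite /degree (eq_card (B := [predX pred1 (~~ p.1) & predT])).
    by rewrite cardX card1 card_option card_bool.
  by move=> q; rewrite !inE /K33 andbT; case: p.1; case: q.1.
have c6 : #|{: bool * option bool}| = 6 by rewrite card_prod card_option card_bool.
have := sum_degree Ks Ki dK; rewrite c6 => ne.
have n3 : noC3 K33 by move=> [[] ?] [[] ?] [[] ?].
have V0 : 0 < #|{: bool * option bool}| by rewrite c6.
have VE : #|{: bool * option bool}| < #|edge K33| by rewrite c6; lia.
by have := euler4 Ks Ki gm V0 VE n3; rewrite c6; lia.
Qed.

Section Twins.
Variables (V : finType) (U : rel V) (X : pred V).
Hypothesis Us : symmetric U.
Hypothesis Ui : irreflexive U.
Hypothesis conn : forall v w, connect U v w.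
Hypothesis gm : gridmodel (@esrc V U) (@etgt V U).
Hypothesis bip : forall v w, U v w -> X w = ~~ X v.
Hypothesis degX : forall v, X v -> degree U v = 3.
Hypothesis degY : forall v, ~~ X v -> degree U v = 4.
Hypothesis X0 : exists x, X x.
Hypothesis two : forall x y y', X x -> U x y -> U x y' -> y != y' -> walks2 U y y' = 2.
Hypothesis tau : forall x a, X x -> U x a ->
  #|[pred x' | [&& U a x', x' != x & walks2 U x x' == 3]]| = 1.

Let tw x := odflt x [pick x' | (x' != x) && (walks2 U x x' == 3)].

Let nbr x : X x -> exists a, U x a.
Proof.
move=> Xx; have [s [sz us hs]] := degree_enum (degX Xx).
by case: s sz us hs => [|a s] // _ us hs; exists a; rewrite hs inE eqxx.
Qed.

Let same x x' : X x -> walks2 U x x' = 3 -> forall w, U x w = U x' w.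
Proof.
move=> Xx; rewrite walks2E => c3.
have sb : [pred u | U x u && U u x'] \subset [pred u | U x u].
  by apply/subsetP => v; rewrite !inE => /andP[].
have /subset_cardP /(_ sb) E : #|[pred u | U x u && U u x']| = #|[pred u | U x u]|.
  by rewrite c3 -/(degree U x) degX.
have sub w : U x w -> U x' w.
  by move=> xw; have := E w; rewrite !inE xw Us => /andP[].
have [a xa] := nbr Xx; have x'a := sub a xa; have ax' : U a x' by rewrite Us.
have Xx' : X x' by rewrite (bip ax') (bip xa) Xx.
have sb' : [pred u | U x u] \subset [pred u | U x' u] by apply/subsetP => w; exact: sub.
have /subset_cardP /(_ sb') E' : #|[pred u | U x u]| = #|[pred u | U x' u]|.
  by rewrite -/(degree U x) -/(degree U x') !degX.
by move=> w; have := E' w; rewrite !inE.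
Qed.

Let twP x : X x -> [/\ tw x != x, walks2 U x (tw x) = 3 &
  forall x', x' != x -> walks2 U x x' = 3 -> x' = tw x].
Proof.
move=> Xx; have [a xa] := nbr Xx; have := tau Xx xa => /mem_card1[x0 x0P].
have P x' : x' != x -> walks2 U x x' = 3 -> x' = x0.
  move=> h1 h2; have := x0P x'; rewrite !inE h1 h2 eqxx Us -(same Xx h2) xa /=.
  by move/esym/eqP.
have := x0P x0; rewrite !inE eqxx => /and3P[h1 h2 /eqP h3].
have E : tw x = x0.
  rewrite /tw; case: pickP => [y /andP[y1 /eqP y2]|/(_ x0)]; first exact: P.
  by rewrite h2 h3.
by rewrite E.
Qed.

Let twX x : X x -> X (tw x).
Proof.
move=> Xx; have [_ h _] := twP Xx; have [a xa] := nbr Xx.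
have : U a (tw x) by rewrite Us -(same Xx h).
by move/bip ->; rewrite (bip xa) Xx.
Qed.

Let twN x w : X x -> U (tw x) w = U x w.
Proof. by move=> Xx; have [_ h _] := twP Xx; rewrite (same Xx h). Qed.

Let twK x : X x -> tw (tw x) = x.
Proof.
move=> Xx; have [h1 h2 _] := twP Xx; have [_ _ h] := twP (twX Xx).
by rewrite -(h x) //; [sd|rewrite walks2C].
Qed.

Let tw_eq x y : X x -> X y -> (tw x == y) = (x == tw y).
Proof. by move=> Xx Xy; apply/eqP/eqP => [<-|->]; rewrite twK. Qed.

Let nb4 a x v : X x -> X v -> U x a -> U v a -> v != x -> v != tw x ->
  forall w, U a w = (w \in [:: x; tw x; v; tw v]).
Proof.
move=> Xx Xv xa va vx vt.
have [t1 _ _] := twP Xx; have [t2 _ _] := twP Xv.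
have nXa : ~~ X a by rewrite (bip xa) Xx.
apply: degree_span; rewrite ?degY //=; last by rewrite !(Us a) !twN // xa va.
have n1 : tw v != x by rewrite tw_eq.
have n2 : tw x != tw v by apply/eqP => E; case/eqP: vx; rewrite -(twK Xv) -E twK.
by neqs.
Qed.

(** The neighbours [a] and [b] of [x] have just two common neighbours, and these are [x] and its
    twin. *)
Let one x p a b : X x -> X p -> p != x -> p != tw x -> U x a -> U x b -> a != b ->
  U p a -> U p b -> False.
Proof.
move=> Xx Xp px pt xa xb ab pa pb.
have := two Xx xa xb ab; rewrite walks2E => c2.
have [|z zx zP] := card2P c2 (v := x); first by rewrite /= Us xa.
have [t1 _ _] := twP Xx.
have := zP (tw x); rewrite /= (negPf t1) Us !twN // xa xb /= => /esym/eqP E.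
by have := zP p; rewrite /= (Us a) pa pb (negPf px) -E (negPf pt).
Qed.

Let D x v := [|| v == x, v == tw x | U x v].
Let Rx x : rel V := fun p q => [&& U p q, ~~ D x p & ~~ D x q].

Let XD x v : X x -> X v -> D x v = (v == x) || (v == tw x).
Proof.
move=> Xx Xv; rewrite /D; case h : (U x v); rewrite ?orbF //.
by have := bip h; rewrite Xx Xv.
Qed.

(* The class {x, tw x} whose removal leaves the largest component of r0 leaves
   a connected graph; contracting it produces K33 with parts {x, tw x, rest}
   and the neighbourhood of x. *)
Lemma no_twins : False.
Proof.
have [r0 X0'] := X0.
pose C x := [pred v | connect (Rx x) r0 v].
pose P x := [&& X x, x != r0 & x != tw r0].
have [a0 ra0] := nbr X0'.
have nXa0 : ~~ X a0 by rewrite (bip ra0) X0'.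
have other a x : ~~ X a -> X x -> exists z, [/\ U a z, X z, z != x & z != tw x].
  move=> nXa Xx; have [s [sz us hs]] := degree_enum (degY nXa).
  have [h|/allPn[c cs]] := boolP (all (mem [:: x; tw x]) s).
    by have := uniq_leq_size us (allP h); rewrite sz.
  rewrite !inE negb_or => /andP[h1 h2]; exists c; rewrite hs cs.
  by rewrite (bip (_ : U a c)) // hs.
have [i0 Pi0] : exists i, P i.
  by have [z [_ Xz z1 z2]] := other a0 r0 nXa0 X0'; exists z; rewrite /P Xz z1 z2.
case: (arg_maxnP (fun i => #|C i|) Pi0) => x /and3P[Xx xr xtr] xmax.
have tr : tw x != r0 by rewrite tw_eq.
have Dr : ~~ D x r0 by rewrite XD // negb_or eq_sym xr eq_sym tr.
have Cstep y p q : C y p -> ~~ D y p -> U p q -> ~~ D y q -> C y q.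
  rewrite !inE => cp np pq nq; apply: connect_trans cp (connect1 _).
  by rewrite /Rx pq np nq.
have CD p : C x p -> ~~ D x p.
  rewrite inE => /connectP[s]; case/lastP: s => [|s z] /=; first by move=> _ ->.
  by rewrite last_rcons rcons_path => /andP[_ /and3P[_ _ h]] ->.
have Cr : C x r0 by rewrite inE connect0.
(* By [one], [p] shares at most one neighbour with [x]; any other neighbour of [p] survives the
   deletion and joins [p] to its twin. *)
have Ctw p : X p -> C x p -> C x (tw p).
  move=> Xp cp; have np := CD p cp; move: (np); rewrite XD // negb_or => /andP[p1 p2].
  have [s [sz us hs]] := degree_enum (degX Xp).
  have [y [py nxy]] : exists y, U p y /\ ~~ U x y.
    case: s sz us hs => [|y1 [|y2 s]] // _ us hs.
    have n12 : y1 != y2 by move: us; rewrite /= inE negb_or => /andP[/andP[]].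
    have [h1 h2] : U p y1 /\ U p y2 by rewrite !hs !inE !eqxx orbT.
    have [x1|x1] := boolP (U x y1); last by exists y1.
    exists y2; split=> //; apply/negP => x2.
    exact: (one Xx Xp p1 p2 x1 x2 n12 h1 h2).
  have nXy : ~~ X y by rewrite (bip py) Xp.
  have Dy : ~~ D x y.
    rewrite /D !negb_or nxy andbT; apply/andP.
    by split; apply: contraNneq nXy => -> //; exact: twX.
  have cy := Cstep _ _ _ cp np py Dy.
  apply: (Cstep _ y) => //; first by rewrite Us twN.
  rewrite XD ?twX // negb_or !tw_eq ?twX // twK // p2 //=.
(* If some [v] were missed, deleting its class instead would leave the whole component of [r0] and,
   through a neighbour [q] of [x], the vertex [x] as well, against the maximal choice of [x]. *)
have CX v : X v -> ~~ D x v -> C x v.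
  move=> Xv nDv; apply/negPn/negP => nC.
  move: (nDv); rewrite XD // negb_or => /andP[vx vtx].
  have Pv : P v.
    rewrite /P Xv /=; apply/andP; split; apply: contraNneq nC => ->; first exact: Cr.
    exact: Ctw.
  have nCt : ~~ C x (tw v).
    by apply: contra nC => /(Ctw _ (twX Xv)); rewrite twK.
  have CDv p : C x p -> ~~ D v p.
    move=> cp; rewrite /D !negb_or; apply/and3P; split.
    - by apply: contraNneq nC => <-.
    - by apply: contraNneq nCt => <-.
    - apply: contra nC => vp; apply: (Cstep _ p) => //; [exact: CD|sd].
  have sub p : C x p -> C v p.
    have Cv y' s' : C x y' -> path (Rx x) y' s' -> connect (Rx v) y' (last y' s').
      elim: s' y' => [|z s' IH] y' cy' /=; first by rewrite connect0.
      case/andP=> /and3P[yz ny nz] pth'; have cz := Cstep _ _ _ cy' ny yz nz.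
      apply: connect_trans (IH z cz pth'); apply: connect1.
      by rewrite /Rx yz !CDv.
    by move=> /connectP[t pth ->]; apply: Cv.
  have nCx : ~~ C x x by apply/negP => /CD; rewrite /D eqxx.
  have [p [q [cp ncq pq]]] : exists p q, [/\ C x p, ~~ C x q & U p q].
    have go t y : C x y -> path U y t -> ~~ C x (last y t) ->
        exists p q, [/\ C x p, ~~ C x q & U p q].
      elim: t y => [|z t IH] y cy; first by move=> _ /negP[].
      case/andP=> yz pth; have [cz|ncz] := boolP (C x z); first exact: IH.
      by exists y, z.
    have /connectP[t pth E] := conn r0 x; apply: (go t r0) => //.
    by rewrite -E.
  have nDp := CD p cp.
  have xq : U x q.
    have Dq : D x q by apply: contraR ncq => nq; exact: (Cstep _ p).
    case/or3P: Dq => [/eqP E|/eqP E|//]; rewrite E Us ?twN // in pq; case/negP: nDp;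
      by rewrite /D pq !orbT.
  have nXq : ~~ X q by rewrite (bip xq) Xx.
  have nvq : ~~ U v q.
    (* Otherwise the four neighbours of [q] are [x], [v] and their twins, and [p] has no place among
       them. *)
    apply/negP => vq; have := nb4 Xx Xv xq vq vx vtx p.
    rewrite Us pq !inE => /esym/or4P[] /eqP E.
    - by case/negP: nDp; rewrite /D E eqxx.
    - by case/negP: nDp; rewrite /D E eqxx orbT.
    - by case/negP: nC; rewrite -E.
    - by case/negP: nCt; rewrite -E.
  have Dvq : ~~ D v q.
    rewrite /D !negb_or nvq andbT; apply/andP.
    by split; apply: contraNneq nXq => -> //; exact: twX.
  have Dvx : ~~ D v x by rewrite XD // negb_or eq_sym vx -tw_eq // eq_sym vtx.
  have qx : U q x by sd.
  have cvq := Cstep v p q (sub p cp) (CDv p cp) pq Dvq.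
  have cvx := Cstep v q x cvq Dvq qx Dvx.
  have := xmax v Pv; rewrite /geq /= leqNgt => /negP; apply; apply: proper_card.
  by apply/properP; split; [apply/subsetP => t; exact: sub | exists x].
have CA v : ~~ D x v -> C x v.
  move=> nDv; have [Xv|nXv] := boolP (X v); first exact: CX.
  have [z [vz Xz z1 z2]] := other v x nXv Xx.
  have nDz : ~~ D x z by rewrite XD // negb_or z1.
  by apply: (Cstep _ z) => //; [exact: CX|sd].
have [s [sz us hs]] := degree_enum (degX Xx).
case: s sz us hs => [|a [|b [|c []]]] // _ us hs.
have [xa xb xc] : [/\ U x a, U x b & U x c] by rewrite !hs !inE !eqxx !orbT.
have Xt := twX Xx; have [txx _ _] := twP Xx.
have nX y : U x y -> [/\ ~~ X y, y != x & y != tw x].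
  move=> xy; have h : ~~ X y by rewrite (bip xy) Xx.
  by split=> //; apply: contraNneq h => ->.
have [na xa1 xa2] := nX a xa; have [nb xb1 xb2] := nX b xb; have [nc xc1 xc2] := nX c xc.
move: us; rewrite /= !inE !negb_or => /and3P[/andP[ab ac] bc _].
pose pi v : bool * option bool := if v == x then (false, None) else
  if v == tw x then (false, Some true) else if v == a then (true, None) else
  if v == b then (true, Some true) else if v == c then (true, Some false) else (false, Some false).
pose rep (w : bool * option bool) : V := match w with
  | (false, None) => x | (false, Some true) => tw x | (false, Some false) => r0
  | (true, None) => a | (true, Some true) => b | (true, Some false) => c end.
have piD v : ~~ D x v -> pi v = (false, Some false).
  rewrite /D hs !inE !negb_or => /and5P[h1 h2 h3 h4 h5].
  by rewrite /pi (negPf h1) (negPf h2) (negPf h3) (negPf h4) (negPf h5).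
have rep_pi w : pi (rep w) = w.
  case: w => -[] [[]|] /=.
  - by rewrite /pi (negPf xb1) (negPf xb2) eq_sym (negPf ab) eqxx.
  - by rewrite /pi (negPf xc1) (negPf xc2) eq_sym (negPf ac) eq_sym (negPf bc) eqxx.
  - by rewrite /pi (negPf xa1) (negPf xa2) eqxx.
  - by rewrite /pi (negPf txx) eqxx.
  - by rewrite piD.
  - by rewrite /pi eqxx.
have fib v : connect (fun p q => [&& U p q, pi p == pi v & pi q == pi v]) (rep (pi v)) v.
  have [Dv|nDv] := boolP (D x v); last first.
    rewrite (piD v nDv) /=; apply: (connect_sub (e := Rx x)); last exact: CA.
    by move=> p q /and3P[h1 h2 h3]; apply: connect1; rewrite /= h1 !piD ?eqxx.
  suff -> : rep (pi v) = v by exact: connect0.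
  case/or3P: Dv => [/eqP ->|/eqP ->|].
  - by rewrite /pi eqxx.
  - by rewrite /pi (negPf txx) eqxx.
  - rewrite hs !inE => /or3P[] /eqP ->; rewrite /pi.
    + by rewrite (negPf xa1) (negPf xa2) eqxx.
    + by rewrite (negPf xb1) (negPf xb2) eq_sym (negPf ab) eqxx.
    + by rewrite (negPf xc1) (negPf xc2) eq_sym (negPf ac) eq_sym (negPf bc) eqxx.
have lift1 o o' : exists u u', [/\ pi u = (false, o), pi u' = (true, o') & U u u'].
  have xo : U x (rep (true, o')) by case: o' => [[]|].
  case: o => [[]|].
  - exists (tw x), (rep (true, o')); rewrite rep_pi twN //; split=> //.
    exact: (rep_pi (false, Some true)).
  - have [nXo _ _] := nX _ xo; have [z [oz Xz z1 z2]] := other _ x nXo Xx.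
    exists z, (rep (true, o')); rewrite rep_pi piD ?XD // ?negb_or ?z1 //; split=> //; sd.
  - exists x, (rep (true, o')); rewrite rep_pi; split=> //; exact: (rep_pi (false, None)).
have lift w w' : K33 w w' -> exists u u', [/\ pi u = w, pi u' = w' & U u u'].
  case: w w' => [b1 o] [b2 o']; rewrite /K33 [_ != _]/(b1 != b2).
  case: b1 b2 => [] [] // _.
  by have [u [u' [h1 h2 h3]]] := lift1 o' o; exists u', u; split=> //; sd.
exact: K33_nongrid (gridmodel_minor Us Ui gm fib lift).
Qed.
End Twins.

Section BipartiteMain.
Variables (V : finType) (U : rel V) (X : pred V) (d : nat).
Hypothesis Us : symmetric U.
Hypothesis Ui : irreflexive U.
Hypothesis conn : forall v w, connect U v w.
Hypothesis V0 : 0 < #|V|.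
Hypothesis gm : gridmodel (@esrc V U) (@etgt V U).
Hypothesis bip : forall v w, U v w -> X w = ~~ X v.
Hypothesis degX : forall v, X v -> degree U v = 3.
Hypothesis degY : forall v, ~~ X v -> degree U v = d.
Hypothesis d3 : 3 <= d <= 5.
Hypothesis hk_ex : exists k, forall x y y', X x -> U x y -> U x y' -> y != y' -> walks2 U y y' = k.
Hypothesis hk'_ex : d = 3 ->
  exists k, forall x y y', ~~ X x -> U x y -> U x y' -> y != y' -> walks2 U y y' = k.
Hypothesis htau_ex : exists t, forall x a, X x -> U x a ->
  #|[pred x' | [&& U a x', x' != x & walks2 U x x' == 3]]| = t.

Lemma bipartite_main : graph_iso U cube \/ graph_iso U rhombic_dodecahedron \/
  graph_iso U rhombic_triacontahedron.
Proof.
case: hk_ex => k hk; have k2 := bip_k Us Ui conn V0 gm bip degX degY d3 hk; rewrite {}k2 in hk.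
have [c8 [c14 c32]] := bip_card Us Ui V0 gm bip degX degY d3.
have : d = 3 \/ d = 4 \/ d = 5 by move: d3; lia.
case=> [E|dE].
  (* Both parts have degree 3 now, so [bip_k] applies again with the parts exchanged. *)
  left; case: (hk'_ex E) => k' hk'.
  have bip' v w : U v w -> predC X w = ~~ predC X v by move/bip => /= ->; case: (X v).
  have degX' v : predC X v -> degree U v = 3 by move=> /degY ->.
  have degY' v : ~~ predC X v -> degree U v = 3 by rewrite negbK => /degX.
  have k2' := bip_k Us Ui conn V0 gm bip' degX' degY' isT hk'; rewrite {}k2' in hk'.
  have U3 v : degree U v = 3 by have [/degX|/degX'] := boolP (X v).
  apply: (cubic_cube Us Ui U3 conn V0 gm (bip_noC3 bip)).
  by move=> v a b; have [Xv|Xv] := boolP (X v); [exact: hk|exact: hk'].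
right.
have X0 : exists x, X x.
  have /card_gt0P[v _] := V0; have [Xv|nXv] := boolP (X v); first by exists v.
  have [s [sz us hs]] := degree_enum (degY nXv).
  case: s sz us hs => [|a s] /=; first by move: d3; lia.
  by move=> _ _ hs; exists a; rewrite (bip (_ : U v a)) // hs inE eqxx.
have sub x x' : X x -> walks2 U x x' = 3 -> forall w, U x w -> U x' w.
  move=> Xx; rewrite walks2E => c3 w xw.
  have sb : [pred u | U x u && U u x'] \subset [pred u | U x u].
    by apply/subsetP => v; rewrite !inE => /andP[].
  have /subset_cardP /(_ sb) E : #|[pred u | U x u && U u x']| = #|[pred u | U x u]|.
    by rewrite c3 -/(degree U x) degX.
  by have := E w; rewrite !inE xw Us => /andP[].
case: htau_ex => t htau.
have [x Xx] := X0; have [s [sz us hs]] := degree_enum (degX Xx).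
case: s sz us hs => [|a [|b s]] // _ us hs.
have [xa xb] : U x a /\ U x b by rewrite !hs !inE !eqxx orbT.
have ab : a != b by move: us; rewrite /= inE negb_or => /andP[/andP[]].
have nXa : ~~ X a by rewrite (bip xa) Xx.
(* A twin of [x] is a common neighbour of [a] and [b] other than [x], and there is only one such
   vertex. *)
have t1 : t <= 1.
  rewrite -(htau x a Xx xa); apply/card_le1_eqP => p q.
  rewrite !inE => /and3P[ap px /eqP p3] /and3P[aq qx /eqP q3].
  have := hk x a b Xx xa xb ab; rewrite walks2E => c2.
  have [|z zx zP] := card2P c2 (v := x); first by rewrite /= Us xa.
  have := zP p; rewrite /= ap (sub x p) // (negPf px) /= => /esym/eqP ->.
  by have := zP q; rewrite /= aq (sub x q) // (negPf qx) /= => /esym/eqP ->.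
case: t htau t1 => [|[|]] // htau _.
  have ntw p p' a' b' c' : U p a' -> U p b' -> U p c' -> U p' a' -> U p' b' -> U p' c' ->
      X p -> uniq [:: a'; b'; c'] -> p = p'.
    move=> h1 h2 h3 k1 k2 k3 Xp un; apply/eqP/negPn/negP => pp.
    have := card0_eq (htau p a' Xp h1) p'; rewrite !inE Us k1 eq_sym pp /=.
    suff -> : walks2 U p p' = 3 by [].
    apply/eqP; rewrite walks2E eqn_leq; apply/andP; split.
      by rewrite -(degX Xp); apply: subset_leq_card; apply/subsetP => u; rewrite !inE => /andP[].
    rewrite -[3]/(size [:: a'; b'; c']) -(card_uniqP un); apply: subset_leq_card.
    apply/subsetP => u; rewrite !inE => /or3P[] /eqP ->.
    - by rewrite h1 Us k1.
    - by rewrite h2 Us k2.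
    - by rewrite h3 Us k3.
  case: dE => E; [left|right].
    by apply: (rhombic_dodecahedron_case Us conn bip degX degY) => //; exact: c14.
  by apply: (rhombic_triacontahedron_case Us conn bip degX degY) => //; exact: c32.
(* Every vertex of [X] has exactly one twin. For [d = 4] this describes a cubic graph with
   subdivided edges and doubled vertices, whose size is not bounded, so it takes a minor rather than
   a count. For [d = 5] the twins would match the five neighbours of [a] in pairs. *)
case: dE => E; exfalso.
  by apply: (no_twins Us Ui conn gm bip degX _ X0 hk htau) => v /degY ->.
pose r : rel V := fun p q => [&& U a p, U a q, q != p & walks2 U p q == 3].
have rs : symmetric r.
  by move=> p q; rewrite /r walks2C // eq_sym; case: (U a p); case: (U a q).
have ri : irreflexive r by move=> p; rewrite /r eqxx !andbF.
have := npairs_edge rs ri; rewrite /npairs -sum1_card big_mkcond /=.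
rewrite -(pair_big predT predT (fun p q => if r p q then 1 else 0)) /=.
rewrite (eq_bigr (fun p => if U a p then 1 else 0)).
  by rewrite -big_mkcond sum1_card -[#|_|]/(degree U a) degY // E; lia.
move=> p _; case: ifP => ap; last by rewrite big1 // => q _; rewrite /r ap.
have Xp : X p by rewrite (bip ap).
have pa : U p a by sd.
by rewrite -big_mkcond sum1_card -[RHS](htau p a Xp pa); apply: eq_card => q; rewrite !inE /r -topredE /= ap.
Qed.
End BipartiteMain.

(** * The stable coloring *)

From mathcomp Require Import finmap multiset.

Section StableColoring.
Variables (V : finType) (E : rel V).
Notation wl := (wl E).
Notation chi := (chi E).

Lemma wl0_color r v w v' w' : wl r (v, w) = wl r (v', w') -> wl 0 (v, w) = wl 0 (v', w').
Proof. by elim: r => // r IH [/IH]. Qed.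

(** Reversal acts on colors: by induction [fl] is well defined on the colors that occur, and it
    carries one multiset to the other while exchanging the entries of each pair. *)
Lemma wl_flip r v w v' w' : wl r (v, w) = wl r (v', w') -> wl r (w, v) = wl r (w', v').
Proof.
elim: r v w v' w' => [|r IH] v w v' w' /=.
  by move=> [e1 e2 e3 e4 e5]; rewrite eq_sym e1 (eq_sym v') e2 e3 e4 e5.
move=> [e1 e2]; rewrite (IH _ _ _ _ e1); congr pair.
pose fl c := if [pick p | wl r p == c] is Some p then wl r (p.2, p.1) else c.
have flE a b : fl (wl r (a, b)) = wl r (b, a).
  by rewrite /fl; case: pickP => [[p q] /eqP /IH|/(_ (a, b))]; rewrite ?eqxx.
apply/eq_seq_msetP; move/eq_seq_msetP: e2 => /(perm_map (fun c => (fl c.2, fl c.1))).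
by rewrite -!map_comp; congr perm_eq; apply: eq_map => u /=; rewrite !flE.
Qed.

Lemma chi_flip v w v' w' : chi (v, w) = chi (v', w') -> chi (w, v) = chi (w', v').
Proof. exact: wl_flip. Qed.

(** By stability equal colors stay equal for one more round, and that round compares the
    multisets. *)
Lemma chi_perm v w v' w' : chi (v, w) = chi (v', w') ->
  perm_eq [seq (chi (u, w), chi (v, u)) | u <- enum V] [seq (chi (u, w'), chi (v', u)) | u <- enum V].
Proof.
move=> e; apply/eq_seq_msetP.
have : wl_stable E (wl_round E) by rewrite /wl_round; case: ex_minnP.
move=> /forallP/(_ (v, w))/forallP/(_ (v', w'))/implyP/(_ (introT eqP e))/eqP.
by case.
Qed.

Definition winv (T : Type) (F : V -> V -> T) : Prop :=
  forall v w v' w', chi (v, w) = chi (v', w') -> F v w = F v' w'.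

Lemma winv_eq : winv (fun v w => v == w).
Proof. by move=> v w v' w' /wl0_color[]. Qed.

Lemma winv_edge : winv E.
Proof. by move=> v w v' w' /wl0_color[]. Qed.

Lemma winv_flip T (F : V -> V -> T) : winv F -> winv (fun v w => F w v).
Proof. by move=> h v w v' w' /chi_flip /h. Qed.

Lemma winv_comb S T R (h : S -> T -> R) (F : V -> V -> S) (G : V -> V -> T) :
  winv F -> winv G -> winv (fun v w => h (F v w) (G v w)).
Proof. by move=> hF hG v w v' w' e; rewrite (hF _ _ _ _ e) (hG _ _ _ _ e). Qed.

(** The multiset of color pairs determines every sum over [u] of a function of two invariants. All
    walk counts arise by iterating this one step. *)
Lemma winv_sum S T (h : S -> T -> nat) (F : V -> V -> S) (G : V -> V -> T) :
  winv F -> winv G -> winv (fun v w => \sum_u h (F v u) (G u w)).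
Proof.
move=> hF hG v w v' w' e.
(* [H] recovers the summand from a pair of colors through chosen representatives; its default 0 is
   not reached on colors that occur. *)
pose H c := if [pick p | chi p == c.1] is Some p then
  if [pick q | chi q == c.2] is Some q then h (F q.1 q.2) (G p.1 p.2) else 0 else 0.
have HE u a b : h (F a u) (G u b) = H (chi (u, b), chi (a, u)).
  rewrite /H /=; case: pickP => [[p1 p2] /eqP/hG /= ->|/(_ (u, b))]; last by rewrite eqxx.
  by case: pickP => [[q1 q2] /eqP/hF /= ->|/(_ (a, u))]; last by rewrite eqxx.
under eq_bigr do rewrite HE; under [RHS]eq_bigr do rewrite HE.
rewrite -[LHS]big_enum -[RHS]big_enum /=.
rewrite -(big_map (fun u => (chi (u, w), chi (v, u))) predT H).
rewrite -(big_map (fun u => (chi (u, w'), chi (v', u))) predT H).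
exact/perm_big/chi_perm.
Qed.

Let U := undirected E.

Lemma winv_U : winv U.
Proof.
move=> v w v' w' e; rewrite /U /undirected /= (winv_edge e).
by rewrite (winv_edge (chi_flip e)).
Qed.

Lemma winv_walks2 : winv (walks2 U).
Proof. exact: (winv_sum (fun a b : bool => a && b) winv_U winv_U). Qed.

Lemma winv_walks3 : winv (walks3 U).
Proof. exact: (winv_sum (fun (a : bool) b => a * b) winv_U winv_walks2). Qed.

Lemma winv_walks5 : winv (walks5 U).
Proof.
have w1 : winv (fun u y => (y != u) && ~~ U u y).
  apply: (winv_comb (fun a b => ~~ a && ~~ b) _ winv_U); exact: (winv_flip winv_eq).
have w2 := winv_comb pair w1 winv_walks3.
exact: (winv_sum (fun a (b : bool) => [&& b & a.1] * a.2) w2 winv_U).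
Qed.

Lemma winv_outdegree : winv (fun v w => \sum_u E v u).
Proof. exact: (winv_sum (fun (a b : bool) => nat_of_bool a) winv_edge winv_edge). Qed.

Lemma winv_indegree : winv (fun v w => \sum_u E u v).
Proof. exact: (winv_sum (fun (a b : bool) => nat_of_bool a) (winv_flip winv_edge) winv_edge). Qed.

Lemma winv_twins : winv (fun x a => #|[pred x' | [&& U a x', x' != x & walks2 U x x' == 3]]|).
Proof.
have w1 : winv (fun x x' => (x' != x) && (walks2 U x x' == 3)).
  apply: (winv_comb (fun a b => ~~ a && (b == 3)) _ winv_walks2); exact: (winv_flip winv_eq).
have := winv_sum (fun a b : bool => nat_of_bool (b && a)) w1 winv_U.
have cardE x a : #|[pred x' | [&& U a x', x' != x & walks2 U x x' == 3]]| =
    \sum_u [&& U u a, u != x & walks2 U x u == 3].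
  rewrite -sum1_card big_mkcond; apply: eq_bigr => u _; rewrite inE /U /undirected /= orbC.
  by case: ifP.
by move=> h v w v' w' /h; rewrite !cardE.
Qed.

Section Trivalent.
Variable X : pred V.
Hypothesis same : forall x y x' y', X x -> X x' -> U x y -> U x' y' -> chi (x, y) = chi (x', y').
Hypothesis degX : forall x, X x -> degree U x = 3.
Variable F : V -> V -> nat.
Hypothesis wF : winv F.
Hypothesis Fs : forall v w, F v w = F w v.

(* Each of the three values on the pairs of neighbours of x is determined by
   the other two in the same way. *)
Lemma trivalent_const : exists k, forall x y y', X x -> U x y -> U x y' -> y != y' -> F y y' = k.
Proof.
pose cnt j x y := \sum_y' [&& U x y', y' != y & F y' y == j].
have wc j : winv (cnt j).
  have w1 : winv (fun y' y => (y' != y) && (F y' y == j)).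
    exact: (winv_comb (fun a b => ~~ a && (b == j)) winv_eq wF).
  exact: (winv_sum (fun a b : bool => nat_of_bool (a && b)) winv_U w1).
have cE j x a b c : X x -> uniq [:: a; b; c] -> (forall w, U x w = (w \in [:: a; b; c])) ->
    cnt j x a = (F a b == j) + (F a c == j).
  move=> Xx; rewrite /= !inE !negb_or => /and3P[/andP[ab ac] bc _] N.
  rewrite /cnt (bigD1 b) //= (bigD1 c) /=; last by rewrite eq_sym.
  rewrite big1 ?addn0.
    by rewrite !N !inE !eqxx !orbT /= (eq_sym b a) ab (eq_sym c a) ac /= (Fs b) (Fs c).
  move=> i /andP[ib ic]; rewrite N !inE (negPf ib) (negPf ic) !orbF.
  by case: eqVneq.
have all_eq x a b c : X x -> uniq [:: a; b; c] -> (forall w, U x w = (w \in [:: a; b; c])) ->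
    F a b = F a c.
  move=> Xx un N.
  have rot1 : forall w, U x w = (w \in [:: b; c; a]).
    by move=> w; rewrite N !inE; case: (w == a); case: (w == b); case: (w == c).
  have rot2 : forall w, U x w = (w \in [:: c; a; b]).
    by move=> w; rewrite N !inE; case: (w == a); case: (w == b); case: (w == c).
  have un1 : uniq [:: b; c; a] by rewrite -(rot_uniq 2).
  have un2 : uniq [:: c; a; b] by rewrite -(rot_uniq 1).
  have [xb xc] : U x b /\ U x c by rewrite !N !inE !eqxx !orbT.
  (* Count the value [F a b] around [b] and around [c]. The term for the pair of [b] and [c] is
     common to both counts, and around [b] the neighbour [a] attains the value, so around [c] it
     does too. *)
  have := wc (F a b) _ _ _ _ (same Xx Xx xb xc).
  rewrite (cE _ _ _ _ _ Xx un1 rot1) (cE _ _ _ _ _ Xx un2 rot2) (Fs b a) (Fs c b) (Fs c a) eqxx.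
  by rewrite addnC => /addIn; case: eqP.
have triple x a b : X x -> U x a -> U x b -> a != b -> exists c,
    uniq [:: a; b; c] /\ forall w, U x w = (w \in [:: a; b; c]).
  move=> Xx xa xb ab; have [h1 h2 h3 h4] := thirdP (degX Xx) xa xb ab.
  exists (third U x a b); split=> //.
  by rewrite /= !inE !negb_or ab eq_sym h2 eq_sym h3.
have [/existsP[x /andP[Xx /existsP[y /existsP[y' /and3P[xy xy' yy']]]]]|none] :=
   boolP [exists x, X x && [exists y, exists y', [&& U x y, U x y' & y != y']]]; last first.
  exists 0 => x y y' Xx xy xy' yy'; case/negP: none; apply/existsP; exists x; rewrite Xx.
  by apply/existsP; exists y; apply/existsP; exists y'; rewrite xy xy' yy'.
exists (F y y') => p q q' Xp pq pq' qq'.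
have [c [un N]] := triple _ _ _ Xx xy xy' yy'; have [c' [un' N']] := triple _ _ _ Xp pq pq' qq'.
have := wc (F y y') _ _ _ _ (same Xx Xp xy pq).
rewrite (cE _ _ _ _ _ Xx un N) (cE _ _ _ _ _ Xp un' N').
rewrite -(all_eq _ _ _ _ Xx un N) -(all_eq _ _ _ _ Xp un' N') eqxx.
by case: eqP.
Qed.
End Trivalent.
End StableColoring.

(** * The case distinction on the orientation of the edges *)

Section Uniform.
Variables (V : finType) (E : rel V).
Let U := undirected E.
Hypothesis E_loopless : irreflexive E.
Hypothesis conn : forall v w, connect U v w.
Hypothesis V0 : 0 < #|V|.
Hypothesis gm : gridmodel (@esrc V U) (@etgt V U).
Hypothesis mindeg : forall v, 3 <= degree U v.
Hypothesis E_uniform : forall v1 w1 v2 w2, E v1 w1 -> E v2 w2 -> chi E (v1, w1) = chi E (v2, w2).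

Let Us : symmetric U.
Proof. by move=> v w; rewrite /U /undirected /= orbC. Qed.
Let Ui : irreflexive U.
Proof. by move=> v; rewrite /U /undirected /= E_loopless. Qed.

Let nbr v : exists w, U v w.
Proof.
have [s [sz us hs]] := degree_enum (erefl (degree U v)).
case: s sz us hs => [|a s] /=; first by move: (mindeg v); case: degree.
by move=> _ _ hs; exists a; rewrite hs inE eqxx.
Qed.

Let edge0 : exists v w, E v w.
Proof.
have /card_gt0P[v _] := V0; have [w /orP[vw|wv]] := nbr v; first by exists v, w.
by exists w, v.
Qed.

Lemma uniform_const T (F : V -> V -> T) : winv E F -> exists k, forall v w, E v w -> F v w = k.
Proof.
have [v [w vw]] := edge0; move=> wF; exists (F v w) => v' w' vw'.
exact/wF/E_uniform.
Qed.

Lemma uniform_sym (F : V -> V -> nat) : winv E F -> (forall v w, F v w = F w v) ->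
  exists k, forall v w, U v w -> F v w = k.
Proof.
move=> wF Fs; have [k hk] := uniform_const wF; exists k => v w /orP[/hk //|/hk <-].
exact: Fs.
Qed.

Lemma regular_deg d : (forall v, degree U v = d) -> 3 <= d <= 5.
Proof.
move=> hd; have /card_gt0P[v _] := V0; have := mindeg v; rewrite hd => d3.
have ne := sum_degree Us Ui hd.
have VE : #|V| < #|edge U| by move: ne V0 d3; nia.
by have := euler3 Us Ui gm V0 VE; move: ne V0 d3; nia.
Qed.

Lemma regular4 : (forall v, degree U v = 4) ->
  graph_iso U octahedron \/ graph_iso U cuboctahedron \/ graph_iso U icosidodecahedron.
Proof.
move=> U4; apply: quartic_main => //.
- exact: uniform_sym (winv_walks2 (E := E)) (walks2C Us).
- exact: uniform_sym (winv_walks3 (E := E)) (walks3C Us).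
- have [k hk] := uniform_const (winv_walks5 (E := E)); exists k => u v /orP[/hk|/hk]; by [left|right].
Qed.

Lemma symmetric_case : symmetric E ->
  (graph_iso E tetrahedron \/ graph_iso E cube \/
   graph_iso E dodecahedron \/ graph_iso E icosahedron) \/
  (graph_iso U octahedron \/ graph_iso U cuboctahedron \/ graph_iso U icosidodecahedron).
Proof.
move=> Es; have EU v w : U v w = E v w by rewrite /U /undirected /= (Es w) orbb.
have isoE (W : finType) (G : rel W) : graph_iso U G -> graph_iso E G.
  by move=> [f bf h]; exists f => // v w; rewrite h EU.
have [d hd] : exists d, forall v, degree U v = d.
  have [o ho] := uniform_const (@winv_outdegree V E); exists o => v.
  have [w] := nbr v; rewrite EU => /ho <-; rewrite /degree -sum1_card big_mkcond.
  by apply: eq_bigr => u _; rewrite inE EU; case: (E v u).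
have d35 := regular_deg hd.
have : d = 3 \/ d = 4 \/ d = 5 by lia.
case=> [d3|[d4|d5]].
- left; have U3 v : degree U v = 3 by rewrite hd.
  have same x y x' y' : predT x -> predT x' -> U x y -> U x' y' -> chi E (x, y) = chi E (x', y').
    by move=> _ _; rewrite !EU; exact: E_uniform.
  have degX x : predT x -> degree U x = 3 by [].
  have [] := cubic_main Us Ui U3 conn V0 gm.
  + have wb : winv E (fun v w => nat_of_bool (U v w)) by move=> v w v' w' /winv_U; rewrite -/U => ->.
    have [|k hk] := trivalent_const same degX wb; first by move=> v w; rewrite Us.
    by exists (k == 1) => v x y vx vy xy; rewrite -(hk v x y) //; case: (U x y).
  + have [|k hk] := trivalent_const same degX (@winv_walks2 V E); first exact: walks2C.
    by exists k => v x y; exact: hk.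
  + have [|k hk] := trivalent_const same degX (@winv_walks3 V E); first exact: walks3C.
    by exists k => v x y; exact: hk.
  + by move/isoE; left.
  + by case=> /isoE h; right; [left|right; left].
- by right; apply: regular4 => v; rewrite hd.
- left; right; right; right; apply: isoE.
  apply: quintic_main => //; first by move=> v; rewrite hd.
  exact: uniform_sym (winv_walks2 (E := E)) (walks2C Us).
Qed.

Section Oriented.
Hypothesis Ea : forall v w, E v w -> ~~ E w v.

Let out v := \sum_u E v u.
Let inn v := \sum_u E u v.

Let degree_out_in v : degree U v = out v + inn v.
Proof.
rewrite /degree -sum1_card big_mkcond -big_split /=; apply: eq_bigr => u _.
by rewrite inE /U /undirected /=; case h : (E v u) => //=; rewrite (negPf (Ea h)).
Qed.

Let out_inn : \sum_v out v = \sum_v inn v.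
Proof. by rewrite exchange_big. Qed.

(** The middle vertex [v] is a head and a tail, so the out-degree is the same at heads and at tails,
    and likewise the in-degree. Their totals agree, so all degrees equal twice the out-degree, and 4
    is the only even value from 3 to 5. *)
Lemma mixed_case v u w : E u v -> E v w ->
  graph_iso U octahedron \/ graph_iso U cuboctahedron \/ graph_iso U icosidodecahedron.
Proof.
move=> uv vw; apply: regular4.
have [o1 ho1] := uniform_const (@winv_outdegree V E).
have [i1 hi1] := uniform_const (@winv_indegree V E).
have [o2 ho2] := uniform_const (winv_flip (@winv_outdegree V E)).
have [i2 hi2] := uniform_const (winv_flip (@winv_indegree V E)).
have eo : o1 = o2 by rewrite -(ho1 _ _ vw) (ho2 _ _ uv).
have ei : i1 = i2 by rewrite -(hi1 _ _ vw) (hi2 _ _ uv).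
have oE x : out x = o1.
  by have [y /orP[xy|yx]] := nbr x; [exact: ho1 xy | rewrite eo; exact: ho2 yx].
have iE x : inn x = i1.
  by have [y /orP[xy|yx]] := nbr x; [exact: hi1 xy | rewrite ei; exact: hi2 yx].
have oi : o1 = i1.
  move: out_inn; under eq_bigr do rewrite oE; under [RHS]eq_bigr do rewrite iE.
  by rewrite !sum_nat_const => /eqP; rewrite eqn_pmul2l // => /eqP.
have dE x : degree U x = 2 * o1 by rewrite degree_out_in oE iE -oi; lia.
by have := regular_deg dE => h x; rewrite dE; lia.
Qed.

Let src := [pred v | [exists w, E v w]].

Lemma bipartite_case : (forall u v w, E u v -> E v w -> False) ->
  graph_iso U cube \/ graph_iso U rhombic_dodecahedron \/ graph_iso U rhombic_triacontahedron.
Proof.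
move=> nmix.
have srcE v w : E v w -> src v /\ ~~ src w.
  move=> vw; split; first by apply/existsP; exists w.
  by apply/negP => /existsP[x wx]; exact: nmix vw wx.
have bip v w : U v w -> src w = ~~ src v.
  by case/orP => /srcE[h1 h2]; rewrite ?h1 ?(negPf h2).
have bip' v w : U v w -> predC src w = ~~ predC src v by move/bip => /= ->.
have Esrc v w : src v -> U v w -> E v w.
  by move=> sv /orP[//|/srcE[_]]; rewrite sv.
have Etgt v w : ~~ src v -> U v w -> E w v.
  by move=> sv /orP[/srcE[h _]|//]; rewrite h in sv.
have same x y x' y' : src x -> src x' -> U x y -> U x' y' -> chi E (x, y) = chi E (x', y').
  by move=> sx sx' xy xy'; apply: E_uniform; apply: Esrc.
have same' x y x' y' : predC src x -> predC src x' -> U x y -> U x' y' ->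
    chi E (x, y) = chi E (x', y').
  by move=> sx sx' xy xy'; apply/chi_flip/E_uniform; apply: Etgt.
have const (X : pred V) T (F : V -> V -> T) :
    (forall x y x' y', X x -> X x' -> U x y -> U x' y' -> chi E (x, y) = chi E (x', y')) ->
    (exists x, X x) -> winv E F -> exists k, forall x y, X x -> U x y -> F x y = k.
  move=> sm [x Xx] wF; have [y xy] := nbr x; exists (F x y) => x' y' Xx' xy'.
  exact/wF/sm.
have [v0 [w0 vw0]] := edge0; have [sv0 nsw0] := srcE _ _ vw0.
have exs : exists x, src x by exists v0.
have ext : exists x, predC src x by exists w0.
have wdeg : winv E (fun v w => degree U v).
  move=> v w v' w' e; rewrite !degree_out_in.
  by rewrite /out /inn (winv_outdegree e) (winv_indegree e).
have [a ha] := const src _ _ same exs wdeg; have [b hb] := const (predC src) _ _ same' ext wdeg.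
have degX v : src v -> degree U v = a by move=> sv; have [w vw] := nbr v; exact: (ha v w).
have degY v : ~~ src v -> degree U v = b by move=> sv; have [w vw] := nbr v; exact: (hb v w).
have a3 : 3 <= a by rewrite -(degX _ sv0).
have b3 : 3 <= b by rewrite -(degY _ nsw0).
have [e1 e2] := bip_count Us Ui bip degX degY; have e3 := cardC src.
have VE : #|V| < #|edge U|.
  by move: e1 e2 e3 V0 a3 b3; move: #|src| #|predC src| #|V| #|edge U| => p q r s; nia.
have eu := euler4 Us Ui gm V0 VE (bip_noC3 bip).
(* Two degrees of at least 4, or degree 3 against more than 5, leave too many edges for [euler4]. *)
have ab : (a = 3 /\ b <= 5) \/ (b = 3 /\ a <= 5).
  move: e1 e2 e3 V0 a3 b3 eu; move: #|src| #|predC src| #|V| #|edge U| => p q r s *.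
  have [a4|a4] := leqP 4 a; have [b4|b4] := leqP 4 b; nia.
case: ab => -[E3 le5].
- rewrite E3 in degX; apply: (bipartite_main Us Ui conn V0 gm bip degX degY); first by rewrite b3.
  + by apply: (trivalent_const same degX) (@winv_walks2 V E) _; exact: walks2C.
  + move=> b3'; rewrite b3' in degY.
    by apply: (trivalent_const same' degY) (@winv_walks2 V E) _; exact: walks2C.
  + exact: const same exs (@winv_twins V E).
- rewrite E3 in degY.
  have degX' v : ~~ predC src v -> degree U v = a by rewrite negbK; exact: degX.
  apply: (bipartite_main Us Ui conn V0 gm bip' degY degX'); first by rewrite a3.
  + by apply: (trivalent_const same' degY) (@winv_walks2 V E) _; exact: walks2C.
  + move=> a3'; rewrite a3' in degX.
    have [|k hk] := trivalent_const same degX (@winv_walks2 V E); first exact: walks2C.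
    by exists k => x y y' /negPn; exact: hk.
  + exact: const same' ext (@winv_twins V E).
Qed.
End Oriented.

Lemma uniform_main :
  (graph_iso E tetrahedron \/ graph_iso E cube \/
   graph_iso E dodecahedron \/ graph_iso E icosahedron) \/
  (graph_iso U octahedron \/ graph_iso U cuboctahedron \/ graph_iso U icosidodecahedron) \/
  (graph_iso U cube \/ graph_iso U rhombic_dodecahedron \/ graph_iso U rhombic_triacontahedron).
Proof.
have [/existsP[v /existsP[w /andP[vw wv]]]|none] := boolP [exists v, exists w, E v w && E w v].
  (* One edge present in both directions makes every edge so, because colors of reversed pairs agree
     too. *)
  have Es : symmetric E.
    have sub a b : E a b -> E b a.
      by move=> ab; rewrite (winv_edge (chi_flip (E_uniform ab vw))).
    by move=> a b; apply/idP/idP; exact: sub.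
  by have [h|h] := symmetric_case Es; [left|right; left].
have Ea v w : E v w -> ~~ E w v.
  move=> vw; apply: contra none => wv; apply/existsP; exists v; apply/existsP; exists w.
  by rewrite vw wv.
right; have [/existsP[u /existsP[v /existsP[w /andP[uv vw]]]]|nmix] :=
    boolP [exists u, exists v, exists w, E u v && E v w].
  by left; exact: (mixed_case Ea uv vw).
right; apply: (bipartite_case Ea) => u v w uv vw; case/negP: nmix.
by apply/existsP; exists u; apply/existsP; exists v; apply/existsP; exists w; rewrite uv vw.
Qed.
End Uniform.

(** * From plane drawings to lattice models *)

From mathcomp Require Import all_classical all_reals all_analysis.

Import numFieldNormedType.Exports.

Local Open Scope classical_set_scope.
Local Open Scope ring_scope.

Lemma step_row (x x' y : nat) : (x <= x'.+1)%N -> (x' <= x.+1)%N ->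
  step (x, y) (x', y).
Proof.
move=> h1 h2; have [->|[->|->]] : x' = x \/ x' = x.+1 \/ x = x'.+1 by lia.
- by rewrite /step eqxx.
- by rewrite /step /adj4 /rgt eqxx orbT.
- by rewrite /step /adj4 /rgt eqxx !orbT.
Qed.

Lemma step_col (x y y' : nat) : (y <= y'.+1)%N -> (y' <= y.+1)%N ->
  step (x, y) (x, y').
Proof.
move=> h1 h2; have [->|[->|->]] : y' = y \/ y' = y.+1 \/ y = y'.+1 by lia.
- by rewrite /step eqxx.
- by rewrite /step /adj4 /up eqxx !orbT.
- by rewrite /step /adj4 /up eqxx !orbT.
Qed.

Section Topology.
Variable R : realType.

(** Prolongs an arc from [[0, 1]] to the whole line, so that its continuity becomes global. *)
Definition clamp (t : R) : R := Num.max 0 (Num.min 1 t).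

Lemma clamp_in t : 0 <= clamp t <= 1.
Proof.
rewrite /clamp le_max lexx /= ge_max ler01 /=.
by rewrite ge_min lexx.
Qed.

Lemma clamp_id t : 0 <= t <= 1 -> clamp t = t.
Proof. by case/andP=> t0 t1; rewrite /clamp min_r // max_r. Qed.

Lemma clamp_continuous : continuous clamp.
Proof.
move=> t; apply: (@continuous_max R R (cst 0) (fun t => Num.min 1 t)).
  exact: cvg_cst.
apply: (@continuous_min R R (cst 1) id); first exact: cvg_cst.
exact: cvg_id.
Qed.

Lemma clamp_comp_continuous (g : R -> R * R) :
  {within `[0, 1], continuous g} -> continuous (g \o clamp).
Proof.
move=> /subspace_continuousP gc t.
have cin s : `[0, 1]%classic (clamp s) by rewrite /= in_itv /= clamp_in.
apply: (@cvg_comp _ _ _ clamp g _ (within `[0, 1] (nbhs (clamp t)))); last exact: gc.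
move=> B; rewrite /within/= => h.
apply: (@filterS _ (nbhs t) _ (clamp @^-1` [set x | x \in `[0, 1] -> B x])).
  by move=> s /= hs; apply: hs; exact: cin.
exact: (@clamp_continuous t _ h).
Qed.

Lemma compact_pos_min (A : set (R * R)) (f : R * R -> R) : compact A ->
  continuous f -> (forall q, A q -> 0 < f q) ->
  exists2 d, 0 < d & forall q, A q -> d <= f q.
Proof.
move=> cA cf fpos; have [->|/set0P A0] := eqVneq A set0.
  by exists 1; rewrite ?ltr01.
have [c cin cmin] := compact_EVT_min A0 cA (continuous_subspaceT cf).
exists (f c); first by apply: fpos; rewrite inE in cin.
by move=> q Aq; apply: cmin; rewrite inE.
Qed.

Lemma dist_continuous (g h : R -> R * R) : continuous g -> continuous h ->
  continuous (fun q : R * R => `|g q.1 - h q.2| : R).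
Proof.
move=> gc hc q.
apply: (@cvg_norm _ (R * R)%type).
apply: (@cvgB R (R * R)%type).
  apply: (@cvg_comp _ _ _ fst g _ (nbhs q.1)); [exact: cvg_fst|exact: gc].
apply: (@cvg_comp _ _ _ snd h _ (nbhs q.2)); [exact: cvg_snd|exact: hc].
Qed.

Lemma dist_segments (g h : R -> R * R) (a b c d : R) :
  continuous g -> continuous h ->
  (forall s t, a <= s <= b -> c <= t <= d -> g s <> h t) ->
  exists2 r, 0 < r & forall s t, a <= s <= b -> c <= t <= d -> r <= `|g s - h t|.
Proof.
move=> gc hc ne.
have [||r r0 hr] := @compact_pos_min (`[a, b] `*` `[c, d])
    (fun q => `|g q.1 - h q.2|) _ (dist_continuous gc hc).
- by apply: compact_setX; apply: segment_compact.
- move=> [s t] /= []; rewrite !in_itv /= => hs ht.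
  by rewrite normr_gt0 subr_eq0; apply/eqP; exact: ne.
exists r => // s t hs ht; apply: (hr (s, t)).
by split; rewrite /= in_itv.
Qed.

(** The pairs of parameters with images at distance at least [r] form a compact set off the
    diagonal, on which [|s - t|] has a positive minimum. *)
Lemma unif_segment (g : R -> R * R) (r : R) : continuous g -> 0 < r ->
  exists2 d, 0 < d & forall s t, 0 <= s <= 1 -> 0 <= t <= 1 ->
    `|s - t| < d -> `|g s - g t| < r.
Proof.
move=> gc r0.
pose A := (`[0, 1] `*` `[0, 1]) `&` [set q : R * R | r <= `|g q.1 - g q.2| ].
have [|||d d0 hd] := @compact_pos_min A (fun q => `|q.1 - q.2|).
- apply: compact_closedI; first by apply: compact_setX; apply: segment_compact.
  apply: (@preimage_closed _ _ (fun q : R * R => `|g q.1 - g q.2| : R) [set x | r <= x]).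
    by move=> q _; apply: dist_continuous.
  exact: closed_ge.
- move=> q; apply: (@cvg_norm _ R); apply: (@cvgB R R); [exact: cvg_fst|exact: cvg_snd].
- move=> [s t] /= [_ hr]; rewrite normr_gt0 subr_eq0; apply/eqP => E.
  by move: hr => /=; rewrite E subrr normr0 leNgt r0.
exists d => // s t hs ht; rewrite ltNge => hd'; rewrite ltNge; apply/negP => hr.
by case/negP: hd'; apply: (hd (s, t)); split => //=; split; rewrite /= in_itv.
Qed.

Lemma bounded_segment (g : R -> R * R) : continuous g ->
  exists2 d, 0 < d & forall t, 0 <= t <= 1 -> `|g t| * d <= 1.
Proof.
move=> gc.
have [|c _ hc] := @EVT_max R (fun t => `|g t|) 0 1 ler01.
  by apply: continuous_subspaceT => t; apply: (@cvg_norm _ (R * R)%type); exact: gc.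
exists (`|g c| + 1)^-1; first by rewrite invr_gt0 ltr_wpDl.
move=> t ht; rewrite ler_pdivrMr ?ltr_wpDl // mul1r.
by apply: le_trans (hc t _) _; rewrite ?in_itv //= lerDl.
Qed.

Lemma fin_common (T : finType) (P : T -> R -> Prop) :
  (forall x, exists2 d, 0 < d & P x d) ->
  (forall x d d', 0 < d' -> d' <= d -> P x d -> P x d') ->
  exists2 d, 0 < d & forall x, P x d.
Proof.
move=> ex mono.
suff [d d0 hd] : exists2 d, 0 < d & forall x, x \in enum T -> P x d.
  by exists d => // x; apply: hd; rewrite mem_enum.
elim: (enum T) => [|x s [d d0 hd]]; first by exists 1.
have [d' d'0 hd'] := ex x; exists (Num.min d d'); first by rewrite lt_min d0.
move=> y; rewrite inE => /orP[/eqP ->|ys].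
  by apply: mono hd'; rewrite ?lt_min ?d0 // ge_min lexx orbT.
by apply: mono (hd _ ys); rewrite ?lt_min ?d0 // ge_min lexx.
Qed.

Lemma trunc_near (x y : R) : 0 <= x -> 0 <= y -> `|x - y| < 1 ->
  (Num.trunc x <= (Num.trunc y).+1)%N.
Proof.
move=> x0 y0; rewrite ltr_norml => /andP[h1 h2].
have /andP[hx hx'] := truncn_itv x0; have /andP[hy hy'] := truncn_itv y0.
rewrite -ltnS -(ltr_nat R); move: hx hx' hy hy'.
rewrite -[(Num.trunc y).+2]addn2 -[(Num.trunc y).+1]addn1 !natrD; lra.
Qed.

Lemma trunc_far (x y : R) : 0 <= x -> 0 <= y ->
  (Num.trunc x <= (Num.trunc y).+2)%N -> (Num.trunc y <= (Num.trunc x).+2)%N ->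
  `|x - y| < 3.
Proof.
move=> x0 y0.
have /andP[hx hx'] := truncn_itv x0; have /andP[hy hy'] := truncn_itv y0.
rewrite -!(ler_nat R) ltr_norml; move: hx hx' hy hy'.
rewrite -[(Num.trunc y).+2]addn2 -[(Num.trunc y).+1]addn1.
rewrite -[(Num.trunc x).+2]addn2 -[(Num.trunc x).+1]addn1 !natrD.
by move=> *; apply/andP; split; lra.
Qed.

(** * Arcs traced on a fine square lattice *)

Section Lattice.
Variables (V I : finType) (src tgt : I -> V) (g : I -> R -> R * R) (p : V -> R * R).
Hypothesis src_neq_tgt : forall e, src e != tgt e.
Hypothesis g_cont : forall e, continuous (g e).
Hypothesis g0 : forall e, g e 0 = p (src e).
Hypothesis g1 : forall e, g e 1 = p (tgt e).
Definition endp e (s : R) v := (s = 0 /\ v = src e) \/ (s = 1 /\ v = tgt e).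
Hypothesis g_disj : forall e e' s t, 0 <= s <= 1 -> 0 <= t <= 1 ->
  g e s = g e' t -> (e = e' /\ s = t) \/ exists v, endp e s v /\ endp e' t v.

(** The thirds of an arc: near the source, inner, near the target. Values above 2 also give the
    target, since the last sample of an arc falls into zone 3. *)
Definition ztag (e : I) (z : nat) : V + I :=
  if z is 0%N then inl (src e) else if z is 1%N then inr e else inl (tgt e).

Definition zone (z : nat) (s : R) := z%:R / 3 <= s <= z.+1%:R / 3.

(** Distinct arcs meet only in common ends, and an arc meets itself only at equal parameters or in
    an end; closed thirds overlap only when consecutive, and consecutive tags are compatible. *)
Lemma zones_disjoint e e' z z' s t : (z < 3)%N -> (z' < 3)%N ->
  zone z s -> zone z' t -> g e s = g e' t ->
  compat src tgt (ztag e z) (ztag e' z').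
Proof.
move=> hz hz'; rewrite /zone => hs ht E.
have s01 : 0 <= s <= 1.
  by move: hs; case: z hz => [|[|[|]]] //= _ /andP[]; lra.
have t01 : 0 <= t <= 1.
  by move: ht; case: z' hz' => [|[|[|]]] //= _ /andP[]; lra.
have [[-> st]|[v [h h']]] := g_disj s01 t01 E.
  rewrite -st in ht; move: hs ht; clear E g_disj g0 g1 g_cont.
  case: z hz => [|[|[|]]] //= _; case: z' hz' => [|[|[|]]] //= _ /andP[? ?] /andP[? ?];
    rewrite ?eqxx ?orbT //; exfalso; lra.
have key e1 z1 s1 : (z1 < 3)%N -> z1%:R / 3 <= s1 <= z1.+1%:R / 3 -> endp e1 s1 v ->
    ztag e1 z1 = inl v.
  move=> hz1 /andP[l1 l2] [[s0 ->]|[s0 ->]]; rewrite s0 in l1 l2 *;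
  by case: z1 hz1 l1 l2 => [|[|[|]]] //= _ l1 l2; exfalso; lra.
by rewrite (key e z s) // (key e' z' t) //=.
Qed.

Lemma zone_time (m k : nat) : (0 < m)%N -> (k <= 3 * m)%N ->
  zone (minn 2 (k %/ m)) (k%:R / (3 * m)%:R).
Proof.
move=> m0 km; rewrite /zone natrM.
have m0' : 0 < m%:R :> R by rewrite ltr0n.
have -> : k%:R / (3%:R * m%:R) = k%:R / m%:R / 3 :> R.
  by rewrite invfM mulrA mulrAC.
rewrite !ler_pM2r ?invr_gt0 // ler_pdivlMr // ler_pdivrMr //.
rewrite -!natrM !ler_nat; clear m0' g_disj.
have h1 := leq_divM k m; have h2 := ltn_ceil k m0.
have [q2|q2] := leqP (k %/ m) 2.
  by rewrite h1 ltnW.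
by rewrite km andbT (leq_trans _ h1) // leq_mul2r ltnW ?orbT.
Qed.

Lemma zone_lt (m k : nat) : (minn 2 (k %/ m) < 3)%N.
Proof. by rewrite ltnS geq_minl. Qed.

(** [d] separates incompatible zones, the mesh [1 / M] is less than [d / 3], and sampling is so fine
    that consecutive samples move by less than one mesh. A square shared by two walks then comes
    from samples closer than [d], hence from compatible zones. *)
Theorem arcs_gridmodel : gridmodel src tgt.
Proof.
have [d d0 hd] : exists2 d, 0 < d & forall x : I * 'I_3 * (I * 'I_3),
   ~~ compat src tgt (ztag x.1.1 x.1.2) (ztag x.2.1 x.2.2) ->
   forall s t, zone x.1.2 s -> zone x.2.2 t -> d <= `|g x.1.1 s - g x.2.1 t|.
  apply: fin_common => [[[e z] [e' z']] /=|x r r' r0 rr' h nc s t hs ht]; last first.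
    exact: le_trans rr' (h nc s t hs ht).
  have [c|nc] := boolP (compat src tgt (ztag e z) (ztag e' z')).
    by exists 1.
  have [|r r0 hr] := @dist_segments (g e) (g e') (z%:R / 3) (z.+1%:R / 3)
     (z'%:R / 3) (z'.+1%:R / 3) (@g_cont e) (@g_cont e').
    move=> s t hs ht E; case/negP: nc.
    exact: (zones_disjoint (ltn_ord z) (ltn_ord z') hs ht E).
  by exists r.
pose M := (Num.trunc (3 / d)).+1.
have hM : 3 < M%:R * d.
  have /andP[_] : (Num.trunc (3 / d))%:R <= 3 / d < M%:R.
    by apply: truncn_itv; rewrite divr_ge0 // ltW.
  by rewrite ltr_pdivrMr.
have M0 : 0 < M%:R :> R by rewrite ltr0n.
have [eta eta0 heta] : exists2 r, 0 < r & forall e, forall s t : R,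
    0 <= s <= 1 -> 0 <= t <= 1 -> `|s - t| < r -> `|g e s - g e t| < M%:R^-1.
  apply: fin_common => [e|e r r' r0 rr' h s t hs ht st].
    by apply: unif_segment => //; rewrite invr_gt0.
  by apply: h => //; apply: lt_le_trans rr'.
have [b b0 hb] : exists2 r, 0 < r & forall e, forall t : R,
    0 <= t <= 1 -> `|g e t| * r <= 1.
  apply: fin_common => [e|e r r' r0 rr' h t ht]; first exact: bounded_segment.
  by apply: le_trans (h t ht); apply: ler_wpM2l.
(* The arcs stay within [B - 1], so adding [B] makes all coordinates at least 1 and keeps the cells
   off row and column 0. *)
pose B := (Num.trunc (b^-1)).+2.
have hB e t : 0 <= t <= 1 -> `|g e t| <= B%:R - 1.
  move=> ht; have := hb e t ht; rewrite -ler_pdivlMr // mul1r => h.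
  have /andP[_ h'] : (Num.trunc b^-1)%:R <= b^-1 < (Num.trunc b^-1).+1%:R.
    by apply: truncn_itv; rewrite invr_ge0 ltW.
  by rewrite /B -natr1 addrK; apply: le_trans h (ltW h').
pose m := (Num.trunc (eta^-1)).+1.
have hm : m%:R^-1 < eta.
  have /andP[_ h'] : (Num.trunc eta^-1)%:R <= eta^-1 < m%:R.
    by apply: truncn_itv; rewrite invr_ge0 ltW.
  by rewrite invf_plt ?posrE ?ltr0n.
pose n3 := (3 * m)%N.
have n30 : 0 < n3%:R :> R by rewrite ltr0n.
pose tm (k : nat) : R := k%:R / n3%:R.
have tm01 k : (k <= n3)%N -> 0 <= tm k <= 1.
  move=> hk; rewrite /tm divr_ge0 //= ler_pdivrMr // mul1r ler_nat //.
pose cc (x : R) : nat := Num.trunc (M%:R * (x + B%:R)).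
pose cell (q : R * R) : pt := (cc q.1, cc q.2).
have n1 (q : R * R) : `|q.1| <= `|q| by rewrite prod_normE le_max lexx.
have n2 (q : R * R) : `|q.2| <= `|q| by rewrite prod_normE le_max lexx orbT.
pose okx (x : R) := `|x| <= B%:R - 1.
have ok1 e k : (k <= n3)%N -> okx (g e (tm k)).1.
  by move=> hk; apply: le_trans (n1 _) (hB _ _ (tm01 k hk)).
have ok2 e k : (k <= n3)%N -> okx (g e (tm k)).2.
  by move=> hk; apply: le_trans (n2 _) (hB _ _ (tm01 k hk)).
have pos x : okx x -> 1 <= x + B%:R.
  by rewrite /okx ler_norml => /andP[h _]; lra.
have Mge1 : 1 <= M%:R :> R by rewrite ler1n.
have mpos x : okx x -> 1 <= M%:R * (x + B%:R).
  by move=> /pos h; apply: mulr_ege1.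
have mpos0 x : okx x -> 0 <= M%:R * (x + B%:R).
  by move=> /mpos; apply: le_trans.
have cc_near x y : okx x -> okx y -> `|x - y| < M%:R^-1 -> (cc x <= (cc y).+1)%N.
  move=> hx hy h; apply: trunc_near; rewrite ?mpos0 //.
  have -> : M%:R * (x + B%:R) - M%:R * (y + B%:R) = M%:R * (x - y) by ring.
  by rewrite normrM (ger0_norm (ltW M0)) -ltr_pdivlMl // mulr1.
have cc_far x y : okx x -> okx y -> (cc x <= (cc y).+2)%N -> (cc y <= (cc x).+2)%N ->
    `|x - y| < d.
  move=> hx hy h1 h2.
  have := trunc_far (mpos0 _ hx) (mpos0 _ hy) h1 h2.
  have -> : M%:R * (x + B%:R) - M%:R * (y + B%:R) = M%:R * (x - y) by ring.
  rewrite normrM (ger0_norm (ltW M0)) => h.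
  by rewrite -(ltr_pM2l M0); apply: lt_trans h hM.
pose N := (M * (2 * B)).+1.
have cc_box x : okx x -> (0 < cc x < N)%N.
  move=> hx; have /andP[h1 h2] := truncn_itv (mpos0 _ hx); apply/andP; split.
    rewrite lt0n; apply/eqP => E.
    have := mpos _ hx; rewrite -/(cc x) in h2; rewrite E in h2.
    by move=> h; have := le_lt_trans h h2; rewrite ltxx.
  rewrite ltnS -(ler_nat R); apply: le_trans h1 _.
  rewrite natrM ler_wpM2l ?ltW // natrM.
  by move: hx; rewrite /okx ler_norml => /andP[_]; lra.
have near e k : (k < n3)%N -> `|g e (tm k) - g e (tm k.+1)| < M%:R^-1.
  move=> hk; apply: heta; rewrite ?tm01 //; first exact: ltnW.
  rewrite /tm -mulrBl -natr1 opprD addrA subrr sub0r mulN1r normrN.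
  rewrite ger0_norm ?invr_ge0 ?ltW //; apply: le_lt_trans hm.
  by rewrite lef_pV2 ?posrE ?ltr0n // ler_nat /n3; lia.
have near1 e k : (k < n3)%N -> `|(g e (tm k)).1 - (g e (tm k.+1)).1| < M%:R^-1.
  by move=> hk; apply: le_lt_trans (near e k hk); exact: (n1 (g e (tm k) - g e (tm k.+1))).
have near2 e k : (k < n3)%N -> `|(g e (tm k)).2 - (g e (tm k.+1)).2| < M%:R^-1.
  by move=> hk; apply: le_lt_trans (near e k hk); exact: (n2 (g e (tm k) - g e (tm k.+1))).
pose c e k := cell (g e (tm k)).
have c1 e k : (k < n3)%N -> ((c e k).1 <= (c e k.+1).1.+1)%N /\ ((c e k.+1).1 <= (c e k).1.+1)%N.
  move=> hk; have o1 := ok1 e k (ltnW hk); have o2 := ok1 e k.+1 hk.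
  by split; [apply: cc_near => //; exact: near1
    | apply: cc_near => //; rewrite distrC; exact: near1].
have c2 e k : (k < n3)%N -> ((c e k).2 <= (c e k.+1).2.+1)%N /\ ((c e k.+1).2 <= (c e k).2.+1)%N.
  move=> hk; have o1 := ok2 e k (ltnW hk); have o2 := ok2 e k.+1 hk.
  by split; [apply: cc_near => //; exact: near2
    | apply: cc_near => //; rewrite distrC; exact: near2].
(* Consecutive cells may differ diagonally. Odd positions insert the cell that moves in the first
   coordinate only, which doubles the number of steps. *)
pose a e j : pt := if odd j then ((c e j./2.+1).1, (c e j./2).2) else c e j./2.
pose tg e j := ztag e (j./2 %/ m).
have m0 : (0 < m)%N by [].
have a_close e j : (j <= n3.*2)%N ->
    [/\ (j./2 <= n3)%N, ((a e j).1 <= (c e j./2).1.+1)%N, ((c e j./2).1 <= (a e j).1.+1)%N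
     & (a e j).2 = (c e j./2).2].
  move=> hj; rewrite /a; case: (boolP (odd j)) => oj /=.
    have hk : (j./2 < n3)%N by lia.
    have [? ?] := c1 e _ hk; split=> //; exact: ltnW.
  by split=> //; lia.
apply: (@zones_gridmodel _ _ _ _ src_neq_tgt n3.*2 N a tg (fun v => cell (p v))).
- move=> e j hj; rewrite /a /= uphalf_half.
  have hk : (j./2 < n3)%N by lia.
  have [h1 h2] := c1 e _ hk; have [h3 h4] := c2 e _ hk.
  case: (boolP (odd j)) => oj /=; rewrite ?add1n ?add0n.
    by rewrite [c e j./2.+1]surjective_pairing; exact: step_col.
  by rewrite [X in step X _]surjective_pairing; exact: step_row.
- move=> e j hj; have [hk _ _ ->] := a_close e j hj.
  rewrite (cc_box _ (ok2 e _ hk)) andbT /a; case: ifP => oj /=.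
    by apply/cc_box/ok1; lia.
  exact/cc_box/ok1.
- move=> e j; rewrite /tg; case: (_ %/ _)%N => [|[|z]] /=;
    [exact: Or31|exact: Or32|exact: Or33].
- by move=> e; rewrite /tg; have -> : (0./2 %/ m)%N = 0%N by apply: div0n.
- by move=> e; rewrite /tg doubleK /n3 mulnK.
- move=> e i j ij; rewrite /tg.
  have : (i./2 %/ m <= j./2 %/ m)%N by apply/leq_div2r/half_leq.
  have := src_neq_tgt e; move: (i./2 %/ m)%N (j./2 %/ m)%N.
  by move=> [|[|z]] [|[|z']] //= + _ [] E; rewrite E eqxx.
- move=> e i j ij; rewrite /tg.
  have : (i./2 %/ m <= j./2 %/ m)%N by apply/leq_div2r/half_leq.
  have := src_neq_tgt e; move: (i./2 %/ m)%N (j./2 %/ m)%N.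
  by move=> [|[|z]] [|[|z']] //= + _ [] E; rewrite E eqxx.
- move=> e j e' j' hj hj' E.
  (* Each walk position lies within one column of the cell of its sample, so the two samples are at
     most two columns apart, which is the tolerance of [cc_far]. *)
  have [hk u1 u2 u3] := a_close e j hj; have [hk' w1 w2 w3] := a_close e' j' hj'.
  apply/negPn/negP => nc.
  have tgE e1 k : ztag e1 (k %/ m) = ztag e1 (Ordinal (zone_lt m k)).
    by rewrite /=; case: (k %/ m)%N => [|[|[|z]]].
  have := hd (e, Ordinal (zone_lt m j./2), (e', Ordinal (zone_lt m j'./2))).
  rewrite /= -!tgE -/(tg e j) -/(tg e' j') => /(_ nc (tm j./2) (tm j'./2)).
  move=> /(_ (zone_time m0 hk) (zone_time m0 hk')); rewrite leNgt => /negP; apply.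
  rewrite prod_normE gt_max; apply/andP; split => /=.
    rewrite E in u1 u2.
    have w1' : ((a e' j').1.+1 <= (c e' j'./2).1.+2)%N by [].
    have u1' : ((a e' j').1.+1 <= (c e j./2).1.+2)%N by [].
    by apply: cc_far; rewrite ?ok1 //; [exact: (leq_trans u2 w1')|exact: (leq_trans w2 u1')].
  have e2 : cc (g e (tm j./2)).2 = cc (g e' (tm j'./2)).2.
    by move: u3; rewrite E w3 /c /cell /= => ->.
  by apply: cc_far; rewrite ?ok2 // e2; exact: leqW (leqnSn _).
- by move=> e; rewrite /a /= /c /tm mul0r g0.
- by move=> e; rewrite /a odd_double doubleK /c /tm divff ?g1 // gt_eqF.
Qed.
End Lattice.

Theorem planar_gridmodel (V : finType) (E : rel V) :
  planar R E -> gridmodel (@esrc V (undirected E)) (@etgt V (undirected E)).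
Proof.
case=> p [A [pinj arc onv cross]].
have Ue (e : edge (undirected E)) : undirected E (esrc e) (etgt e).
  by case/andP: (valP e).
have rk (e : edge (undirected E)) : (enum_rank (esrc e) < enum_rank (etgt e))%N.
  by case/andP: (valP e).
have nst (e : edge (undirected E)) : esrc e != etgt e.
  by apply/eqP => h; have := rk e; rewrite h ltnn.
have /choice[g hg] : forall e : edge (undirected E), exists g : R -> R * R,
    [/\ {within `[0, 1], continuous g}, {in `[0, 1] &, injective g},
      g 0 = p (esrc e), g 1 = p (etgt e) & A (esrc e) (etgt e) = g @` `[0, 1]].
  by move=> e; have [[g hg] _] := arc _ _ (Ue e); exists g.
have i01 (s : R) : 0 <= s <= 1 -> s \in `[0, 1] by rewrite in_itv.
have cl0 : clamp 0 = 0 by rewrite clamp_id ?lexx ?ler01.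
have cl1 : clamp 1 = 1 by rewrite clamp_id ?lexx ?ler01.
apply: (@arcs_gridmodel _ _ _ _ (fun e => g e \o clamp) p nst).
- by move=> e; have [gc _ _ _ _] := hg e; apply: clamp_comp_continuous.
- by move=> e; have [_ _ g0 _ _] := hg e; rewrite /= cl0.
- by move=> e; have [_ _ _ g1 _] := hg e; rewrite /= cl1.
move=> e e' s t hs ht /=; rewrite !clamp_id //= => gst.
have [_ inj g0 g1 AE] := hg e; have [_ inj' g0' g1' AE'] := hg e'.
have As : A (esrc e) (etgt e) (g e s) by rewrite AE; exists s; rewrite //= i01.
have As' : A (esrc e') (etgt e') (g e s) by rewrite AE' gst; exists t; rewrite //= i01.
have [h|h|[v [hv hv' gv]]] := cross _ _ _ _ _ (Ue e) (Ue e') As As'.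
- left; have ee' : e = e'.
    by apply: val_inj; rewrite [val e]surjective_pairing [val e']surjective_pairing.
  by split=> //; apply: inj; rewrite ?i01 // gst ee'.
(* Edges are listed once, with their ends in the order of [enum_rank], so no edge is the reverse of
   another. *)
- case: h => h1 h2; have := rk e; have := rk e'; rewrite h1 h2 => l1 l2.
  by have := ltn_trans l1 l2; rewrite ltnn.
right; exists v; split.
  case: hv => hv; [left|right]; split=> //; apply: inj; rewrite ?i01 ?lexx ?ler01 //.
    by rewrite gv hv g0.
  by rewrite gv hv g1.
case: hv' => hv'; [left|right]; split=> //; apply: inj'; rewrite ?i01 ?lexx ?ler01 //.
  by rewrite -gst gv hv' g0'.
by rewrite -gst gv hv' g1'.
Qed.
End Topology.

Local Close Scope ring_scope.
Local Close Scope classical_set_scope.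

Theorem theorem8 (R : realType) (V : finType) (E : rel V)
    (E_loopless : irreflexive E)
    (E_connected : connected_graph E)
    (E_planar : planar R E)
    (E_mindeg : forall v : V, (3 <= deg E v)%N)
    (E_uniform : forall v1 w1 v2 w2 : V, E v1 w1 -> E v2 w2 ->
       chi E (v1, w1) = chi E (v2, w2)) :
  (graph_iso E tetrahedron \/ graph_iso E cube \/
   graph_iso E dodecahedron \/ graph_iso E icosahedron) \/
  (graph_iso (undirected E) octahedron \/
   graph_iso (undirected E) cuboctahedron \/
   graph_iso (undirected E) icosidodecahedron) \/
  (graph_iso (undirected E) cube \/
   graph_iso (undirected E) rhombic_dodecahedron \/
   graph_iso (undirected E) rhombic_triacontahedron).
Proof.
case: E_connected => V0 conn.
exact: uniform_main E_loopless conn V0 (planar_gridmodel E_planar) E_mindeg E_uniform.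
Qed.
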